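(* Let assumptions (A0)–(A6) (listed in the context) hold. Then for any $\phi(0)\in H^1(\Omega)$, $\mathbf u(0)\in H^1(\Omega)^d$ and any $h,\tau>0$, the fully discrete problem (P) (stated in the context) has at least one solution $(\phi_{h,\tau},\bar\mu_{h,\tau},\mathbf u_{h,\tau},\bar p_{h,\tau})$. Moreover, any solution of (P) satisfies $$\int_\Omega \phi_{h,\tau}(t^n)\,dx=\int_\Omega\phi_{h,\tau}(t^m)\,dx$$ and $$\mathcal E(\phi_{h,\tau}(t^n),\mathbf u_{h,\tau}(t^n))+\int_{t^m}^{t^n}\mathcal D_{\bar\phi_{h,\tau}}(\bar\mu_{h,\tau},\bar{\mathbf u}_{h,\tau})\,ds=\mathcal E(\phi_{h,\tau}(t^m),\mathbf u_{h,\tau}(t^m))$$ for all discrete time points $t^m\le t^n$ of the time grid, where $$\mathcal E(\phi,\mathbf u)=\int_\Omega \frac{\gamma}{2}|\nabla\phi|^2+f(\phi)+\frac12|\mathbf u|^2\,dx,\qquad \mathcal D_\phi(\mu,\mathbf u)=\int_\Omega b(\phi)|\nabla\mu|^2+\eta(\phi)|\nabla\mathbf u|^2\,dx .$$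
   Context: Assumptions. $T>0$ is a fixed final time. (A0) $\Omega\subset\mathbb R^d$, $d\in\{2,3\}$, is a cube identified with the $d$-dimensional torus; all functions on $\Omega$ are periodic. (A1) $\gamma>0$ is constant. (A2) $b\in C^2(\mathbb R)$, $0<b_1\le b(s)\le b_2$, $\|b'\|_{L^\infty(\mathbb R)}\le b_3$, $\|b''\|_{L^\infty(\mathbb R)}\le b_4$. (A3) $f\in C^4(\mathbb R)$, $f(s)\ge 0$, $f''(s)\ge -f_1$ for some $f_1\ge0$, and $|f^{(k)}(s)|\le f_2^{(k)}+f_3^{(k)}|s|^{4-k}$ for $0\le k\le4$ with constants $f_2^{(k)},f_3^{(k)}$. (A4) $\eta\in C^2(\mathbb R)$, $0<\eta_1\le\eta(s)\le\eta_2$, $\|\eta'\|_{L^\infty(\mathbb R)}\le\eta_3$, $\|\eta''\|_{L^\infty(\mathbb R)}\le\eta_4$. (A5) $\mathcal T_h$ is a geometrically conforming, quasi-uniform partition of $\Omega$ into simplices that extends periodically: there is $\sigma>0$ with $\sigma h\le\rho_K\le h_K\le h$ for all $K\in\mathcal T_h$ ($\rho_K$ inner-circle radius, $h_K$ diameter of $K$, $h=\max_K h_K$). (A6) The time grid is $\mathcal I_\tau=\{0=t^0,t^1,\dots,t^N=T\}$ with $t^n=n\tau$, $\tau=T/N$. Spaces. $L^2_0(\Omega)$ is the space of $L^2$ functions with zero average; $\mathcal V_h=\{v\in H^1(\Omega): v|_K\in P_2(K)\ \forall K\in\mathcal T_h\}$; $\mathcal Q_h=\{v\in L^2_0(\Omega)\cap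 H^1(\Omega): v|_K\in P_1(K)\ \forall K\in\mathcal T_h\}$; $\mathcal Z_h=\{\mathbf v_h\in\mathcal V_h^d:\langle\operatorname{div}\mathbf v_h,q_h\rangle=0\ \forall q_h\in\mathcal Q_h\}$. $P_k(\mathcal I_\tau;X)$ denotes (possibly discontinuous) piecewise polynomials in time of degree $\le k$ over the grid with values in $X$, and $P_k^c(\mathcal I_\tau;X)=P_k(\mathcal I_\tau;X)\cap C(0,T;X)$. Notation. $\langle a,b\rangle=\int_\Omega a\cdot b\,dx$; $\langle a\cdot\nabla b,c\rangle_{\rm skw}=\frac12(\langle a\cdot\nabla b,c\rangle-\langle b,a\cdot\nabla c\rangle)$; $\langle a,b\rangle^n=\int_{t^{n-1}}^{t^n}\langle a(s),b(s)\rangle\,ds$ and likewise $\langle a\cdot\nabla b,c\rangle_{\rm skw}^n=\int_{t^{n-1}}^{t^n}\langle a\cdot\nabla b,c\rangle_{\rm skw}\,ds$. A bar denotes functions piecewise constant in time; $\bar u=\bar\pi_\tau^0u$ is also the $L^2$-orthogonal projection of $u$ onto piecewise constants in time (so $\bar\phi_{h,\tau}=\bar\pi^0_\tau\phi_{h,\tau}$, $\bar{\mathbf u}_{h,\tau}=\bar\pi^0_\tau\mathbf u_{h,\tau}$). $\pi_h^1:H^1(\Omega)\to\mathcal V_h$ is the $H^1$-orthogonal projection, and $\mathbf P_h^1:H^1(\Omega)^d\to\mathcal Z_h$ is defined by $\langle\mathbf u-\mathbf P_h^1\mathbf u,\mathbf v_h\rangle+\langle\nabla(\mathbf u-\mathbf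 P_h^1\mathbf u),\nabla\mathbf v_h\rangle=0$ for all $\mathbf v_h\in\mathcal Z_h$. Problem (P). Find $\phi_{h,\tau}\in P_1^c(\mathcal I_\tau;\mathcal V_h)$, $\bar\mu_{h,\tau}\in P_0(\mathcal I_\tau;\mathcal V_h)$, $\mathbf u_{h,\tau}\in P_1^c(\mathcal I_\tau;\mathcal V_h^d)$, $\bar p_{h,\tau}\in P_0(\mathcal I_\tau;\mathcal Q_h)$ with $\phi_{h,\tau}(0)=\pi_h^1\phi(0)$, $\mathbf u_{h,\tau}(0)=\mathbf P_h^1\mathbf u(0)$, and $$\langle\partial_t\phi_{h,\tau},\bar\psi\rangle^n=\langle\phi_{h,\tau}\bar{\mathbf u}_{h,\tau},\nabla\bar\psi\rangle^n-\langle b(\bar\phi_{h,\tau})\nabla\bar\mu_{h,\tau},\nabla\bar\psi\rangle^n,$$ $$\langle\bar\mu_{h,\tau},\bar\xi\rangle^n=\gamma\langle\nabla\phi_{h,\tau},\nabla\bar\xi\rangle^n+\langle f'(\phi_{h,\tau}),\bar\xi\rangle^n,$$ $$\langle\partial_t\mathbf u_{h,\tau},\bar{\mathbf v}\rangle^n=-\langle\mathbf u_{h,\tau}\cdot\nabla\bar{\mathbf u}_{h,\tau},\bar{\mathbf v}\rangle^n_{\rm skw}-\langle\eta(\bar\phi_{h,\tau})\nabla\bar{\mathbf u}_{h,\tau},\nabla\bar{\mathbf v}\rangle^n+\langle\bar p_{h,\tau},\operatorname{div}\bar{\mathbf v}\rangle^n-\langle\phi_{h,\tau}\bar{\mathbf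 v},\nabla\bar\mu_{h,\tau}\rangle^n,$$ $$\langle\operatorname{div}\mathbf u_{h,\tau},\bar q\rangle^n=0$$ for all $\bar\psi,\bar\xi\in P_0(\mathcal I_\tau;\mathcal V_h)$, $\bar{\mathbf v}\in P_0(\mathcal I_\tau;\mathcal V_h^d)$, $\bar q\in P_0(\mathcal I_\tau;\mathcal Q_h)$ and all $1\le n\le N$. *)

(* Defs.v *)
From HB Require Import structures.
From mathcomp Require Import all_boot all_order all_algebra.
From mathcomp Require Import all_classical all_reals all_analysis.
Set Implicit Arguments.
Unset Strict Implicit.
Unset Printing Implicit Defensive.
Import Order.TTheory GRing.Theory Num.Theory.
Import numFieldNormedType.Exports.
Local Open Scope classical_set_scope.
Local Open Scope ring_scope.

(* 'rV[R]_n carries the product (= Borel) sigma-algebra, generated by the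
   coordinates; lebesgue_row n is the n-dimensional Lebesgue measure, obtained
   by iterating the library product of sigma-finite measures. *)

Definition measure_row_display : measure_display.
Proof. exact: default_measure_display. Qed.

Section measurable_row.
Context {R : realType} (n : nat).

Let coord : 'I_n -> 'rV[R]_n -> measurableTypeR R := fun i x => x ord0 i.

Let row_set0 : g_sigma_preimage coord set0.
Proof. exact: sigma_algebra0. Qed.

Let row_setC A : g_sigma_preimage coord A -> g_sigma_preimage coord (~` A).
Proof. exact: sigma_algebraC. Qed.

Let row_bigcup (F : (set _)^nat) : (forall i, g_sigma_preimage coord (F i)) ->
  g_sigma_preimage coord (\bigcup_i F i).
Proof. exact: sigma_algebra_bigcup. Qed.

HB.instance Definition _ := @isMeasurable.Build measure_row_display
  'rV[R]_n (g_sigma_preimage coord) row_set0 row_setC row_bigcup.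

Lemma measurable_coord (i : 'I_n) :
  measurable_fun [set: 'rV[R]_n]
    (fun x : 'rV[R]_n => x ord0 i : measurableTypeR R).
Proof.
move=> _ Y mY; rewrite setTI; apply: sub_sigma_algebra => /=.
rewrite -bigcup_seq/=; exists i => /=; first by rewrite mem_index_enum.
by exists Y => //; rewrite setTI.
Qed.

Lemma measurable_fun_rowP d (T : measurableType d) (f : T -> 'rV[R]_n) :
  (forall i, measurable_fun [set: T]
    (fun x => f x ord0 i : measurableTypeR R)) ->
  measurable_fun [set: T] f.
Proof.
move=> mf _ A; rewrite setTI; move: A.
apply: (@smallest_sub _ (sigma_algebra setT) _
  [set A | measurable (f @^-1` A)]).
  split => /=; first by rewrite preimage_set0.
  - move=> A mA; rewrite setTD preimage_setC; exact: measurableC.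
  - by move=> F mF; rewrite preimage_bigcup; exact: bigcup_measurable.
rewrite -bigcup_seq/=; apply: bigcup_sub => i _ _ [B mB <-] /=.
by rewrite setTI -[X in measurable X]setTI; exact: (mf i).
Qed.

End measurable_row.

Section lebesgue_row.
Context {R : realType}.

Definition row_cons n (p : measurableTypeR R * 'rV[R]_n) : 'rV[R]_n.+1 :=
  \row_i oapp (p.2 ord0) p.1 (unlift ord0 i).

Lemma measurable_row_cons n : measurable_fun setT (@row_cons n).
Proof.
apply: measurable_fun_rowP => i.
rewrite [X in measurable_fun _ X](_ : _ =
    fun p : measurableTypeR R * 'rV[R]_n =>
      oapp (p.2 ord0) p.1 (unlift ord0 i)); last first.
  by apply/funext => p; rewrite mxE.
case: (unliftP ord0 i) => [j|] _ /=; last exact: measurable_fst.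
apply: (@measurableT_comp _ _ _ _ _ _ (fun x : 'rV[R]_n => x ord0 j)).
  exact: measurable_coord.
exact: measurable_snd.
Qed.


Lemma measurable_row_uncons n :
  measurable_fun setT (fun x : 'rV[R]_n.+1 =>
    (x ord0 ord0 : measurableTypeR R, \row_(i < n) x ord0 (lift ord0 i))).
Proof.
apply: measurable_fun_pair; first exact: measurable_coord.
apply: measurable_fun_rowP => i.
rewrite [X in measurable_fun _ X](_ : _ =
    fun x : 'rV[R]_n.+1 => x ord0 (lift ord0 i)).
  exact: measurable_coord.
by apply/funext => x; rewrite mxE.
Qed.

Lemma row_uncons_cons n (p : measurableTypeR R * 'rV[R]_n) :
  (row_cons p ord0 ord0, \row_i row_cons p ord0 (lift ord0 i)) = p.
Proof.
case: p => a v; rewrite mxE unlift_none; congr pair.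
by apply/rowP => i; rewrite !mxE liftK.
Qed.

Section lebesgue_cons.
Context (n : nat) (mu : {sigma_finite_measure set 'rV[R]_n -> \bar R}).

Definition lebesgue_cons : set 'rV[R]_n.+1 -> \bar R :=
  pushforward (lebesgue_measure \x mu)%E (@row_cons n).

Let nu : {measure set 'rV[R]_n.+1 -> \bar R} :=
  measure_function_pushforward__canonical__measure_function_Measure
    (lebesgue_measure \x mu)%E (@measurable_row_cons n).

Let lebesgue_cons0 : lebesgue_cons set0 = 0%E.
Proof. exact: (measure0 nu). Qed.

Let lebesgue_cons_ge0 A : (0 <= lebesgue_cons A)%E.
Proof. exact: (measure_ge0 nu). Qed.

Let lebesgue_cons_sigma_additive : semi_sigma_additive lebesgue_cons.
Proof. exact: (@measure_semi_sigma_additive _ _ _ nu). Qed.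

HB.instance Definition _ := isMeasure.Build _ _ _ lebesgue_cons
  lebesgue_cons0 lebesgue_cons_ge0 lebesgue_cons_sigma_additive.

Let lebesgue_cons_sigma_finite : sigma_finite setT lebesgue_cons.
Proof.
have /sigma_finiteP[F [TF ndF Foo]] := sigma_finiteT (@lebesgue_measure R).
have /sigma_finiteP[G [TG ndG Goo]] := sigma_finiteT mu.
pose g := fun x : 'rV[R]_n.+1 =>
  (x ord0 ord0 : measurableTypeR R, \row_(i < n) x ord0 (lift ord0 i)).
exists (fun k => g @^-1` (F k `*` G k)).
  rewrite predeqE => x; split => // _; rewrite -preimage_bigcup /=.
  have [k _ Fk] : (\bigcup_k F k) (g x).1 by rewrite -TF.
  have [l _ Gl] : (\bigcup_k G k) (g x).2 by rewrite -TG.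
  exists (maxn k l) => //; split.
    by move: Fk; exact/subsetPset/ndF/leq_maxl.
  by move: Gl; exact/subsetPset/ndG/leq_maxr.
move=> k; have [mF Fk] := Foo k; have [mG Gk] := Goo k; split.
  rewrite -[X in measurable X]setTI; apply: measurable_row_uncons => //.
  exact: measurableX.
rewrite /lebesgue_cons /pushforward -comp_preimage.
rewrite (_ : g \o _ = id) ?preimage_id.
  by rewrite product_measure1E// lte_mul_pinfty// ge0_fin_numE.
by apply/funext => p; exact: row_uncons_cons.
Qed.

HB.instance Definition _ := Measure_isSigmaFinite.Build _ _ _ lebesgue_cons
  lebesgue_cons_sigma_finite.

End lebesgue_cons.

Fixpoint lebesgue_row (n : nat) :
    {sigma_finite_measure set 'rV[R]_n -> \bar R} :=
  if n is m.+1 then lebesgue_cons (lebesgue_row m)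
  else \d_(0 : 'rV[R]_0).
End lebesgue_row.

(* Functions on the torus are represented by functions on R^d that are periodic
   in every coordinate; the cube is the closed fundamental cell. *)

Record cube (R : realType) (d : nat) := Cube {
  corner : 'rV[R]_d ;
  side : R ;
  side_gt0 : 0 < side }.

Section torus.
Context {R : realType} {d : nat}.

Definition cube_set (Om : cube R d) : set 'rV[R]_d :=
  [set x | forall i,
    corner Om ord0 i <= x ord0 i <= corner Om ord0 i + side Om].

Definition dir (i : 'I_d) : 'rV[R]_d := delta_mx ord0 i.

Context (Om : cube R d).

Definition periodic (f : 'rV[R]_d -> R) : Prop :=
  forall x i, f (x + side Om *: dir i) = f x.

Definition intO (f : 'rV[R]_d -> R) : R :=
  \int[lebesgue_row d]_(x in cube_set Om) f x.

Definition L2 (f : 'rV[R]_d -> R) : Prop :=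
  [/\ periodic f, measurable_fun setT f &
      (lebesgue_row d).-integrable (cube_set Om) (fun x => (f x ^+ 2)%:E)].

Definition partials (s : seq 'I_d) (psi : 'rV[R]_d -> R) : 'rV[R]_d -> R :=
  foldr (fun i g => 'D_(dir i) g) psi s.

Definition smooth (psi : 'rV[R]_d -> R) : Prop :=
  forall s, continuous (partials s psi) /\
            forall x i, derivable (partials s psi) x (dir i).

(* There is no boundary term: the test functions are periodic. *)
Definition is_weak_deriv (i : 'I_d) (v g : 'rV[R]_d -> R) : Prop :=
  L2 g /\ forall psi, periodic psi -> smooth psi ->
    intO (fun x => v x * 'D_(dir i) psi x) = - intO (fun x => g x * psi x).

Definition H1 (v : 'rV[R]_d -> R) : Prop :=
  L2 v /\ forall i, exists g, is_weak_deriv i v g.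

(* A weak derivative is unique up to null sets; this is one representative,
   meaningful only for functions that have one. *)
Definition wderiv (i : 'I_d) (v : 'rV[R]_d -> R) : 'rV[R]_d -> R :=
  xget (fun=> 0) [set g | is_weak_deriv i v g].

Definition grad (v : 'rV[R]_d -> R) : 'I_d -> 'rV[R]_d -> R :=
  fun i => wderiv i v.

(* gradv v i j is the derivative in direction j of the i-th component. *)
Definition gradv (v : 'I_d -> 'rV[R]_d -> R) : 'I_d -> 'I_d -> 'rV[R]_d -> R :=
  fun i j => wderiv j (v i).

Definition divg (v : 'I_d -> 'rV[R]_d -> R) : 'rV[R]_d -> R :=
  fun x => \sum_i wderiv i (v i) x.

Definition ip (a b : 'rV[R]_d -> R) : R := intO (fun x => a x * b x).

Definition ipv (a b : 'I_d -> 'rV[R]_d -> R) : R :=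
  intO (fun x => \sum_i a i x * b i x).

Definition ipm (a b : 'I_d -> 'I_d -> 'rV[R]_d -> R) : R :=
  intO (fun x => \sum_i \sum_j a i j x * b i j x).

(* (a . nabla) b *)
Definition conv (a b : 'I_d -> 'rV[R]_d -> R) : 'I_d -> 'rV[R]_d -> R :=
  fun i x => \sum_j a j x * gradv b i j x.

Definition skw (a b c : 'I_d -> 'rV[R]_d -> R) : R :=
  2^-1 * (ipv (conv a b) c - ipv b (conv a c)).

End torus.

Section mesh.
Context {R : realType} {d : nat}.

Record mesh := Mesh {
  ncells : nat ;
  vertex : 'I_ncells -> 'I_d.+1 -> 'rV[R]_d }.

(* Convex hull of the vertices v j, j \in A; it is empty for A empty. *)
Definition face (v : 'I_d.+1 -> 'rV[R]_d) (A : {set 'I_d.+1}) : set 'rV[R]_d :=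
  [set x | exists w : 'I_d.+1 -> R,
    [/\ forall j, 0 <= w j, forall j, j \notin A -> w j = 0,
        \sum_j w j = 1 & x = \sum_j w j *: v j]].

Definition simplex (v : 'I_d.+1 -> 'rV[R]_d) : set 'rV[R]_d :=
  face v [set: 'I_d.+1]%SET.

Definition cell (M : mesh) (i : 'I_(ncells M)) : set 'rV[R]_d :=
  simplex (vertex i).
Arguments cell : clear implicits.

Definition enorm (x : 'rV[R]_d) : R := Num.sqrt (\sum_i x ord0 i ^+ 2).

Definition diam (K : set 'rV[R]_d) : R :=
  sup [set r | exists x y, [/\ K x, K y & r = enorm (x - y)]].

Definition inradius (K : set 'rV[R]_d) : R :=
  sup [set r | 0 <= r /\
    exists c, [set x | enorm (x - c) <= r] `<=` K].

Definition lattice_shift (Om : cube R d) (z : 'I_d -> int)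
    (v : 'I_d.+1 -> 'rV[R]_d) : 'I_d.+1 -> 'rV[R]_d :=
  fun j => v j + side Om *: \row_k (z k)%:~R.

(* Conformity is required of the periodic extension: any two distinct cells of
   the extended mesh meet in a common proper (possibly empty) face. *)
Record conforming_partition (Om : cube R d) (M : mesh) : Prop := {
  cells_nondegenerate : forall i : 'I_(ncells M),
    row_free (\matrix_(j < d) (vertex i (lift ord0 j) - vertex i ord0)) ;
  cells_cover : \bigcup_i cell M i = cube_set Om ;
  cells_conform : forall (i j : 'I_(ncells M)) (z : 'I_d -> int),
    ~ (i = j /\ forall k, z k = 0) ->
    exists A B : {set 'I_d.+1},
      [/\ A != [set: 'I_d.+1]%SET, B != [set: 'I_d.+1]%SET,
          cell M i `&` simplex (lattice_shift Om z (vertex j))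
            = face (vertex i) A &
          cell M i `&` simplex (lattice_shift Om z (vertex j))
            = face (lattice_shift Om z (vertex j)) B] }.

Record quasi_uniform (M : mesh) (sigma h : R) : Prop := {
  mesh_size : h = \big[Num.max/0]_(i < ncells M) diam (cell M i) ;
  cells_regular : forall i : 'I_(ncells M),
    sigma * h <= inradius (cell M i) <= diam (cell M i) /\
    diam (cell M i) <= h }.

(* Polynomials in d variables of total degree at most k. *)
Definition polynomial_le (k : nat) (p : 'rV[R]_d -> R) : Prop :=
  exists c : {ffun 'I_d -> 'I_k.+1} -> R, forall x,
    p x = \sum_(m : {ffun 'I_d -> 'I_k.+1} | (\sum_i m i <= k)%N)
            c m * \prod_i x ord0 i ^+ m i.

(* The restriction to the closed cells is read pointwise: a finite element
   function is identified with its continuous representative. *)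
Definition piecewise_poly (M : mesh) (k : nat) (v : 'rV[R]_d -> R) : Prop :=
  forall i : 'I_(ncells M), exists2 p, polynomial_le k p &
    forall x, cell M i x -> v x = p x.

Context (Om : cube R d) (M : mesh).

Definition Vh (v : 'rV[R]_d -> R) : Prop := H1 Om v /\ piecewise_poly M 2 v.

Definition Qh (q : 'rV[R]_d -> R) : Prop :=
  [/\ L2 Om q /\ intO Om q = 0, H1 Om q & piecewise_poly M 1 q].

Definition Vhd (v : 'I_d -> 'rV[R]_d -> R) : Prop := forall i, Vh (v i).

Definition Zh (v : 'I_d -> 'rV[R]_d -> R) : Prop :=
  Vhd v /\ forall q, Qh q -> ip Om (divg Om v) q = 0.

Definition is_pi1h (v vh : 'rV[R]_d -> R) : Prop :=
  Vh vh /\ forall w, Vh w ->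
    ip Om (v \- vh) w + ipv Om (grad Om (v \- vh)) (grad Om w) = 0.

Definition is_P1h (v vh : 'I_d -> 'rV[R]_d -> R) : Prop :=
  Zh vh /\ forall w, Zh w ->
    ipv Om (fun i => v i \- vh i) w
    + ipm Om (gradv Om (fun i => v i \- vh i)) (gradv Om w) = 0.

End mesh.
Arguments mesh : clear implicits.

Section time.
Context {R : realType} {d : nat} (T : R) (N : nat).

Definition tgrid (n : nat) : R := n%:R * (T / N%:R).

(* Integral over the n-th slab, 1 <= n <= N. *)
Definition slab (n : nat) (g : R -> R) : R :=
  \int[lebesgue_measure]_(s in `[tgrid n.-1, tgrid n]) g s.

(* X-valued piecewise polynomials in time; the values at the grid points are
   only required to lie in X. *)
Definition Pk (k : nat) (X : ('rV[R]_d -> R) -> Prop)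
    (v : R -> 'rV[R]_d -> R) : Prop :=
  (forall t, 0 <= t <= T -> X (v t)) /\
  forall n, (n < N)%N -> exists c : 'I_k.+1 -> 'rV[R]_d -> R,
    (forall j, X (c j)) /\
    forall t x, tgrid n < t < tgrid n.+1 ->
      v t x = \sum_(j < k.+1) t ^+ j * c j x.

(* Continuity is stated pointwise in space; for the finite-dimensional spaces X
   of continuous functions used here this is continuity for any norm of X. *)
Definition Pkc (k : nat) (X : ('rV[R]_d -> R) -> Prop)
    (v : R -> 'rV[R]_d -> R) : Prop :=
  Pk k X v /\ forall x, {within `[0, T], continuous (fun t => v t x)}.

Definition Pkv (k : nat) (X : ('rV[R]_d -> R) -> Prop)
    (v : R -> 'I_d -> 'rV[R]_d -> R) : Prop :=
  forall i, Pk k X (fun t => v t i).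

Definition Pkcv (k : nat) (X : ('rV[R]_d -> R) -> Prop)
    (v : R -> 'I_d -> 'rV[R]_d -> R) : Prop :=
  forall i, Pkc k X (fun t => v t i).

Definition dt (v : R -> 'rV[R]_d -> R) (t : R) : 'rV[R]_d -> R :=
  fun x => derive1 (fun s => v s x) t.

(* vb is the orthogonal projection, for the inner product of
   L^2(0, T; L^2(Omega)), of v onto the X-valued piecewise constants. *)
Definition is_pi0 (Om : cube R d) (X : ('rV[R]_d -> R) -> Prop)
    (v vb : R -> 'rV[R]_d -> R) : Prop :=
  Pk 0 X vb /\ forall w, Pk 0 X w ->
    \int[lebesgue_measure]_(s in `[0, T]) ip Om (v s \- vb s) (w s) = 0.

End time.

Definition classCk {R : realType} (k : nat) (g : R -> R) : Prop :=
  (forall j, (j < k)%N -> forall s, derivable (derive1n j g) s 1) /\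
  continuous (derive1n k g).

Section scheme.
Context {R : realType} {d : nat} (Om : cube R d) (M : mesh R d)
  (T : R) (N : nat) (gamma : R) (b f eta : R -> R).

Local Notation V := (Vh Om M).
Local Notation Q := (Qh Om M).
Local Notation slab := (slab T N).

(* phib and ub are the projections of phi and u onto piecewise constants in
   time; the projection of the vector field u acts componentwise. *)
Record is_solution (phi0 : 'rV[R]_d -> R) (u0 : 'I_d -> 'rV[R]_d -> R)
    (phi phib mu : R -> 'rV[R]_d -> R)
    (u ub : R -> 'I_d -> 'rV[R]_d -> R) (p : R -> 'rV[R]_d -> R) : Prop := {
  sol_phi : Pkc T N 1 V phi ;
  sol_mu : Pk T N 0 V mu ;
  sol_u : Pkcv T N 1 V u ;
  sol_p : Pk T N 0 Q p ;
  sol_phib : is_pi0 T N Om V phi phib ;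
  sol_ub : forall i, is_pi0 T N Om V (fun t => u t i) (fun t => ub t i) ;
  sol_phi_init : is_pi1h Om M phi0 (phi 0) ;
  sol_u_init : is_P1h Om M u0 (u 0) ;
  sol_eq_phi : forall psi n, Pk T N 0 V psi -> (1 <= n <= N)%N ->
    slab n (fun s => ip Om (dt phi s) (psi s)) =
      slab n (fun s =>
        ipv Om (fun i x => phi s x * ub s i x) (grad Om (psi s)))
      - slab n (fun s =>
        ipv Om (fun i x => b (phib s x) * grad Om (mu s) i x)
               (grad Om (psi s))) ;
  sol_eq_mu : forall xi n, Pk T N 0 V xi -> (1 <= n <= N)%N ->
    slab n (fun s => ip Om (mu s) (xi s)) =
      gamma * slab n (fun s => ipv Om (grad Om (phi s)) (grad Om (xi s)))
      + slab n (fun s => ip Om (fun x => derive1 f (phi s x)) (xi s)) ;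
  sol_eq_u : forall v n, Pkv T N 0 V v -> (1 <= n <= N)%N ->
    slab n (fun s => ipv Om (fun i => dt (fun t => u t i) s) (v s)) =
      - slab n (fun s => skw Om (u s) (ub s) (v s))
      - slab n (fun s =>
          ipm Om (fun i j x => eta (phib s x) * gradv Om (ub s) i j x)
                 (gradv Om (v s)))
      + slab n (fun s => ip Om (p s) (divg Om (v s)))
      - slab n (fun s =>
          ipv Om (fun i x => phi s x * v s i x) (grad Om (mu s))) ;
  sol_eq_div : forall q n, Pk T N 0 Q q -> (1 <= n <= N)%N ->
    slab n (fun s => ip Om (divg Om (u s)) (q s)) = 0 }.

Definition energy (phi : 'rV[R]_d -> R) (u : 'I_d -> 'rV[R]_d -> R) : R :=
  intO Om (fun x => gamma / 2 * (\sum_i grad Om phi i x ^+ 2) + f (phi x)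
                    + 2^-1 * \sum_i u i x ^+ 2).

Definition dissipation (phi mu : 'rV[R]_d -> R) (u : 'I_d -> 'rV[R]_d -> R) :
    R :=
  intO Om (fun x => b (phi x) * (\sum_i grad Om mu i x ^+ 2)
                    + eta (phi x) * \sum_i \sum_j gradv Om u i j x ^+ 2).

End scheme.

(* Main.v *)
Require Import Defs.
From mathcomp Require Import all_boot all_order all_algebra.
From mathcomp Require Import all_classical all_reals all_analysis.
From mathcomp Require Import zify ring lra measurable_realfun.
Set Implicit Arguments.
Unset Strict Implicit.
Unset Printing Implicit Defensive.
Import Order.TTheory GRing.Theory Num.Theory.
Import numFieldNormedType.Exports.

(** Between two grid points phi and u are affine in time, mu and p are constant,
    and the fields in the coefficients are means. So every integral over a slab is
    the length tau times a form evaluated at the midpoints of phi and u, except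
    the one with f', which depends on phi along the whole path. The scheme is
    therefore equivalent to one finite system per slab ([slab_scheme]), relating the
    values of phi and u at its start, their increments, mu and p.

    Mass and energy. The test function 1 gives the conservation of mass
    ([mass_step]). For the energy, the mass equation is tested with mu, the
    potential equation with the increment of phi, the momentum equation with the
    mean velocity ([energy_step]). The transport of phi by the mean velocity
    cancels against the capillary force, the convection form is skew, and the
    pressure is paired with a discretely divergence-free field. The remaining terms
    are exact differences: the quadratic ones because the means are midpoints, the
    one with f because the integral of f'(phi) against the velocity of an affine
    path is the increment of the potential energy ([chain_rule_slab]).

    Existence of one step. The same computation bounds the solution a priori: the
    residual of the system at a state, tested with the state itself, is at least a
    positive multiple of the energy form minus a constant given by the data
    ([residual_zero]). A continuous vector field on a finite-dimensional space that
    points outwards far away has a zero ([coercive_zero], [galerkin]). This consequence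
    of Brouwer's theorem is proved combinatorially: Scarf's lemma ([scarf]),
    applied to the coordinates of grid points of a simplex coloured by the
    smallest component of the field, gives small cells showing all the colours
    that matter, and these accumulate at a solution of a variational inequality
    ([simplex_variational]).

    The energy form only sees the gradients of phi and mu. Therefore the increment of
    phi and mu are first sought, and the equations first tested, orthogonally to
    the functions with null gradient. The mass equation then holds for all tests,
    and the potential equation determines the missing part of mu. The momentum
    equation is first solved on discretely divergence-free fields. Its residual is
    then a functional vanishing where all pressures tested against the divergence
    do, so it is a combination of these, and the coefficients are the pressure
    ([functional_in_span], [step_solution]). The steps are chained, each starting from the final values of the
    previous one ([slab_solutions]), and interpolated ([solution_exists]).

    Function spaces. The weak derivative is a choice among functions that agree
    almost everywhere, so its linearity is an almost everywhere statement resting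
    on uniqueness ([is_weak_deriv_unique]), that is on the fundamental lemma of the
    calculus of variations for smooth periodic tests ([fundamental_lemma]). The finite
    element spaces are spanned by finitely many functions, because a periodic
    function is determined by its polynomials on the cells that cover the cube
    ([piecewise_poly_fin_span]), and consist of bounded functions, so all products
    in the scheme are integrable. *)

(** * Scarf's combinatorial lemma *)

Section Scarf.
Variables (X I : finType) (r : I -> X -> nat).
Hypothesis r_inj : forall i, injective (r i).
Implicit Types (S : {set X}) (C : {set I}).

Definition below i y S := [forall x in S, r i y <= r i x].

(** Scarf's dominance: no point exceeds, in every order of C, the minimum of S for
    that order. *)
Definition dominant S C := [forall y, [exists i in C, below i y S]].

(** The incidence of the door-in, room-out argument: a pair with one index too many
    for its set (a door) becomes a room when an index is dropped or a point is
    added. *)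
Definition opens (door room : {set X} * {set I}) :=
  [exists k in door.2, room == (door.1, door.2 :\ k)] ||
  [exists x, (x \notin door.1) && (room == (x |: door.1, door.2))].

Lemma belowP i y S : reflect {in S, forall x, r i y <= r i x} (below i y S).
Proof. exact: forall_inP. Qed.

Lemma dominantP S C :
  reflect (forall y, exists2 i, i \in C & below i y S) (dominant S C).
Proof.
apply: (iffP forallP) => H y; first by have /exists_inP := H y.
by apply/exists_inP; exact: H.
Qed.

Lemma dominantS S S' C C' : S' \subset S -> C \subset C' ->
  dominant S C -> dominant S' C'.
Proof.
move=> /fintype.subsetP sS /fintype.subsetP sC /dominantP H; apply/dominantP => y.
have [i iC /belowP ib] := H y; exists i; first exact: sC.
by apply/belowP => x /sS; exact: ib.
Qed.

Lemma below_uniq i x y S : x \in S -> y \in S ->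
  below i x S -> below i y S -> x = y.
Proof.
move=> xS yS /belowP bx /belowP b_y; apply: (@r_inj i); apply/eqP.
by rewrite eqn_leq bx // b_y.
Qed.

Lemma surj_card_inj (A B : finType) (f : A -> B) (C : {set A}) (S : {set B}) :
  S \subset f @: C -> #|C| <= #|S| -> {in C &, injective f}.
Proof.
move=> sub le; apply/imset_injP; rewrite eqn_leq leq_imset_card.
by rewrite (leq_trans le) // subset_leq_card.
Qed.

Section door.
Variables (S : {set X}) (C : {set I}) (x0 : X).
Hypotheses (x0S : x0 \in S) (domSC : dominant S C) (cardC : #|C| = #|S|.+1).

Let m i := [arg min_(x < x0 in S) r i x].

Let mS i : m i \in S.
Proof. by rewrite /m; case: arg_minnP. Qed.

Let m_le i x : x \in S -> r i (m i) <= r i x.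
Proof. by rewrite /m; case: arg_minnP => // y _ H; exact: H. Qed.

Let below_m i y : below i y S = (r i y <= r i (m i)).
Proof.
apply/belowP/idP => [H|H x xS]; first exact: H.
exact: leq_trans H (m_le _ xS).
Qed.

Let below_mem i x : x \in S -> below i x S -> x = m i.
Proof.
move=> xS bx; apply: (below_uniq xS (mS i) bx); by rewrite below_m.
Qed.

Let surj C' : dominant S C' -> S \subset m @: C'.
Proof.
move=> /dominantP dom; apply/fintype.subsetP => x xS.
have [i iC' bi] := dom x; apply/imsetP; exists i => //; exact: below_mem.
Qed.

(** The two indices of C sharing their minimum: without either of them the minima
    still exhaust S. *)
Let K := [set k in C | S \subset m @: (C :\ k)].

Let cardK : #|K| = 2.
Proof.
have [i [j [iC jC ij mij]]] : exists i j, [/\ i \in C, j \in C, i != j & m i = m j].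
  have : ~~ [forall i in C, forall j in C, (m i == m j) ==> (i == j)].
    apply/negP => /forall_inP H.
    have inj : {in C &, injective m}.
      move=> i j iC jC /eqP mij; apply/eqP.
      by have /forall_inP/(_ j jC)/implyP := H i iC; apply.
    have : #|m @: C| <= #|S|.
      by apply: subset_leq_card; apply/fintype.subsetP => _ /imsetP[k _ ->].
    by rewrite (card_in_imset inj) cardC ltnn.
  rewrite negb_forall_in => /exists_inP[i iC].
  rewrite negb_forall_in => /exists_inP[j jC].
  rewrite negb_imply => /andP[/eqP mij ij].
  by exists i, j.
have keep a b : a \in C -> b \in C -> a != b -> m a = m b -> a \in K.
  move=> aC bC ab mab; rewrite inE aC /=.
  apply: fintype.subset_trans (surj domSC) _; apply/fintype.subsetP => _ /imsetP[l lC ->].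
  have [->|la] := eqVneq l a; last by apply: imset_f; rewrite !inE la.
  by rewrite mab; apply: imset_f; rewrite !inE eq_sym ab.
suff -> : K = [set i; j] by rewrite cards2 ij.
apply/eqP; rewrite finset.eqEsubset; apply/andP; split; last first.
  apply/fintype.subsetP => k; rewrite !inE => /orP[] /eqP ->.
    by have := keep _ _ iC jC ij mij; rewrite inE.
  have ji : j != i by rewrite eq_sym.
  by have := keep _ _ jC iC ji (esym mij); rewrite inE.
apply/fintype.subsetP => k; rewrite !inE => /andP[kC sk].
have le : #|C :\ k| <= #|S|.
  by rewrite -ltnS -cardC (finset.cardsD1 k C) kC.
have inj := surj_card_inj sk le.
rewrite !(eq_sym k); apply: contraT; rewrite negb_or => /andP[ik jk].
case/negP: ij; apply/eqP; apply: inj => //; by rewrite !inE ?ik ?jk.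
Qed.

(** The candidates for a point to be added when k is the index that becomes free. *)
Let Y k := [set y | [forall i in C :\ k, r i (m i) < r i y]].

Let YP k y : reflect {in C :\ k, forall i, r i (m i) < r i y} (y \in Y k).
Proof. by rewrite inE; exact: forall_inP. Qed.

Let notY k y : y \notin Y k -> exists2 i, i \in C :\ k & r i y <= r i (m i).
Proof.
rewrite inE negb_forall_in => /exists_inP[i iC]; rewrite -leqNgt; by exists i.
Qed.

Let top k := odflt x0 [pick y in Y k | [forall z in Y k, r k z <= r k y]].

Let topP k : ~~ dominant S (C :\ k) ->
  top k \in Y k /\ {in Y k, forall z, r k z <= r k (top k)}.
Proof.
rewrite negb_forall => /existsP[y].
rewrite negb_exists_in => /forall_inP yP.
have yY : y \in Y k.
  by apply/YP => i iC; have := yP i iC; rewrite below_m -ltnNge.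
rewrite /top; case: pickP => [z /andP[zY /forall_inP zP]|none] //=.
exfalso; have := none [arg max_(z > y in Y k) r k z].
case: arg_maxnP => // z zY zP /negP; apply; rewrite zY /=; exact/forall_inP.
Qed.

Let room k := if dominant S (C :\ k) then (S, C :\ k) else (top k |: S, C).

Let Y_disj k y : k \in K -> y \in Y k -> y \notin S.
Proof.
rewrite inE => /andP[_ /fintype.subsetP sk] /YP yY; apply/negP => /sk /imsetP[i iC yi].
by have := yY i iC; rewrite yi ltnn.
Qed.

Let room_inj : {in K &, injective room}.
Proof.
move=> k k' kK k'K; rewrite /room.
have kC : k \in C by move: kK; rewrite inE => /andP[].
have k'C : k' \in C by move: k'K; rewrite inE => /andP[].
have CD a : a \in C -> C = C :\ a -> False.
  by move=> aC /setP/(_ a); rewrite !inE eqxx aC.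
case: ifPn => dk; case: ifPn => dk' //.
- move=> [/setP/(_ k)]; rewrite !inE eqxx kC !andbT /= => /esym/negbFE e; exact/eqP.
- by move=> [_ e]; case: (CD k kC).
- by move=> [_ e]; case: (CD k' k'C).
have [tY _] := topP dk; have [tY' _] := topP dk'.
move=> [/setP/(_ (top k))]; rewrite finset.setU11 inE.
rewrite (negbTE (Y_disj kK tY)) orbF finset.in_set1 => /esym/eqP tt.
apply/eqP; apply: contraT => kk'.
have /dominantP/(_ (top k))[i iC] := domSC; rewrite below_m leqNgt => /negP[].
have [ik|ik] := eqVneq i k.
  by rewrite tt; apply: (YP _ _ tY'); rewrite !inE ik kk'.
by apply: (YP _ _ tY); rewrite !inE ik.
Qed.

Let room_img : [set rm | opens (S, C) rm && dominant rm.1 rm.2] = room @: K.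
Proof.
apply/setP => rm; rewrite inE; apply/idP/imsetP.
- case/andP=> /orP[/exists_inP[k kC /eqP ->]|/existsP[x /andP[xS /eqP ->]]] /= dom.
  + by exists k; [rewrite inE kC surj|rewrite /room dom].
  + have [k kC bk] := dominantP _ _ dom x.
    have surj' s : s \in S -> exists2 i, i \in C :\ k & below i s (x |: S).
      move=> sS; have [i iC bi] := dominantP _ _ dom s.
      exists i => //; rewrite !inE iC andbT; apply/eqP => ik.
      case/negP: xS; rewrite -ik in bk.
      by rewrite (below_uniq _ _ bk bi) // !inE ?eqxx ?sS ?orbT.
    have kK : k \in K.
      rewrite inE kC; apply/fintype.subsetP => s sS; have [i iC bi] := surj' s sS.
      apply/imsetP; exists i => //; apply: below_mem => //.
      by apply/belowP => z zS; apply: (belowP _ _ _ bi); rewrite !inE zS orbT.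
    (* the minimum over x |: S at i != k lies in S, as x is the minimum at k *)
    have inj : {in C :\ k &, injective m}.
      apply: (@surj_card_inj _ _ _ _ S); first by move: kK; rewrite inE => /andP[].
      by rewrite -ltnS -cardC (finset.cardsD1 k C) kC.
    have xY : x \in Y k.
      apply/YP => i iC.
      have [j jC bj] := surj' (m i) (mS i).
      have mj : m i = m j.
        apply: below_mem; first exact: mS.
        by apply/belowP => z zS; apply: (belowP _ _ _ bj); rewrite !inE zS orbT.
      rewrite (inj _ _ iC jC mj) -mj ltn_neqAle.
      rewrite (belowP _ _ _ bj) ?finset.setU11 // andbT.
      by apply/eqP => /r_inj e; case/negP: xS; rewrite -e.
    have ndom : ~~ dominant S (C :\ k).
      apply/negP => /dominantP/(_ x)[i iC]; rewrite below_m leqNgt => /negP[].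
      exact: (YP _ _ xY).
    exists k => //; rewrite /room (negbTE ndom); congr (_ |: _, _).
    have [tY tmax] := topP ndom.
    apply: (@r_inj k); apply/eqP; rewrite eqn_leq tmax //=.
    have [i iC bi] := dominantP _ _ dom (top k).
    have [ik|ik] := eqVneq i k.
      by rewrite ik in bi; apply: (belowP _ _ _ bi); rewrite finset.setU11.
    have : r i (m i) < r i (top k) by apply: (YP _ _ tY); rewrite !inE ik.
    by rewrite ltnNge (belowP _ _ _ bi) // !inE mS orbT.
- move=> [k kK ->]; rewrite /room.
  have kC : k \in C by move: kK; rewrite inE => /andP[].
  case: ifPn => dk /=.
    by rewrite dk andbT; apply/orP; left; apply/exists_inP; exists k.
  have [tY tmax] := topP dk; apply/andP; split.
    by apply/orP; right; apply/existsP; exists (top k); rewrite eqxx (Y_disj kK tY).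
  apply/dominantP => z; have [zY|/notY[i iC zi]] := boolP (z \in Y k).
    have [i iC bi] := dominantP _ _ domSC z.
    have ik : i = k.
      apply/eqP; apply: contraT => ik; move: bi; rewrite below_m leqNgt => /negP[].
      by apply: (YP _ _ zY); rewrite !inE ik.
    exists k => //; apply/belowP => x; rewrite !inE => /orP[/eqP ->|xS].
      exact: tmax.
    by rewrite -ik; exact: (belowP _ _ _ bi).
  exists i; first by move: iC; rewrite !inE => /andP[].
  apply/belowP => x; rewrite !inE => /orP[/eqP ->|xS].
    by apply: leq_trans zi (ltnW _); exact: (YP _ _ tY).
  exact: leq_trans zi (m_le _ xS).
Qed.

(** Dominance sends S injectively into the minima of C, and C has one index more
    than S, so exactly two indices of C share their minimum. Each of them can be
    traded in one way: either it can be dropped, or the set of points lying above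
    all the other minima is nonempty and its maximal point for that index can be
    added. *)
Lemma door_two_rooms : #|[set rm | opens (S, C) rm && dominant rm.1 rm.2]| = 2.
Proof. by rewrite room_img card_in_imset. Qed.

End door.

(** The only door without a second room: starting from the empty set, the point to
    add is the maximum of the order. *)
Lemma outer_door (i0 : I) : 0 < #|X| ->
  #|[set rm | opens (finset.set0, [set i0]) rm && dominant rm.1 rm.2]| = 1.
Proof.
move=> /card_gt0P[x0 _].
pose x1 := [arg max_(x > x0) r i0 x].
have x1P y : r i0 y <= r i0 x1 by rewrite /x1; case: arg_maxnP => // z _; apply.
apply/eqP/cards1P; exists ([set x1], [set i0]).
apply/setP => rm; rewrite !inE; apply/andP/eqP.
- case=> /orP[/exists_inP[k]|/existsP[x /andP[_ /eqP -> /=]]].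
    rewrite inE /= => /eqP -> /eqP -> /= /dominantP/(_ x0)[i].
    by rewrite finset.setDv inE.
  rewrite finset.setU0 => /dominantP/(_ x1)[i]; rewrite inE => /eqP -> /belowP/(_ x).
  rewrite set11 => /(_ isT) le; congr pair; congr finset.set1.
  by apply: (@r_inj i0); apply/eqP; rewrite eqn_leq le x1P.
- move=> ->; split.
    by apply/orP; right; apply/existsP; exists x1; rewrite inE finset.setU0 eqxx.
  apply/dominantP => y; exists i0; first by rewrite set11.
  by apply/belowP => x; rewrite inE => /eqP ->.
Qed.

Section colouring.
Variables (c : X -> I) (i0 : I).

Definition coloured (d : {set X} * {set I}) :=
  (d.2 == i0 |: c @: d.1) && (#|d.2| == #|d.1|.+1).

Lemma coloured_inj S C : coloured (S, C) ->
  {in S &, injective c} /\ i0 \notin c @: S.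
Proof.
move=> /andP[/= /eqP -> /eqP]; rewrite finset.cardsU1.
have le := leq_imset_card c S.
case: (i0 \in _) => /=; first by rewrite add0n => e; move: le; rewrite e ltnn.
by rewrite add1n => -[e]; split => //; apply/imset_injP; rewrite e.
Qed.

Lemma imsetD1_inj S x : {in S &, injective c} -> x \in S ->
  c @: (S :\ x) = (c @: S) :\ c x.
Proof.
move=> inj xS; apply/setP => i; apply/imsetP/idP.
  move=> [y]; rewrite !inE => /andP[yx yS] ->; rewrite imset_f // andbT.
  by apply: contra yx => /eqP /inj -> .
rewrite !inE => /andP[ix /imsetP[y yS iy]]; exists y => //.
by rewrite !inE yS andbT; apply: contra ix => /eqP <-; rewrite iy.
Qed.

(** If leaving out the point x gives a coloured door, then either the colour of x is
    shared with exactly one other point, and leaving that one out gives the second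
    door, or the colour of x is not an index of the room, and adding it gives the
    second door. *)
Lemma room_even S C : #|S| = #|C| -> C != c @: S ->
  ~~ odd #|[set d | opens d (S, C) && coloured d]|.
Proof.
move=> cardSC unsolved.
pose dA x := (S :\ x, C); pose dB k := (S, k |: C).
pose A := [set x in S | coloured (dA x)].
pose B := [set k in ~: C | coloured (dB k)].
have -> : [set d | opens d (S, C) && coloured d] = (dA @: A) :|: (dB @: B).
  apply/setP => -[S' C']; rewrite !inE; apply/andP/orP.
  - case=> /orP[/exists_inP[k /= kC /eqP[e1 e]] g|/existsP[x /andP[/= xS /eqP[e e1]]] g].
      subst S'; right; apply/imsetP; exists k; last by rewrite /dB e finset.setD1K.
      by rewrite !inE /dB e !inE eqxx /= finset.setD1K.
    subst C'; left; apply/imsetP; exists x; last by rewrite /dA e finset.setU1K.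
    by rewrite !inE /dA e finset.setU11 finset.setU1K.
  - case=> /imsetP[z]; rewrite !inE => /andP[zS g] ->; split => //; apply/orP.
      right; apply/existsP; exists z; rewrite !inE eqxx /=.
      by rewrite xpair_eqE finset.setD1K // !eqxx.
    by left; apply/exists_inP; exists z; rewrite /= ?finset.setU11 // finset.setU1K.
have dAinj : {in A &, injective dA}.
  move=> x y; rewrite !inE => /andP[xS _] _ [/setP/(_ x)].
  by rewrite !inE eqxx xS !andbT /= => /esym/negbFE e; exact/eqP.
have dBinj : {in B &, injective dB}.
  move=> x y; rewrite !inE => /andP[xC _] _ [/setP/(_ x)].
  by rewrite !inE eqxx (negbTE xC) !orbF /= => /esym e; exact/eqP.
have disj : (dA @: A) :&: (dB @: B) = finset.set0.
  apply/setP => d; rewrite !inE; apply/negP => /andP[/imsetP[x]].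
  rewrite inE => /andP[xS _] -> /imsetP[k _ [/setP/(_ x)]].
  by rewrite !inE eqxx xS.
rewrite cardsU disj cards0 subn0 !card_in_imset //.
have [A0|[x xA]] := set_0Vmem A.
  have [->|[k]] := set_0Vmem B; first by rewrite A0 !cards0.
  rewrite !inE => /andP[kC kg]; exfalso.
  have [inj i0S] := coloured_inj kg.
  have /andP[/eqP /= e _] := kg.
  have ki0 : k != i0.
    apply: contra unsolved => /eqP ki0; rewrite ki0 in e kC.
    by rewrite -(finset.setU1K kC) e finset.setU1K.
  have i0C : i0 \in C.
    by have := finset.setU11 i0 (c @: S); rewrite -e !inE eq_sym (negbTE ki0).
  have : k \in c @: S.
    by have := finset.setU11 k C; rewrite e !inE (negbTE ki0).
  move=> /imsetP[x xS kx].
  have : x \in A.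
    rewrite inE xS /coloured /= imsetD1_inj // -kx; apply/andP; split.
      apply/eqP; rewrite -(finset.setU1K kC) e; apply/setP => i; rewrite !inE.
      by have [->|] := eqVneq i i0; rewrite ?andbT //= eq_sym ki0.
    by rewrite -cardSC (finset.cardsD1 x S) xS.
  by rewrite A0 inE.
move: (xA); rewrite inE => /andP[xS xg].
have [inj i0S] := coloured_inj xg.
have /andP[/eqP /= e _] := xg.
have cSx : c @: S = c x |: c @: (S :\ x) by rewrite -finset.imsetU1 finset.setD1K.
have cxi0 : c x != i0.
  by apply: contra unsolved => /eqP cx; rewrite e cSx cx.
have [cxC|cxC] := boolP (c x \in C).
  have : c x \in c @: (S :\ x) by move: cxC; rewrite e !inE (negbTE cxi0).
  move=> /imsetP[x' x'S cxx']; move: (x'S); rewrite !inE => /andP[x'x x'S1].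
  have cSS : c @: S = c @: (S :\ x).
    by rewrite cSx; apply/finset.setUidPr; rewrite finset.sub1set cxx' imset_f.
  have -> : B = finset.set0.
    apply/setP => k; rewrite !inE; apply/negP => /andP[kC /andP[/eqP /= e' _]].
    by case/negP: kC; rewrite e -cSS -e' finset.setU11.
  suff -> : A = [set x; x'] by rewrite cards0 addn0 cards2 eq_sym x'x.
  apply/setP => y; rewrite !inE; apply/idP/idP.
    move=> /andP[yS yg]; apply: contraT; rewrite negb_or => /andP[yx yx'].
    have [_ i0y] := coloured_inj yg; have /andP[/eqP /= e' _] := yg.
    have : c y \in C by rewrite e !inE imset_f ?orbT // !inE yx.
    rewrite e' !inE => /orP[/eqP cy|/imsetP[z]].
      by case/negP: i0S; rewrite -cy imset_f // !inE yx.
    rewrite !inE => /andP[zy zS] cyz.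
    have [zx|zx] := eqVneq z x.
      case/negP: yx'; apply/eqP; apply: inj; rewrite ?inE ?yx ?x'x //.
      by rewrite cyz zx.
    by case/negP: zy; apply/eqP; apply: inj; rewrite ?inE ?yx ?zx.
  case/orP=> /eqP -> //; first by rewrite xS.
  rewrite x'S1 /coloured /=; apply/andP; split.
    rewrite {1}e; apply/eqP; congr (_ |: _).
    apply/setP => i; apply/imsetP/imsetP => -[z]; rewrite !inE => /andP[zx zS] ->.
      have [->|zx'] := eqVneq z x'; last by exists z; rewrite // !inE zx'.
      by exists x; rewrite ?cxx' // !inE eq_sym x'x.
    have [->|zx'] := eqVneq z x; last by exists z; rewrite // !inE zx'.
    by exists x'; rewrite ?cxx' // !inE x'x.
  by rewrite -cardSC (finset.cardsD1 x' S) x'S1.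
suff -> : A = [set x]; last first.
  apply/setP => y; rewrite !inE; apply/andP/eqP => [[yS /andP[/eqP /= e' _]]|->//].
  apply/eqP; apply: contraT => yx; case/negP: cxC; rewrite e' !inE.
  by rewrite imset_f ?orbT // !inE eq_sym yx.
suff -> : B = [set c x] by rewrite !cards1.
have full : c x |: C = i0 |: c @: S.
  by rewrite {1}e cSx finset.setUCA.
apply/setP => k; rewrite !inE; apply/andP/eqP => [[kC /andP[/eqP /= e' _]]|->].
  by have := finset.setU11 k C; rewrite e' -full !inE (negbTE kC) orbF => /eqP.
by split => //; rewrite /coloured /= full eqxx -full finset.cardsU1 cxC cardSC add1n eqxx.
Qed.

(** Double counting of the incidences between coloured dominant doors and dominant
    rooms. Every door but the outer one has two rooms, so the number of incidences
    is odd; a room whose indices are not exactly its colours has an even number of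
    doors, so some room is solved. *)
Theorem scarf : 0 < #|X| -> exists2 S, S != finset.set0 & dominant S (c @: S).
Proof.
move=> X0; pose rooms := [set rm : {set X} * {set I} |
  dominant rm.1 rm.2 && (#|rm.1| == #|rm.2|)].
pose doors := [set d | coloured d && dominant d.1 d.2].
have count : \sum_(d in doors) #|[set rm in rooms | opens d rm]|
           = \sum_(rm in rooms) #|[set d in doors | opens d rm]|.
  transitivity (\sum_(d in doors) \sum_(rm in rooms) opens d rm).
    apply: eq_bigr => d _; rewrite -sum1_card big_mkcond [RHS]big_mkcond /=.
    by apply: eq_bigr => rm _; rewrite [_ \in [set _ in _ | _]]inE; case: (rm \in rooms); case: (opens d rm).
  rewrite exchange_big; apply: eq_bigr => rm _.
  rewrite -sum1_card big_mkcond [RHS]big_mkcond /=.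
  by apply: eq_bigr => d _; rewrite [_ \in [set _ in _ | _]]inE; case: (d \in doors); case: (opens d rm).
have openE d : d \in doors -> [set rm in rooms | opens d rm] =
    [set rm | opens d rm && dominant rm.1 rm.2].
  case: d => S C; rewrite inE => /andP[/andP[_ /eqP /= cC] _].
  apply/setP => rm; rewrite !inE andbC.
  have [|//] := boolP (opens _ _).
  case/orP=> [/exists_inP[k /= kC /eqP ->]|/existsP[x /andP[/= xS /eqP ->]]] /=.
    by move: cC; rewrite (finset.cardsD1 k C) kC add1n => -[->]; rewrite eqxx andbT.
  by rewrite cC finset.cardsU1 xS add1n eqxx andbT.
pose d0 := (finset.set0 : {set X}, [set i0]).
have d0D : d0 \in doors.
  rewrite inE /coloured /= finset.imset0 finset.setU0 eqxx cards1 cards0 eqxx /=.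
  by apply/dominantP => y; exists i0; rewrite ?set11 //; apply/belowP => x; rewrite inE.
have : odd (\sum_(rm in rooms) #|[set d in doors | opens d rm]|).
  rewrite -count (bigD1 d0) //= openE // outer_door // oddD /=.
  rewrite (_ : odd _ = false) //.
  elim/big_ind: _ => [//|a b|[S C] /andP[dD dd0]]; first by rewrite oddD => -> ->.
  move: (dD); rewrite inE => /andP[/andP[/eqP /= e /eqP /= cC] dom].
  have [S0|[x xS]] := set_0Vmem S.
    by case/eqP: dd0; rewrite /d0 S0 e S0 finset.imset0 finset.setU0.
  by rewrite openE // (door_two_rooms xS).
have [/existsP[rm /andP[rmR od]] _|] :=
    boolP [exists rm in rooms, odd #|[set d in doors | opens d rm]|].
  case: rm rmR od => S C; rewrite inE => /andP[/= dom /eqP cSC] od.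
  have CS : C = c @: S.
    apply/eqP; apply: contraT => CS; have := room_even cSC CS.
    rewrite (_ : [set d | opens d (S, C) && coloured d] = [set d in doors | opens d (S, C)]) ?od //.
    apply/setP => -[S' C']; rewrite !inE andbC.
    have [|] := boolP (opens _ _); rewrite ?andbF // !andbT => op.
    rewrite (_ : dominant S' C') ?andbT //.
    apply: dominantS dom => /=; move: op.
      case/orP=> [/exists_inP[k _ /eqP[-> _]]|/existsP[x /andP[_ /eqP[-> _]]]] //=.
      exact: finset.subsetUr.
    case/orP=> [/exists_inP[k _ /eqP[_ ->]]|/existsP[x /andP[_ /eqP[_ ->]]]] //=.
    exact: finset.subsetDl.
  exists S; last by rewrite -CS.
  have /card_gt0P[x _] := X0; have [i iC _] := dominantP _ _ dom x.
  by rewrite -card_gt0 cSC card_gt0; apply/set0Pn; exists i.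
rewrite negb_exists_in => /forall_inP even.
rewrite (_ : odd _ = false) //.
elim/big_ind: _ => [//|a b|rm rmR]; first by rewrite oddD => -> ->.
exact/negbTE/even.
Qed.

End colouring.
End Scarf.

Local Open Scope classical_set_scope.
Local Open Scope ring_scope.

(** * Zeros of coercive vector fields *)

(** The points of the simplex with coordinates in multiples of 1/K, stored as
    integer vectors of sum K. *)
Definition grid (n K : nat) :=
  {a : {ffun 'I_n.+1 -> 'I_K.+1} | (\sum_i a i == K)%N}.

Section grid.
Variables (n K : nat).
Local Open Scope nat_scope.
Implicit Types (x y : grid n K) (i : 'I_n.+1).

Let num x i : nat := val x i.

Let num_sum x : \sum_i num x i = K.
Proof. exact/eqP/(valP x). Qed.

Let mkgrid (g : 'I_n.+1 -> nat) : \sum_i g i = K -> exists y, forall i, num y i = g i.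
Proof.
move=> gK; have gle i : g i < K.+1.
  by rewrite ltnS -gK (bigD1 i) //= leq_addr.
have eg : (\sum_i (finfun (fun i => Ordinal (gle i))) i == K)%N.
  by rewrite -[X in _ == X]gK; apply/eqP/eq_bigr => i _; rewrite ffunE.
by exists (exist (fun a : {ffun 'I_n.+1 -> 'I_K.+1} => is_true (\sum_i a i == K)) _ eg) => i; rewrite /num /= ffunE.
Qed.

Let grid_gt0 : 0 < #|{: grid n K}|.
Proof.
have [|y _] := @mkgrid (fun i => if i == ord0 then K else 0).
  by rewrite -big_mkcond /= big_pred1_eq.
by apply/card_gt0P; exists y.
Qed.

(** Ties between equal coordinates are broken by the position in the enumeration. *)
Let rank i x := num x i * #|{: grid n K}| + enum_rank x.

Let rank_inj i : injective (rank i).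
Proof.
move=> x y /(congr1 (modn^~ #|{: grid n K}|)).
rewrite /rank !modnMDl !modn_small ?ltn_ord // => /val_inj; exact: enum_rank_inj.
Qed.

Let rank_le i x y : rank i x <= rank i y -> num x i <= num y i.
Proof.
move=> /(leq_div2r #|{: grid n K}|).
by rewrite /rank !divnMDl // !divn_small ?ltn_ord // !addn0.
Qed.

(** For the orders by coordinates, dominance forces the minima m_i over the cell to
    add up to almost K: otherwise the vector of the m_i + 1 could be completed to a
    grid point above all of them. Hence the points of the cell differ by at most n
    in each coordinate. C is the set of the colours met. *)
Lemma small_panchromatic (c : grid n K -> 'I_n.+1) :
  exists x (C : {set 'I_n.+1}),
    (forall i, i \notin C -> val x i <= n) /\
    (forall i, i \in C -> exists2 y, c y = i &
       forall j, val x j <= val y j + n /\ val y j <= val x j + n).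
Proof.
have [S /set0Pn[x xS]] := scarf rank_inj c ord0 grid_gt0.
set C := imset _ _ => /dominantP dom.
pose m i := num [arg min_(z < x in S) num z i] i.
have m_le i z : z \in S -> m i <= num z i.
  by rewrite /m; case: arg_minnP => // w _ H; exact: H.
have sumE (g : 'I_n.+1 -> nat) (A : {set 'I_n.+1}) :
    \sum_i g i = \sum_(i in A) g i + \sum_(i | i \notin A) g i.
  by rewrite (bigID (mem A)).
have mK : K <= \sum_(i in C) m i + n.
  have : K < \sum_(i in C) (m i).+1.
    rewrite ltnNge; apply/negP => le.
    have [i1 i1C _] := dom x.
    have [|y yE] := @mkgrid (fun i => if i \in C then (m i).+1 +
        (if i == i1 then K - \sum_(i in C) (m i).+1 else 0) else 0).
      rewrite -big_mkcond /= big_split /= -big_mkcondr /=.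
      rewrite [X in _ + X](eq_bigl (fun i => i == i1)) ?big_pred1_eq ?subnKC // => i.
      by case: eqVneq => [->|]; rewrite ?i1C ?andbF.
    have [i iC /belowP bi] := dom y.
    have zS : [arg min_(z < x in S) num z i] \in S by case: arg_minnP.
    have := rank_le (bi _ zS); rewrite yE iC -/(m i) => H.
    by have := leq_trans (leq_addr _ _) H; rewrite ltnn.
  move=> lt; rewrite -ltnS; apply: leq_trans lt _.
  under eq_bigr do rewrite -addn1.
  rewrite big_split /= sum1_card -addnS leq_add2l.
  by rewrite -[X in _ <= X]card_ord max_card.
have key (p q a b e : nat) : p + b + e = K -> K <= q + a + n -> a <= b -> p <= q + n.
  by lia.
have key' (p a b e : nat) : b + (p + e) = K -> K <= a + n -> a <= b -> p <= n by lia.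
have up i z : z \in S -> i \in C -> num z i <= m i + n.
  move=> zS iC; have s := num_sum z; rewrite (sumE _ C) (bigD1 i) //= in s.
  have m1 := mK; rewrite (bigD1 i) //= in m1.
  have : \sum_(j in C | j != i) m j <= \sum_(j in C | j != i) num z j.
    by apply: leq_sum => j _; exact: m_le.
  by apply: key s m1.
have out i z : z \in S -> i \notin C -> num z i <= n.
  move=> zS iC; have s := num_sum z.
  rewrite (sumE _ C) [X in _ + X = _](bigD1 i) //= in s.
  have : \sum_(j in C) m j <= \sum_(j in C) num z j.
    by apply: leq_sum => j _; exact: m_le.
  by apply: key' s mK.
exists x, C; split; first by move=> i; exact: out.
move=> i /imsetP[y yS ->]; exists y => // j.
rewrite -!/(num _ _); have [jC|jC] := boolP (j \in C).
  by have := up _ _ xS jC; have := up _ _ yS jC; have := m_le j _ xS; have := m_le j _ yS; lia.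
by have := out _ _ xS jC; have := out _ _ yS jC; lia.
Qed.

End grid.

Section variational.
Context {R : realType}.

(** The variational inequality on the simplex, equivalent to Brouwer's theorem.
    Colour a grid point by a component where G is smallest; a limit of small
    panchromatic cells is a point near which every index carrying positive weight
    is, somewhere arbitrarily close, a minimiser of G. *)
Lemma simplex_variational n (G : 'rV[R]_n.+1 -> 'I_n.+1 -> R) :
  (forall i, continuous (G^~ i)) ->
  exists x : 'rV[R]_n.+1, [/\ forall i, 0 <= x ord0 i, \sum_i x ord0 i = 1 &
    forall i, 0 < x ord0 i -> forall j, G x i <= G x j].
Proof.
move=> Gc.
pose pt K (a : grid n K.+1) : 'rV[R]_n.+1 := \row_i ((val a i)%:R / K.+1%:R).
pose c K (a : grid n K.+1) := [arg min_(i < ord0) G (pt K a) i]%O.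
have cP K a j : G (pt K a) (c K a) <= G (pt K a) j.
  by rewrite /c; case: arg_minP => // i _; apply.
have exP K := cid (@small_panchromatic n K.+1 (c K)).
pose P K := sval (exP K); have PH K := svalP (exP K).
pose u K := pt K (P K).
have u01 K i : `[0, 1]%classic (u K ord0 i).
  rewrite /u /= in_itv /= mxE divr_ge0 //= ler_pdivrMr // mul1r ler_nat.
  by rewrite -ltnS.
have usum K : \sum_i u K ord0 i = 1.
  under eq_bigr do rewrite mxE.
  rewrite -mulr_suml -natr_sum (eqP (valP (P K))) divff //.
have comp : compact [set v : 'rV[R]_n.+1 | forall i, `[0, 1]%classic (v ord0 i)].
  by have := (@rV_compact R^o _ (fun=> `[0, 1]%classic)); apply => i; exact: segment_compact.
have uin : (u @ \oo) [set v : 'rV[R]_n.+1 | forall i, `[0, 1]%classic (v ord0 i)].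
  have h : \forall K \near \oo, forall i, `[0, 1]%classic (u K ord0 i) by exact: nearW.
  exact: h.
have [x x01 xcl] : exists2 x : 'rV[R]_n.+1,
    forall i, `[0, 1]%classic (x ord0 i) & cluster (u @ \oo) x.
  by have [x [x01 xcl]] := comp (u @ \oo) _ uin; exists x.
have freq (B : set 'rV[R]_n.+1) (Q : nat -> Prop) : nbhs x B -> (\forall K \near \oo, Q K) ->
    exists K, B (u K) /\ Q K.
  move=> xB QK; have [|z [/= [K QK' <-] Bz]] := xcl (u @` Q) B _ xB.
    have h : \forall K \near \oo, [set u K | K in Q] (u K).
      by apply: filterS QK => K QK; exists K.
    exact: h.
  by exists K.
have xsum : \sum_i x ord0 i = 1.
  apply/eqP; apply: contraT => ne.
  have sc : continuous (fun y : 'rV[R]_n.+1 => \sum_i y ord0 i).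
    by apply: continuous_big => [|i _]; [exact: add_continuous|exact: coord_continuous].
  have nB : nbhs x [set y : 'rV[R]_n.+1 | \sum_i y ord0 i != 1].
    apply: (sc x [set s | s != 1]); apply: open_nbhs_nbhs; split; last exact: ne.
    exact: (@open_neq R 1).
  have [K [/eqP]] := freq _ (fun=> True) nB (nearW _ (fun=> I)).
  by rewrite usum.
exists x; split => //; first by move=> i; have := x01 i; rewrite /= in_itv /= => /andP[].
move=> i xi j; rewrite leNgt; apply/negP => Gji.
have nB : nbhs x [set y | G y j < G y i /\ x ord0 i / 2 < y ord0 i].
  have c1 : {for x, continuous (fun y : 'rV[R]_n.+1 => G y i - G y j)}.
    exact: (cvgB (Gc i x) (Gc j x)).
  have c2 : {for x, continuous (fun y : 'rV[R]_n.+1 => y ord0 i)} by exact: coord_continuous.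
  have h1 : nbhs x [set y : 'rV[R]_n.+1 | 0 < G y i - G y j].
    by apply: (cvgr_gt _ c1); rewrite subr_gt0.
  have h2 : nbhs x [set y : 'rV[R]_n.+1 | x ord0 i / 2 < y ord0 i].
    by apply: (cvgr_gt _ c2); lra.
  by apply: filterS2 h1 h2 => y /=; rewrite subr_gt0.
have /nbhs_ballP[e /= e0 eB] := nB.
(* e / 2 leaves room for the size of the cell; below x_i / 2, so that i is a colour met *)
pose d := Num.min (e / 2) (x ord0 i / 2).
have d0 : 0 < d by rewrite lt_min !divr_gt0.
have [K [uK Kd]] : exists K, ball x (e / 2) (u K) /\ n%:R / K.+1%:R < d.
  apply: freq; first by apply: nbhsx_ballx; rewrite divr_gt0.
  have : (fun K => n%:R * (K.+1%:R)^-1) @ \oo --> (n%:R * 0 : R).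
    by apply: cvgMr; exact: cvg_harmonic.
  rewrite mulr0 => /cvgr_lt; apply => //.
have small a b : (a <= b + n)%N -> (a%:R / K.+1%:R : R) <= b%:R / K.+1%:R + n%:R / K.+1%:R.
  by move=> ab; rewrite -mulrDl -natrD ler_pM2r ?invr_gt0 // ler_nat.
have de : d <= e / 2 by rewrite ge_min lexx.
have dx : d <= x ord0 i / 2 by rewrite ge_min lexx orbT.
clearbody d.
have key (p q s : R) : p <= q + s -> q <= p + s -> s < e / 2 -> `|p - q| < e / 2.
  by move=> *; rewrite ltr_norml; apply/andP; split; lra.
have inB y : ball x (e / 2) y -> ball x e y by apply: le_ball; lra.
have [C [Cout Cin]] := PH K.
have [iC|iC] := boolP (i \in C); last first.
  have [_] := eB _ (inB _ uK); rewrite mxE.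
  have := small _ 0%N (Cout _ iC); rewrite mul0r add0r => H.
  by move=> /lt_le_trans /(_ H); rewrite ltNge (le_trans (ltW Kd) dx).
have [y cy yx] := Cin _ iC.
have [] : G (pt K y) j < G (pt K y) i /\ x ord0 i / 2 < pt K y ord0 i.
  apply: eB; apply: (ball_split uK).
  split; first by lra.
  move=> k0 k; rewrite !ord1 /ball /= !mxE; have [/small h1 /small h2] := yx k.
  exact: key h1 h2 (lt_le_trans Kd de).
by rewrite -cy ltNge cP.
Unshelve. all: by end_near. Qed.

Lemma continuous_row (T : topologicalType) n (g : T -> 'rV[R]_n) :
  (forall k, continuous (fun y => g y ord0 k)) -> continuous g.
Proof.
move=> gk x A /nbhs_ballP[e /= e0 eA].
have h : nbhs x [set y | forall k, `|g x ord0 k - g y ord0 k| < e].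
  apply: (@filter_forall _ _ (fun k y => `|g x ord0 k - g y ord0 k| < e)) => k.
  by have /cvgrPdist_lt := gk k x; apply.
by apply: filterS h => y h; apply: eA; split => // i k; rewrite !ord1; exact: h.
Qed.

(** A continuous field pointing outwards far away has a zero. The simplex is mapped
    affinely onto a corner simplex z around the origin, and the field is extended
    by a component 0 at the extra vertex. At a solution of the variational
    inequality the sum of F_i z_i is nonpositive, so z is not far away, hence
    interior, hence all components of G are equal, to the extra one. *)
Lemma coercive_zero n (F : 'rV[R]_n -> 'I_n -> R) (rho : R) :
  (forall i, continuous (F^~ i)) ->
  (forall x : 'rV[R]_n, (exists i, rho <= `|x ord0 i|) ->
    0 < \sum_i F x i * x ord0 i) ->
  exists x, forall i, F x i = 0.
Proof.
move=> Fc; wlog rho0 : rho / 0 < rho => [H coer|coer].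
  have [|x [i ix]|x xP] := H (Num.max rho 1); last by exists x.
    by rewrite lt_max ltr01 orbT.
  by apply: coer; exists i; apply: le_trans ix; rewrite le_max lexx.
pose L := n.+1%:R * rho; have L0 : 0 < L by rewrite mulr_gt0.
have n1 : (1 : R) <= n.+1%:R by rewrite ler1n.
pose z (x : 'rV[R]_n.+1) : 'rV[R]_n := \row_k (L * (n.+1%:R * x ord0 (lift ord0 k) - 1)).
pose G x i := oapp (F (z x)) 0 (unlift ord0 i).
have zc : continuous z.
  apply: continuous_row => k; rewrite /z.
  rewrite [X in continuous X](_ : _ = fun y : 'rV[R]_n.+1 =>
    L * (n.+1%:R * y ord0 (lift ord0 k) - 1)); last by apply/funext => w; rewrite mxE.
  move=> y; have cy := @coord_continuous R _ _ ord0 (lift ord0 k) y.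
  exact: (cvgM (cvg_cst _) (cvgB (cvgM (cvg_cst _) cy) (cvg_cst _))).
have Gc i : continuous (G^~ i).
  rewrite /G; case: (unlift ord0 i) => [k|] /=; last exact: cst_continuous.
  by move=> x; exact: (continuous_comp (zc x) (Fc k (z x))).
have [x [x_ge0 x1 xG]] := simplex_variational Gc.
pose m := [arg min_(i < ord0) G x i]%O.
have mP i : G x m <= G x i by rewrite /m; case: arg_minP => // j _; apply.
have G0 : G x ord0 = 0 by rewrite /G unlift_none.
have GF k : G x (lift ord0 k) = F (z x) k by rewrite /G liftK.
have xGm i : x ord0 i * G x i = x ord0 i * G x m.
  have := x_ge0 i; rewrite le_eqVlt => /orP[/eqP <-|xi]; first by rewrite !mul0r.
  by congr *%R; apply/le_anti; rewrite mP (xG _ xi).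
have sumG : \sum_i x ord0 i * G x i = G x m.
  by under eq_bigr do rewrite xGm; rewrite -mulr_suml x1 mul1r.
have Fz : \sum_k F (z x) k * z x ord0 k <= 0.
  have -> : \sum_k F (z x) k * z x ord0 k = L * \sum_(i < n.+1) (G x m - G x i).
    rewrite sumrB sumr_const card_ord -mulr_natl -{1}sumG !big_ord_recl G0 mulr0 !add0r.
    rewrite mulrBr !mulr_sumr -sumrB; apply: eq_bigr => k _.
    by rewrite GF mxE; ring.
  by apply: mulr_ge0_le0 (ltW L0) _; apply: sumr_le0 => i _; rewrite subr_le0.
have zrho k : `|z x ord0 k| < rho.
  rewrite ltNge; apply/negP => h; have := coer (z x); rewrite ltNge Fz.
  by move=> H; have := H (ex_intro _ k h).
have xpos i : 0 < x ord0 i.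
  have xz k : x ord0 (lift ord0 k) = (z x ord0 k / L + 1) / n.+1%:R.
    rewrite mxE; field; rewrite (gt_eqF L0) /=.
    by rewrite ?natr1 ?nat1r pnatr_eq0.
  case: (unliftP ord0 i) => [k|] -> {i}.
    have := zrho k; rewrite ltr_norml => /andP[z1 _].
    rewrite xz divr_gt0 // -[1](divff (lt0r_neq0 L0)) -mulrDl divr_gt0 //.
    rewrite -ltrBlDr sub0r; apply: le_lt_trans z1.
    by rewrite lerN2 ler_peMl // ltW.
  have : x ord0 ord0 + \sum_k x ord0 (lift ord0 k) = 1 by rewrite -x1 big_ord_recl.
  suff : \sum_(k < n) x ord0 (lift ord0 k) < 1 by lra.
  apply: (@le_lt_trans _ _ (\sum_(k < n) n.+1%:R^-1 * (rho / L + 1))).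
    apply: ler_sum => k _; rewrite xz mulrC ler_pM2l ?invr_gt0 // lerD2r.
    by rewrite ler_pM2r ?invr_gt0 //; have := zrho k; rewrite ltr_norml => /andP[_ /ltW].
  rewrite sumr_const card_ord -[X in X < _]mulr_natl /L.
  have -> : n%:R * (n.+1%:R^-1 * (rho / (n.+1%:R * rho) + 1)) =
     n%:R * (n.+1%:R + 1) / (n.+1%:R * n.+1%:R) :> R.
    field; rewrite (gt_eqF rho0) /=.
    by rewrite ?nat1r ?natr1 pnatr_eq0.
  rewrite ltr_pdivrMr ?mulr_gt0 // mul1r -natr1; nra.
exists (z x) => k; rewrite -GF.
have g i : G x i = 0.
  by apply/le_anti; rewrite -G0 (xG _ (xpos i)) (xG _ (xpos ord0)).
exact: g.
Qed.

End variational.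

(** * Finitely spanned subspaces and Galerkin systems *)

Section subspaces.
Context {R : realType} {W : lmodType R}.
Implicit Types (S : W -> Prop) (l : W -> R) (q : W -> W -> R).

(** Subspaces are predicates because the finite element spaces are given as such. *)
Definition submodule S := S 0 /\ forall a x y, S x -> S y -> S (a *: x + y).

(** Linearity is asked on a subspace only: forms built on weak derivatives or
    integrals are linear there and arbitrary elsewhere. *)
Definition linear_on S l :=
  forall a x y, S x -> S y -> l (a *: x + y) = a * l x + l y.

Definition fin_span S := exists k (e : 'I_k -> W),
  (forall i, S (e i)) /\
  forall x, S x -> exists c : 'I_k -> R, x = \sum_i c i *: e i.

Lemma submodule_sum S (I : Type) (r : seq I) (c : I -> R) (e : I -> W) :
  submodule S -> (forall i, S (e i)) -> S (\sum_(i <- r) c i *: e i).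
Proof.
by move=> [S0 SD] Se; elim/big_rec: _ => // i x _ Sx; exact: SD.
Qed.

Lemma submoduleD S x y : submodule S -> S x -> S y -> S (x + y).
Proof. by move=> [_ SD] Sx Sy; have := SD 1 _ _ Sx Sy; rewrite scale1r. Qed.

Lemma submoduleZ S a x : submodule S -> S x -> S (a *: x).
Proof. by move=> [S0 SD] Sx; have := SD a _ _ Sx S0; rewrite addr0. Qed.

Lemma submoduleB S x y : submodule S -> S x -> S y -> S (x - y).
Proof.
by move=> [_ SD] Sx Sy; have := SD (-1) _ _ Sy Sx; rewrite scaleN1r addrC.
Qed.

Lemma linear_on0 S l : submodule S -> linear_on S l -> l 0 = 0.
Proof.
move=> [S0 _] /(_ 1 _ _ S0 S0); rewrite scale1r addr0 mul1r => /eqP.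
by rewrite -subr_eq0 opprD addNKr oppr_eq0 => /eqP.
Qed.

Lemma linear_onZ S l a x : submodule S -> linear_on S l -> S x -> l (a *: x) = a * l x.
Proof.
move=> Ss ll Sx; have [S0 _] := Ss.
by have := ll a _ _ Sx S0; rewrite (linear_on0 Ss ll) !addr0.
Qed.

Lemma linear_onD S l x y : linear_on S l -> S x -> S y -> l (x + y) = l x + l y.
Proof. by move=> ll Sx Sy; rewrite -[x]scale1r ll // mul1r scale1r. Qed.

Lemma linear_onB S l x y : linear_on S l -> S x -> S y -> l (x - y) = l x - l y.
Proof.
by move=> ll Sx Sy; rewrite addrC -scaleN1r ll // mulN1r addrC.
Qed.

Lemma linear_on_sum S l (I : Type) (r : seq I) (c : I -> R) (e : I -> W) :
  submodule S -> linear_on S l -> (forall i, S (e i)) ->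
  l (\sum_(i <- r) c i *: e i) = \sum_(i <- r) c i * l (e i).
Proof.
move=> Ss ll Se; elim: r => [|i r IH]; first by rewrite !big_nil (linear_on0 Ss ll).
by rewrite !big_cons ll // ?IH //; exact: submodule_sum.
Qed.

(** Coordinates given by a mere relation suffice, provided the coordinates 0 belong
    to the zero vector only. This covers finite element functions
    without asking whether their polynomial pieces are unique. A family with
    linearly independent coordinates and maximal length spans. *)
Lemma fin_span_rep S m (rep : W -> 'rV[R]_m -> Prop) : submodule S ->
  (forall x, S x -> exists c, rep x c) ->
  (forall a x y c d, rep x c -> rep y d -> rep (a *: x + y) (a *: c + d)) ->
  (forall x, S x -> rep x 0 -> x = 0) -> fin_span S.
Proof.
move=> Ss Srep repD rep0.
pose P r := `[< exists (e : 'I_r -> W) (C : 'M[R]_(r, m)),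
  (forall i, S (e i) /\ rep (e i) (row i C)) /\ row_free C >].
have P0 : exists r, P r.
  exists 0%N; apply/asboolP; exists (fun=> 0), 0; split; first by case.
  by rewrite /row_free mxrank0.
have Pm r : P r -> (r <= m)%N.
  by move=> /asboolP[e [C [_ /eqP <-]]]; exact: rank_leq_col.
case: (ex_maxnP P0 Pm) => r /asboolP[e [C [eC freeC]]] rmax.
exists r, e; split => [i|x Sx]; first by case: (eC i).
have [c xc] := Srep x Sx.
have [|cC] := boolP (c <= C)%MS.
  move=> /submxP[w cw]; exists (fun i => w ord0 i); apply/eqP; rewrite -subr_eq0.
  have Se i : S (e i) by case: (eC i).
  apply/eqP/rep0; first by apply: submoduleB => //; exact: submodule_sum.
  have sumrep : rep (\sum_(i < r) w ord0 i *: e i + 0) (\sum_(i < r) w ord0 i *: row i C + 0).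
    have [S0 _] := Ss; have rep00 : rep 0 0.
      have [c0 h] := Srep 0 S0; have := repD (-1) _ _ _ _ h h.
      by rewrite !scaleN1r !addNr.
    elim: (index_enum _) => [|i s IH]; first by rewrite !big_nil !addr0.
    by rewrite !big_cons -!addrA; apply: repD => //; case: (eC i).
  rewrite !addr0 -(mulmx_sum_row w C) -cw in sumrep.
  by have := repD (-1) _ _ _ _ sumrep xc; rewrite !scaleN1r addNr addrC.
have : P r.+1.
  apply/asboolP.
  exists (fun i => oapp e x (unlift ord0 i)), (\matrix_i oapp (fun j => row j C) c (unlift ord0 i)).
  split => [i|].
    by rewrite rowK; case: (unlift ord0 i) => [j|] //=.
  rewrite -kermx_eq0; apply/rowV0P => v /sub_kermxP.
  rewrite mulmx_sum_row big_ord_recl rowK unlift_none /=.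
  under eq_bigr do rewrite rowK liftK /=.
  move=> v0; have v00 : v ord0 ord0 = 0.
    apply/eqP; apply: contraNT cC => v00.
    move/eqP: v0; rewrite addr_eq0 => /eqP /(congr1 (fun z => (v ord0 ord0)^-1 *: z)).
    rewrite scalerA mulVf // scale1r => ->.
    apply: scalemx_sub; rewrite eqmx_opp; apply: summx_sub => i _.
    by apply: scalemx_sub; exact: row_sub.
  have w0 : \row_i v ord0 (lift ord0 i) = 0.
    move: v0; rewrite v00 scale0r add0r => v0.
    have wC : (\row_(i < r) v ord0 (lift ord0 i)) *m C = 0.
      rewrite mulmx_sum_row -[RHS]v0; apply: eq_bigr => i _; by rewrite mxE.
    move/row_freeP: freeC => [D CD].
    by rewrite -[LHS]mulmx1 -CD mulmxA wC mul0mx.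
  apply/rowP => i; rewrite mxE; case: (unliftP ord0 i) => [j|] -> //.
  by move/rowP/(_ j): w0; rewrite !mxE.
by move=> /rmax; rewrite ltnn.
Qed.

Lemma fin_span_sub S S' : submodule S -> fin_span S -> submodule S' ->
  (forall x, S' x -> S x) -> fin_span S'.
Proof.
move=> Ss [k [e [Se span]]] Ss' sub.
apply: (@fin_span_rep S' k (fun x c => x = \sum_i c ord0 i *: e i)) => //.
- by move=> x /sub/span[c ->]; exists (\row_i c i); apply: eq_bigr => i _; rewrite mxE.
- move=> a x y c d -> ->; rewrite scaler_sumr -big_split /=; apply: eq_bigr => i _.
  by rewrite !mxE scalerDl scalerA.
- by move=> x _ ->; rewrite big1 // => i _; rewrite mxE scale0r.
Qed.

(** The Lagrange multiplier rule: a functional vanishing on a common kernel is a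
    combination. It is solvability of a linear system by Fredholm's alternative. *)
Lemma functional_in_span S p (f : 'I_p -> W -> R) l :
  submodule S -> fin_span S -> (forall j, linear_on S (f j)) -> linear_on S l ->
  (forall x, S x -> (forall j, f j x = 0) -> l x = 0) ->
  exists y : 'I_p -> R, forall x, S x -> l x = \sum_j y j * f j x.
Proof.
move=> Ss [k [e [Se span]]] fl ll ker.
pose A := \matrix_(i < k, j < p) f j (e i).
pose b := \col_(i < k) l (e i).
have /submxP[y yA] : (b^T <= A^T)%MS.
  rewrite submxE -trmx_eq0 trmx_mul trmxK; apply/eqP/row_matrixP => i.
  rewrite row0 row_mul; set v := row i _.
  have vA : v *m A = 0.
    by rewrite -[A]trmxK -row_mul -trmx_mul mulmx_coker trmx0 row0.
  apply/rowP => j; rewrite !mxE ord1.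
  rewrite -[RHS](ker (\sum_i v ord0 i *: e i) (submodule_sum _ _ Ss Se)).
    rewrite (linear_on_sum _ _ Ss ll Se).
    by apply: eq_bigr => r _; rewrite [b _ _]mxE.
  move=> r; rewrite (linear_on_sum _ _ Ss (fl r) Se).
  move/rowP/(_ r): vA; rewrite [RHS]mxE => vr; rewrite -[RHS]vr mxE.
  by apply: eq_bigr => s _; rewrite [A _ _]mxE.
exists (fun j => y ord0 j) => x /span[c ->].
rewrite (linear_on_sum _ _ Ss ll Se).
under [RHS]eq_bigr do rewrite (linear_on_sum _ _ Ss (fl _) Se) mulr_sumr.
rewrite exchange_big /=; apply: eq_bigr => i _.
move/rowP/(_ i): yA; rewrite !mxE => ->; rewrite mulr_sumr; apply: eq_bigr => j _.
by rewrite !mxE; ring.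
Qed.

(** The form q may be degenerate: existence in a finite-dimensional space only needs
    l to vanish where q does. Symmetry is replaced by linearity on both sides. *)
Lemma riesz_on S q l : submodule S -> fin_span S ->
  (forall x, S x -> linear_on S (q x)) -> (forall y, S y -> linear_on S (q^~ y)) ->
  linear_on S l -> (forall x, S x -> q x x = 0 -> l x = 0) ->
  exists2 v, S v & forall x, S x -> q v x = l x.
Proof.
move=> Ss fS qr ql ll ker; have [k [e [Se span]]] := fS.
have [x Sx xe|y yP] := functional_in_span Ss fS (fun j => qr _ (Se j)) ll.
- apply: ker => //; have [c ec] := span x Sx.
  rewrite {1}ec (linear_on_sum _ _ Ss (ql _ Sx) Se) big1 // => i _.
  by rewrite xe mulr0.
exists (\sum_j y j *: e j); first exact: submodule_sum.
by move=> x Sx; rewrite (linear_on_sum _ _ Ss (ql _ Sx) Se) yP.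
Qed.

Section orthonormal.
Variables (S : W -> Prop) (q : W -> W -> R).
Hypotheses (Ss : submodule S) (fS : fin_span S).
Hypothesis q_lin : forall x, S x -> linear_on S (q x).
Hypothesis q_sym : forall x y, S x -> S y -> q x y = q y x.
Hypothesis q_ge0 : forall x, S x -> 0 <= q x x.

Let ql y : S y -> linear_on S (q^~ y).
Proof.
move=> Sy a x z Sx Sz; have Sxz : S (a *: x + z) by apply Ss.2.
by rewrite q_sym // q_lin // !(q_sym Sy).
Qed.

Let orthonormal n (E : 'I_n -> W) :=
  (forall i, S (E i)) /\ forall i j, q (E i) (E j) = (i == j)%:R.

(** For a semidefinite form: a maximal orthonormal family, after subtraction of
    which only null vectors remain. *)
Lemma orthonormal_frame : exists n (E : 'I_n -> W),
  [/\ forall i, S (E i), forall i j, q (E i) (E j) = (i == j)%:R &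
   forall x, S x -> exists r, [/\ S r, q r r = 0 & x = \sum_i q x (E i) *: E i + r]].
Proof.
have [k [e [Se span]]] := fS.
pose P n := `[< exists E : 'I_n -> W, orthonormal E >].
have P0 : exists n, P n.
  by exists 0%N; apply/asboolP; exists (fun=> 0); split; case.
have Pk n : P n -> (n <= k)%N.
  move=> /asboolP[E [SE EE]].
  have [c cP] : {c : 'I_n -> 'I_k -> R | forall i, E i = \sum_j c i j *: e j}.
    by have [c cP] := boolp.choice (fun i => span _ (SE i)); exists c.
  pose C := \matrix_(i, j) c i j.
  suff : row_free C by move=> /eqP <-; exact: rank_leq_col.
  apply/row_freeP; exists (\matrix_(i < k, j < n) q (e i) (E j)).
  apply/matrixP => i j; rewrite !mxE -EE [in RHS]cP (linear_on_sum _ _ Ss (ql (SE j)) Se).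
  by apply: eq_bigr => r _; rewrite !mxE.
case: (ex_maxnP P0 Pk) => n /asboolP[E [SE EE]] nmax.
exists n, E; split => // x Sx.
set s := \sum_i q x (E i) *: E i.
have Ss1 : S s by exact: submodule_sum.
have Sr : S (x - s) by exact: submoduleB.
have orth i : q (E i) (x - s) = 0.
  rewrite (linear_onB (q_lin (SE i)) Sx Ss1) (linear_on_sum _ _ Ss (q_lin (SE i)) SE).
  rewrite (bigD1 i) //= EE eqxx mulr1 big1 ?addr0 => [|j ji].
    by rewrite q_sym // subrr.
  by rewrite EE eq_sym (negbTE ji) mulr0.
exists (x - s); split => //; last by rewrite subrKC.
apply/eqP; apply: contraT => ne0; have pos : 0 < q (x - s) (x - s) by rewrite lt_def ne0 q_ge0.
pose t := (Num.sqrt (q (x - s) (x - s)))^-1 *: (x - s).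
have St : S t by exact: submoduleZ.
have tt : q t t = 1.
  rewrite /t (linear_onZ _ Ss (ql _)) ?(linear_onZ _ Ss (q_lin _)) //.
  rewrite mulrA -expr2 exprVn sqr_sqrtr ?mulVf //; exact: ltW.
have tE i : q (E i) t = 0 by rewrite /t (linear_onZ _ Ss (q_lin _)) // orth mulr0.
suff /nmax : P n.+1 by rewrite ltnn.
apply/asboolP; exists (fun i => oapp E t (unlift ord0 i)); split => [i|i j].
  by case: (unlift ord0 i) => /=.
case: (unliftP ord0 i) => [i'|] ->; case: (unliftP ord0 j) => [j'|] -> /=.
- by rewrite EE (inj_eq lift_inj).
- by rewrite tE.
- by rewrite q_sym // tE.
- by rewrite tt.
Qed.

(** In the coordinates of an orthonormal frame of q, coercivity with respect to q
    says that the field of the residuals points outwards far away; the null vectors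
    of q, which the frame does not see, are assumed to be harmless test vectors. *)
Theorem galerkin (Phi : W -> W -> R) (rho : R) :
  (forall s, S s -> linear_on S (Phi s)) ->
  (forall s r, S s -> S r -> q r r = 0 -> Phi s r = 0) ->
  (forall n (E : 'I_n -> W) t, (forall i, S (E i)) -> S t ->
     continuous (fun x : 'rV[R]_n => Phi (\sum_i x ord0 i *: E i) t)) ->
  (forall s, S s -> rho <= q s s -> 0 < Phi s s) ->
  exists2 s, S s & forall t, S t -> Phi s t = 0.
Proof.
move=> lin null cont coer; have [n [E [SE EE frame]]] := orthonormal_frame.
have Ssum (c : 'I_n -> R) : S (\sum_i c i *: E i) by exact: submodule_sum.
(* the maximum with 1, so that the square of a large coordinate exceeds it *)
have [||x x0] := @coercive_zero R n
  (fun x i => Phi (\sum_i x ord0 i *: E i) (E i)) (Num.max rho 1).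
- by move=> i; exact: cont.
- move=> x [i xi]; set s := \sum_i x ord0 i *: E i.
  have -> : \sum_i Phi s (E i) * x ord0 i = Phi s s.
    rewrite {3}/s (linear_on_sum _ _ Ss (lin _ (Ssum _)) SE).
    by apply: eq_bigr => j _; rewrite mulrC.
  apply: coer; first exact: Ssum.
  have -> : q s s = \sum_j x ord0 j ^+ 2.
    rewrite {1}/s (linear_on_sum _ _ Ss (ql (Ssum _)) SE); apply: eq_bigr => j _.
    rewrite /s (linear_on_sum _ _ Ss (q_lin (SE j)) SE) (bigD1 j) //= EE eqxx mulr1.
    rewrite big1 ?addr0 ?expr2 // => k kj; by rewrite EE eq_sym (negbTE kj) mulr0.
  have /andP[x1 x2] : (1 <= `|x ord0 i|) && (rho <= `|x ord0 i|).
    by move: xi; rewrite ge_max andbC.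
  rewrite (bigD1 i) //= -real_normK ?num_real // expr2.
  apply: le_trans x2 _; apply: (@le_trans _ _ (`|x ord0 i| * `|x ord0 i|)).
    by rewrite ler_peMl.
  by rewrite lerDl; apply: sumr_ge0 => j _; exact: sqr_ge0.
exists (\sum_i x ord0 i *: E i) => // t St; have [r [Sr r0 ->]] := frame t St.
rewrite (linear_onD (lin _ (Ssum _))) // (null _ r) // addr0.
rewrite (linear_on_sum _ _ Ss (lin _ (Ssum _)) SE) big1 // => i _.
by rewrite x0 mulr0.
Qed.

End orthonormal.
End subspaces.

(** * Lebesgue measure on a box *)

Section bounded_functions.
Context {d} {T : measurableType d} {R : realType}.
Implicit Types (f : T -> R) (D : set T).

Lemma bounded_on f D C : (forall x, D x -> `|f x| <= C) -> [bounded f x | x in D].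
Proof.
move=> h; exists C; split; first exact: num_real.
by move=> M CM x Dx /=; exact: le_trans (h x Dx) (ltW CM).
Qed.

Lemma bounded_integrable (mu : {measure set T -> \bar R}) f D C :
  measurable D -> (mu D < +oo)%E -> measurable_fun D f ->
  (forall x, D x -> `|f x| <= C) -> mu.-integrable D (EFin \o f).
Proof.
by move=> mD fD mf bf; apply: measurable_bounded_integrable => //; exact: bounded_on bf.
Qed.

End bounded_functions.

Section continuous_measurable.
Context {R : realType}.

Lemma measurable_coord_preimage n (i : 'I_n) (B : set R) : measurable B ->
  measurable [set x : 'rV[R]_n | B (x ord0 i)].
Proof.
move=> mB; rewrite -[X in measurable X]setTI.
exact: (@measurable_coord R n i measurableT B mB).
Qed.

Lemma measurable_forall n (P : 'I_n -> set 'rV[R]_n) :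
  (forall i, measurable (P i)) -> measurable [set x | forall i, P i x].
Proof.
move=> mP; rewrite (_ : [set x | _] = \big[setI/setT]_(i < n) P i).
  by elim/big_ind: _ => //; exact: measurableI.
apply/seteqP; split => x /= Px; first by elim/big_ind: _ => // A B HA HB; split.
by move=> i; move: Px; rewrite (bigD1 i) //= => -[].
Qed.

(** The sigma-algebra is generated by the coordinates, so open sets have to be
    reached: f is the limit of its values at the points rounded down to the lattice
    of mesh 1/(k+1), and these take countably many values on measurable cubes. *)
Lemma continuous_measurable_row n (f : 'rV[R]_n -> R) :
  continuous f -> measurable_fun setT f.
Proof.
move=> cf; pose Z k (x : 'rV[R]_n) := [ffun i => Num.floor (k.+1%:R * x ord0 i)].
pose g k (z : {ffun 'I_n -> int}) := f (\row_i ((z i)%:~R / k.+1%:R)).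
suff mgZ k : measurable_fun setT (g k \o Z k).
  apply/measurable_EFinP; apply: (emeasurable_fun_cvg (fun k => EFin \o (g k \o Z k))).
    by move=> k; exact/measurable_EFinP.
  move=> x _; apply: cvg_EFin; first exact: nearW.
  have rx : (fun k => \row_i ((Z k x i)%:~R / k.+1%:R)) @ \oo --> x.
    move=> A /nbhs_ballP[e /= e0 eA].
    have : \forall k \near \oo, (k.+1%:R^-1 : R) < e.
      by have /cvgr_lt := @cvg_harmonic R; apply.
    apply: filterS => k ke /=; apply: eA; split => // i j.
    rewrite /ball /= mxE !ord1 ffunE.
    set y := x ord0 j; have /andP[h1 h2] := floor_itv (k.+1%:R * y).
    have k0 : (0 : R) < k.+1%:R by [].
    rewrite ltr_norml; apply/andP; split.
      rewrite (@lt_le_trans _ _ 0) ?oppr_lt0 // subr_ge0 ler_pdivrMr //.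
      by rewrite [leRHS]mulrC.
    apply: le_lt_trans ke; rewrite lerBlDr -[X in _ <= X + _]mul1r -mulrDl.
    rewrite ler_pdivlMr // [leLHS]mulrC addrC.
    by move: h2; rewrite intrD => /ltW.
  exact: (cvg_comp _ _ rx (cf x)).
move=> _ B mB; rewrite setTI.
rewrite (_ : _ @^-1` B = \bigcup_z (if z \in g k @^-1` B then Z k @^-1` [set z] else set0)).
  apply: countable_bigcupT_measurable => [|z]; first exact: countableP.
  case: ifP => _ //.
  rewrite [X in measurable X](_ : _ = [set x : 'rV[R]_n | forall i, `[(z i)%:~R, (z i + 1)%:~R[%classic (k.+1%:R * x ord0 i)]).
    apply: measurable_forall => i.
    apply: (@measurable_coord_preimage n i [set t | `[(z i)%:~R, (z i + 1)%:~R[%classic (k.+1%:R * t)]).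
    rewrite -[X in measurable X]setTI.
    have mm : measurable_fun setT (fun t : R => k.+1%:R * t) by exact: mulrl_measurable.
    apply: mm => //; exact: measurable_itv.
  apply/seteqP; split => x /=.
    by move=> zx i; rewrite -zx ffunE in_itv /=; exact: floor_itv.
  by move=> H; apply/ffunP => i; rewrite ffunE; apply: floor_def; have := H i; rewrite in_itv.
apply/seteqP; split => x /=.
  by move=> Bx; exists (Z k x) => //; rewrite mem_set.
by move=> [z _]; case: ifP => // /set_mem /= gz zx; rewrite zx.
Qed.

End continuous_measurable.

Section box.
Context {R : realType}.

Definition box n (a : 'rV[R]_n) (s : R) : set 'rV[R]_n :=
  [set x | forall i, a ord0 i <= x ord0 i <= a ord0 i + s].

Definition row_tail n (a : 'rV[R]_n.+1) : 'rV[R]_n := \row_i a ord0 (lift ord0 i).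

Lemma measurable_box n (a : 'rV[R]_n) s : measurable (box a s).
Proof.
apply: measurable_forall => i.
apply: (@measurable_coord_preimage R n i [set t | a ord0 i <= t <= a ord0 i + s]).
rewrite (_ : [set t | _] = `[a ord0 i, a ord0 i + s]%classic) //.
Qed.

Lemma compact_box n (a : 'rV[R]_n) s : compact (box a s).
Proof.
rewrite (_ : box a s = [set v : 'rV[R]_n | forall i, `[a ord0 i, a ord0 i + s]%classic (v ord0 i)]).
  have := (@rV_compact R^o n (fun i => `[a ord0 i, a ord0 i + s]%classic)).
  by apply => i; exact: segment_compact.
by apply/seteqP; split => x /= H i; have := H i; rewrite in_itv.
Qed.

Lemma continuous_bounded_box n (a : 'rV[R]_n) s (f : 'rV[R]_n -> R) :
  continuous f -> exists2 C, 0 <= C & forall x, box a s x -> `|f x| <= C.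
Proof.
move=> cf; have := continuous_compact (@continuous_subspaceT _ _ (box a s) f cf) (@compact_box n a s).
move=> /compact_bounded[M [_ Mb]].
exists (Num.max M 0 + 1); first by rewrite addr_ge0 // le_max lexx orbT.
move=> x ax; apply: (Mb (Num.max M 0 + 1)).
  by rewrite (@le_lt_trans _ _ (Num.max M 0)) ?ltrDl // le_max lexx.
by exists x.
Qed.

Lemma row_cons0 n (p : measurableTypeR R * 'rV[R]_n) : row_cons p ord0 ord0 = p.1.
Proof. by rewrite mxE unlift_none. Qed.

Lemma row_consS n (p : measurableTypeR R * 'rV[R]_n) i : row_cons p ord0 (lift ord0 i) = p.2 ord0 i.
Proof. by rewrite mxE liftK. Qed.

Lemma row_cons_box n (a : 'rV[R]_n.+1) s :
  @row_cons R n @^-1` box a s = `[a ord0 ord0, a ord0 ord0 + s]%classic `*` box (row_tail a) s.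
Proof.
apply/seteqP; split => -[t y] /=.
  move=> H; split; first by have := H ord0; rewrite row_cons0 in_itv.
  by move=> i; have := H (lift ord0 i); rewrite row_consS /= mxE.
move=> [t1 y1] i; case: (unliftP ord0 i) => [j|] ->.
  by rewrite row_consS /=; have := y1 j; rewrite mxE.
by rewrite row_cons0; move: t1; rewrite in_itv.
Qed.

Lemma lebesgue_row_box n (a : 'rV[R]_n) s : 0 <= s ->
  lebesgue_row n (box a s) = (s ^+ n)%:E.
Proof.
move=> s0; elim: n a => [|n IH] a.
  by rewrite /= /dirac indicE mem_set //= => -[].
have -> : lebesgue_row n.+1 (box a s) =
    (lebesgue_measure \x lebesgue_row n)%E (@row_cons R n @^-1` box a s) by [].
have itv_s : lebesgue_measure (`[a ord0 ord0, a ord0 ord0 + s]%classic : set R) = s%:E.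
  rewrite lebesgue_measure_itv /= lte_fin; case: ifPn => [_|].
    by rewrite -EFinD addrAC subrr add0r.
  by rewrite ltrDl -leNgt => s0'; congr EFin; apply/le_anti; rewrite s0 s0'.
rewrite row_cons_box product_measure1E //; last exact: measurable_box.
by rewrite IH exprS EFinM; congr (_ * _)%E.
Qed.

Lemma lebesgue_row_hyperplane n (i : 'I_n) c :
  lebesgue_row n [set x : 'rV[R]_n | x ord0 i = c] = 0%E.
Proof.
elim: n i => [[]//|n IH] i.
have -> : lebesgue_row n.+1 [set x : 'rV[R]_n.+1 | x ord0 i = c] =
    (lebesgue_measure \x lebesgue_row n)%E (@row_cons R n @^-1` [set x | x ord0 i = c]) by [].
case: (unliftP ord0 i) => [j|] ->.
  rewrite (_ : _ @^-1` _ = setT `*` [set x : 'rV[R]_n | x ord0 j = c]).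
    rewrite product_measure1E ?IH ?mule0 //.
    exact: (@measurable_coord_preimage R n j [set c]).
  by apply/seteqP; split => -[t y] /=; rewrite row_consS //= => -[].
rewrite (_ : _ @^-1` _ = [set c] `*` setT).
  have c0 : lebesgue_measure ([set c] : set R) = 0%E by exact: lebesgue_measure_set1.
  by rewrite product_measure1E // [X in (X * _)%E]c0 mul0e.
by apply/seteqP; split => -[t y] /=; rewrite row_cons0 //= => -[].
Qed.

End box.

Section directional.
Context {R : realType} {n : nat}.
Implicit Types (f : 'rV[R]_n -> R) (x v : 'rV[R]_n).

Lemma lineE (t : R) (i k : 'I_n) x :
  (t *: dir i + x) ord0 k = t * (k == i)%:R + x ord0 k.
Proof. by rewrite !mxE eqxx. Qed.

(** The restriction of f to a line, through which directional derivatives become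
    derivatives in one variable. *)
Definition along f x v : R -> R := fun t => f (t *: v + x).

Lemma along_is_derive f x v (t : R) (l : R) :
  is_derive (t : R) (1 : R) (along f x v) l <-> is_derive (t *: v + x) v f l.
Proof.
have e : (fun h : R => h^-1 *: ((along f x v \o shift t) (h *: 1) - along f x v t)) =
         (fun h : R => h^-1 *: ((f \o shift (t *: v + x)) (h *: v) - f (t *: v + x))).
  apply/funext => h; rewrite /along /= /shift /=; congr (_ *: (f _ - _)).
  by rewrite scalerDl addrA; congr (_ *: _ + _ + _); rewrite /GRing.scale /= mulr1.
have dE : 'D_1 (along f x v) t = 'D_v f (t *: v + x) by rewrite /derive e.
by split=> -[h1 h2]; split; first [rewrite dE | rewrite -dE | rewrite /derivable -e
  | rewrite /derivable e].
Qed.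

End directional.

Section periodic_integral.
Context {R : realType}.

Lemma itv_integral_deriv (F F' : R -> R) (a b : R) : a < b ->
  (forall t : R, is_derive t (1 : R) F (F' t)) -> continuous F' ->
  (\int[lebesgue_measure]_(t in `[a, b]) (F' t)%:E = (F b - F a)%:E)%E.
Proof.
move=> ab dF cF'; rewrite EFinB.
have cF : continuous F.
  move=> t; apply: differentiable_continuous; apply/derivable1_diffP.
  by have [] := dF t.
apply: continuous_FTC2 => //.
- exact: continuous_subspaceT.
- split; last 2 first.
  + by apply: cvg_at_right_filter; exact: cF.
  + by apply: cvg_at_left_filter; exact: cF.
  by move=> t _; have [] := dF t.
- by move=> t _; rewrite derive1E; have [_ ->] := dF t.
Qed.

(** Fubini in the first variable: the inner integral vanishes by the fundamental
    theorem of calculus and periodicity if the derivative is in that variable, and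
    by induction on the slices otherwise. *)
Lemma integral_deriv_periodic n (a : 'rV[R]_n) s (i : 'I_n) (F F' : 'rV[R]_n -> R) :
  0 < s -> (forall x, is_derive x (dir i) F (F' x)) -> continuous F' ->
  (forall x, F (x + s *: dir i) = F x) ->
  (\int[lebesgue_row n]_(x in box a s) (F' x)%:E = 0)%E.
Proof.
move=> s0; elim: n a i F F' => [_ []//|n IH] a i F F' dF cF' perF.
pose B := box a s; pose J := `[a ord0 ord0, a ord0 ord0 + s]%classic.
pose B' := box (row_tail a) s.
have mB : measurable B by exact: measurable_box.
have mB' : measurable B' by exact: measurable_box.
have mF' : measurable_fun setT F' by exact: continuous_measurable_row.
have [C C0 bC] := continuous_bounded_box a s cF'.
pose h := fun p : measurableTypeR R * 'rV[R]_n => ((EFin \o F') \_ B) (row_cons p).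
have mh : measurable_fun setT h.
  apply: measurableT_comp; last exact: measurable_row_cons.
  apply/(measurable_restrictT _ mB); apply/measurable_EFinP; exact: measurable_funTS.
have fB : (lebesgue_row n.+1 B < +oo)%E by rewrite lebesgue_row_box ?ltry // ltW.
have intF : (lebesgue_row n.+1).-integrable setT ((EFin \o F') \_ B).
  apply/(integrable_mkcond _ mB); apply: (bounded_integrable (C := C)) => //.
  exact: measurable_funTS.
have inth : (lebesgue_measure \x lebesgue_row n)%E.-integrable setT h.
  apply/integrableP; split => //.
  have /integrableP[_] := intF; apply: le_lt_trans.
  rewrite [leRHS](_ : _ = (\int[lebesgue_measure \x lebesgue_row n]_p `|h p|)%E) //.
  rewrite -[LHS]/(\int[pushforward (lebesgue_measure \x lebesgue_row n)%E (@row_cons R n)]_x _)%E.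
  rewrite ge0_integral_pushforward //; first exact: measurable_row_cons.
  by apply: measurableT_comp => //; case/integrableP : intF.
have -> : (\int[lebesgue_row n.+1]_(x in B) (F' x)%:E = \int[lebesgue_measure \x lebesgue_row n]_p h p)%E.
  rewrite integral_mkcond.
  rewrite -[LHS]/(\int[pushforward (lebesgue_measure \x lebesgue_row n)%E (@row_cons R n)]_x _)%E.
  rewrite integral_pushforward //; first exact: measurable_row_cons.
  by case/integrableP : intF.
have hE t y : h (t, y) = if (t \in J) && (y \in B') then (F' (row_cons (t, y)))%:E else 0%E.
  rewrite /h patchE; congr (if _ then _ else _).
  have : B (row_cons (t, y)) <-> J t /\ B' y.
    by have := row_cons_box a s; move=> /seteqP[/(_ (t, y)) /= h1 /(_ (t, y)) /= h2]; split.
  move=> [h1 h2]; apply/idP/andP => [/set_mem/h1[? ?]|[/set_mem ? /set_mem ?]].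
    by split; exact: mem_set.
  by apply: mem_set; exact: h2.
case: (unliftP ord0 i) => [j|] ei; last first.
  rewrite -integral21_prod_meas1 //; apply: integral0_eq => y _.
  rewrite /fubini_G; have [yB|yB] := boolP (y \in B'); last first.
    by apply: integral0_eq => t _; rewrite hE (negbTE yB) andbF.
  transitivity (\int[lebesgue_measure]_(t in J) (F' (row_cons (t, y)))%:E)%E.
    by rewrite [RHS]integral_mkcond; apply: eq_integral => t _; rewrite hE yB andbT patchE.
  pose x0 := row_cons ((0 : R), y).
  have rE t : row_cons (t, y) = t *: dir i + x0.
    apply/rowP => k; rewrite lineE ei.
    case: (unliftP ord0 k) => [l|] ->; rewrite /x0 ?row_consS ?row_cons0 /=.
      by rewrite mulr0 add0r.
    by rewrite mulr1 addr0.
  transitivity (\int[lebesgue_measure]_(t in J) (F' (t *: dir i + x0))%:E)%E.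
    by apply: eq_integral => t _; rewrite rE.
  have ct : continuous (fun t : R => t *: dir i + x0).
    apply: continuous_row => k.
    rewrite (_ : (fun _ => _) = fun t : R => t * (k == i)%:R + x0 ord0 k).
      move=> u; exact: (cvgD (cvgM cvg_id (cvg_cst _)) (cvg_cst _)).
    by apply/funext => u; rewrite lineE.
  have cA : continuous (fun t : R => F' (t *: dir i + x0)).
    by move=> t; exact: (continuous_comp (ct t) (cF' _)).
  have dA (t : R) : is_derive t (1 : R) (along F x0 (dir i)) (F' (t *: dir i + x0)).
    exact/along_is_derive.
  have ab : a ord0 ord0 < a ord0 ord0 + s by rewrite ltrDl.
  have := itv_integral_deriv ab dA cA; rewrite /J => ->.
  rewrite /along (_ : _ + x0 = a ord0 ord0 *: dir i + x0 + s *: dir i).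
    by rewrite perF subrr.
  by rewrite scalerDl addrAC.
rewrite -integral12_prod_meas1 //; apply: integral0_eq => t _.
rewrite /fubini_F; have [tJ|tJ] := boolP (t \in J); last first.
  by apply: integral0_eq => y _; rewrite hE (negbTE tJ).
transitivity (\int[lebesgue_row n]_(y in B') (F' (row_cons (t, y)))%:E)%E.
  by rewrite [RHS]integral_mkcond; apply: eq_integral => y _; rewrite hE tJ patchE.
have rD y c : row_cons (t, c *: dir j + y) = c *: dir i + row_cons (t, y) :> 'rV[R]_n.+1.
  apply/rowP => k; rewrite lineE ei.
  case: (unliftP ord0 k) => [l|] ->; rewrite ?row_consS ?row_cons0 /=.
    by rewrite lineE (inj_eq lift_inj).
  by rewrite mulr0 add0r.
apply: (IH _ j (fun y => F (row_cons (t, y))) (fun y => F' (row_cons (t, y)))).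
- move=> y; rewrite -[y in is_derive y]add0r -(scale0r (dir j)); apply/along_is_derive.
  rewrite (_ : along _ _ _ = along F (row_cons (t, y)) (dir i)); last first.
    by apply/funext => c; rewrite /along rD.
  by apply/along_is_derive; rewrite scale0r add0r.
- have cr : continuous (fun y : 'rV[R]_n => row_cons (t, y)).
    apply: continuous_row => k; case: (unliftP ord0 k) => [l|] ->.
      rewrite (_ : (fun _ => _) = fun y : 'rV[R]_n => y ord0 l); first exact: coord_continuous.
      by apply/funext => y; rewrite row_consS.
    rewrite (_ : (fun _ => _) = fun y : 'rV[R]_n => t); first exact: cst_continuous.
    by apply/funext => y; rewrite row_cons0.
  by move=> y; exact: (continuous_comp (cr y) (cF' _)).
- move=> y; rewrite addrC rD [_ + row_cons _]addrC; exact: perF.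
Qed.

End periodic_integral.

(** * Smooth periodic test functions *)

Section logistic.
Context {R : realType}.
Implicit Types y : R.

(** A smooth substitute for the indicator of the half-line, satisfying the
    differential equation y' = y (1 - y); so a class of functions closed under
    products and composition with it is closed under derivatives. *)
Definition logistic y : R := (1 + expR (- y))^-1.

Let den_gt0 y : 0 < 1 + expR (- y).
Proof. by rewrite addr_gt0 // expR_gt0. Qed.

Lemma is_derive_logistic y :
  is_derive y (1 : R) logistic (logistic y * (1 - logistic y)).
Proof.
have dden : is_derive y (1 : R) (fun y => 1 + expR (- y)) (- expR (- y)).
  have h : is_derive y (1 : R) (expR \o -%R) (expR (- y) * -1) by apply: is_derive1_comp.
  have := is_deriveD (is_derive_cst (1 : R) y (1 : R)) h.
  by rewrite add0r mulrN1.
have := @is_deriveV R (fun y => 1 + expR (- y)) y _ _ (lt0r_neq0 (den_gt0 y)) dden.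
move/is_derive_eq; apply.
rewrite /logistic /GRing.scale /=; have := lt0r_neq0 (den_gt0 y).
by move: (expR (- y)) => e e0; field.
Qed.

Lemma continuous_logistic : continuous logistic.
Proof.
move=> y; apply: differentiable_continuous; apply/derivable1_diffP.
by have [] := is_derive_logistic y.
Qed.

Lemma logistic_gt0 y : 0 < logistic y.
Proof. by rewrite invr_gt0. Qed.

Lemma logistic_lt1 y : logistic y < 1.
Proof. by rewrite invf_lt1 // ltrDl expR_gt0. Qed.

Lemma logisticN y : logistic (- y) = 1 - logistic y.
Proof.
rewrite /logistic opprK expRN; have := expR_gt0 y; move: (expR y) => e e0.
by field; rewrite !gt_eqF ?addr_gt0.
Qed.

Lemma logistic_small k y : y <= - k%:R -> logistic y <= k.+1%:R^-1.
Proof.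
move=> yk; rewrite /logistic lef_pV2 ?posrE ?den_gt0 // -natr1.
by have := expR_ge1Dx (- y); lra.
Qed.

Lemma logistic_large k y : k%:R <= y -> 1 - k.+1%:R^-1 <= logistic y.
Proof.
move=> yk; have : logistic (- y) <= k.+1%:R^-1 by apply: logistic_small; rewrite lerN2.
by rewrite logisticN !lerBlDr addrC.
Qed.

End logistic.

Section test_functions.
Context {R : realType} {d : nat} (Om : cube R d).

Let w : R := pi *+ 2 / side Om.

(** Enough test functions with little calculus: all of them are periodic, and each
    derivative stays in the class, so smoothness is by induction. *)
Inductive trig : ('rV[R]_d -> R) -> Prop :=
| trig_cst c : trig (fun=> c)
| trig_cos i c : trig (fun x => cos (w * x ord0 i + c))
| trigD f g : trig f -> trig g -> trig (fun x => f x + g x)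
| trigM f g : trig f -> trig g -> trig (fun x => f x * g x)
| trig_logistic f : trig f -> trig (fun x => logistic (f x)).

Lemma trig_is_derive f i : trig f ->
  exists2 f', trig f' & forall x, is_derive x (dir i) f (f' x).
Proof.
elim => {f} [c|j c|f g _ [f' tf' df] _ [g' tg' dg]|f g tf [f' tf' df] tg [g' tg' dg]|f tf [f' tf' df]].
- by exists (fun=> 0); [exact: trig_cst|move=> x; exact: is_derive_cst].
- exists (fun x => (w * (j == i)%:R) * cos (w * x ord0 j + (c + pi / 2))).
    by apply: trigM; [exact: trig_cst|exact: trig_cos].
  move=> x; rewrite -[x in is_derive x]add0r -(scale0r (dir i)); apply/along_is_derive.
  have -> : along (fun x : 'rV[R]_d => cos (w * x ord0 j + c)) x (dir i) =
      cos \o ((w * (j == i)%:R) \*: (@idfun R) + cst (w * x ord0 j + c)).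
    apply/funext => t; rewrite /along lineE; congr cos.
    by transitivity ((w * (j == i)%:R) * t + (w * x ord0 j + c)); [ring|].
  set g := (X in cos \o X).
  have dg : is_derive (0 : R) (1 : R) g ((w * (j == i)%:R) *: 1 + 0).
    exact: is_deriveD.
  have := @is_derive1_comp R cos g 0 _ _ (is_derive_cos _) dg.
  move/is_derive_eq; apply.
  have -> : g 0 = w * x ord0 j + c.
    by transitivity ((w * (j == i)%:R) * 0 + (w * x ord0 j + c)); [|ring].
  by rewrite addrA cosDpihalf /GRing.scale /=; ring.
- exists (fun x => f' x + g' x); first exact: trigD.
  by move=> x; exact: is_deriveD.
- exists (fun x => f x * g' x + g x * f' x).
    by apply: trigD; exact: trigM.
  by move=> x; exact: is_deriveM.
- exists (fun x => (logistic (f x) * (1 + (-1) * logistic (f x))) * f' x).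
    apply: trigM => //; apply: trigM; first exact: trig_logistic.
    apply: trigD; first exact: trig_cst.
    by apply: trigM; [exact: trig_cst|exact: trig_logistic].
  move=> x; rewrite -[x in is_derive x]add0r -(scale0r (dir i)); apply/along_is_derive.
  have df0 : is_derive (0 : R) (1 : R) (along f x (dir i)) (f' x).
    by apply/along_is_derive; rewrite scale0r add0r.
  have f0 : along f x (dir i) 0 = f x by rewrite /along scale0r add0r.
  have := @is_derive1_comp R logistic _ 0 _ _ (is_derive_logistic _) df0.
  by rewrite f0; move/is_derive_eq; apply; rewrite mulN1r.
Qed.

Lemma trig_continuous f : trig f -> continuous f.
Proof.
elim => {f} [c|j c|f g _ cf _ cg|f g _ cf _ cg|f _ cf].
- exact: cst_continuous.
- move=> x; have cx := @coord_continuous R _ _ ord0 j x.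
  have cl : {for x, continuous (fun x : 'rV[R]_d => w * x ord0 j + c)}.
    exact: (cvgD (cvgM (cvg_cst _) cx) (cvg_cst _)).
  exact: (continuous_comp cl (@continuous_cos R _)).
- by move=> x; exact: (cvgD (cf x) (cg x)).
- by move=> x; exact: (cvgM (cf x) (cg x)).
- by move=> x; exact: (continuous_comp (cf x) (@continuous_logistic R _)).
Qed.

Lemma trig_periodic f : trig f -> Defs.periodic Om f.
Proof.
elim => {f} [//|j c|f g _ pf _ pg|f g _ pf _ pg|f _ pf] x i; rewrite ?pf ?pg //.
rewrite [x + _]addrC lineE; case: eqP => _ /=; last by rewrite mulr0 add0r.
rewrite mulr1 mulrDr {1}/w divfK ?gt_eqF ?side_gt0 // -addrA addrC.
exact: cosD2pi.
Qed.

Lemma trig_smooth f : trig f -> smooth f.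
Proof.
move=> tf s; have [g tg ->] : exists2 g, trig g & partials s f = g.
  elim: s => [|i s [g tg /= ->]]; first by exists f.
  have [g' tg' dg] := trig_is_derive i tg; exists g' => //.
  by apply/funext => x; exact: (@derive_val _ _ _ _ _ _ _ (dg x)).
split; first exact: trig_continuous.
by move=> x i; have [g' _ dg] := trig_is_derive i tg; have [] := dg x.
Qed.

End test_functions.

(** * The fundamental lemma of the calculus of variations *)

Section cube_measure.
Context {R : realType} {d : nat} (Om : cube R d).

Lemma measurable_cube : measurable (cube_set Om).
Proof. exact: (measurable_box (corner Om) (side Om)). Qed.

Lemma lebesgue_row_cube : lebesgue_row d (cube_set Om) = (side Om ^+ d)%:E.
Proof. exact: (lebesgue_row_box (corner Om) (ltW (side_gt0 Om))). Qed.

Lemma cube_finite : (lebesgue_row d (cube_set Om) < +oo)%E.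
Proof. by rewrite lebesgue_row_cube ltry. Qed.

End cube_measure.

Section arcs.
Context {R : realType}.

(** On a period [c, c + s[ the right rays are superlevel sets of a cosine centred at
    the middle of the ray. This is how a periodic function distinguishes points of
    the cube by one coordinate. *)
Lemma arc_ray (c s q t : R) : 0 < s -> c <= q < c + s -> c <= t < c + s ->
  (q < t) = (cos (pi *+ 2 / s * ((c + s - q) / 2)) <
             cos (pi *+ 2 / s * t + - (pi *+ 2 / s * ((q + (c + s)) / 2)))).
Proof.
move=> s0 /andP[q1 q2] /andP[t1 t2].
set w := pi *+ 2 / s; have w0 : 0 < w by rewrite divr_gt0 // mulrn_wgt0 // pi_gt0.
have ws : w * s = pi *+ 2 by rewrite /w divfK // gt_eqF.
have pi0 : 0 < pi :> R by exact: pi_gt0.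
rewrite -mulrN -mulrDr; set r := (c + s - q) / 2; set m := (q + (c + s)) / 2.
have r0 : 0 < r by rewrite divr_gt0 // subr_gt0.
have wr : w * r <= pi.
  have : w * r <= w * (s / 2) by rewrite ler_pM2l // /r; lra.
  by rewrite mulrA ws mulr2n; lra.
have wr0 : 0 < w * r by rewrite mulr_gt0.
have wr_in : w * r \in `[0, pi] by rewrite in_itv /= wr ltW.
have [qt|tq] := ltP q t.
  have [mt|tm] := leP m t.
    have h1 : 0 <= w * (t - m) by apply: mulr_ge0; [exact: ltW|rewrite subr_ge0].
    have h2 : w * (t - m) < w * r by rewrite ltr_pM2l // /m /r; lra.
    rewrite ltr_cos // in_itv /= h1 /=; lra.
  rewrite -[X in _ < X]cosN -mulrN opprB.
  have h1 : 0 <= w * (m - t) by apply: mulr_ge0; [exact: ltW|rewrite subr_ge0 ltW].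
  have h2 : w * (m - t) < w * r by rewrite ltr_pM2l // /m /r; lra.
  rewrite ltr_cos // in_itv /= h1 /=; lra.
apply/esym/negbTE; rewrite -leNgt -[X in X <= _]cosN -mulrN opprB.
have h1 : w * r <= w * (m - t) by rewrite ler_pM2l // /m /r; lra.
have h2 : w * (m - t) <= pi *+ 2 - w * r.
  by rewrite -ws -mulrBr ler_pM2l // /m /r; lra.
rewrite leNgt; have [le|gt] := leP (w * (m - t)) pi.
  by rewrite ltr_cos ?in_itv /= -?leNgt //; lra.
have -> : cos (w * (m - t)) = cos (pi *+ 2 - w * (m - t)).
  by rewrite -[RHS]cosN opprB -[RHS]cosD2pi subrK.
by rewrite ltr_cos ?in_itv /= -?leNgt //; move: h2 gt; rewrite mulr2n => *; lra.
Qed.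

End arcs.

Section fundamental_lemma.
Context {R : realType} {d : nat} (Om : cube R d).

Local Notation D := (cube_set Om).
Local Notation mu := (lebesgue_row d).

Definition trig_limit (A : set 'rV[R]_d) := exists psi : nat -> 'rV[R]_d -> R,
  [/\ forall k, trig Om (psi k), forall k x, `|psi k x| <= 1 &
      forall x, psi k x @[k --> \oo] --> (\1_A x : R)].

Lemma trig_limitI : setI_closed trig_limit.
Proof.
move=> A B [f [tf bf lf]] [g [tg bg lg]]; exists (fun k x => f k x * g k x); split.
- by move=> k; exact: trigM.
- by move=> k x; rewrite normrM mulr_ile1.
- by move=> x; rewrite indicI; exact: (cvgM (lf x) (lg x)).
Qed.

Lemma trig_limit_setT : trig_limit setT.
Proof.
exists (fun _ => fun=> 1); split; [by move=> _; exact: trig_cst|by move=> *; rewrite normr1|].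
by move=> x; rewrite indicT; exact: cvg_cst.
Qed.

(** The argument of the logistic function is k^2 f - k: it tends to infinity where
    f > 0, and to minus infinity where f <= 0, also where f = 0. *)
Lemma trig_limit_pos f : trig Om f -> trig_limit [set x | 0 < f x].
Proof.
move=> tf; exists (fun k x => logistic (k%:R * k%:R * f x + - k%:R)); split.
- move=> k; apply: trig_logistic; apply: trigD; last exact: trig_cst.
  by apply: trigM => //; exact: trig_cst.
- by move=> k x; rewrite gtr0_norm ?logistic_gt0 // ltW // logistic_lt1.
move=> x; rewrite indicE; have [fx|fx] := ltP 0 (f x).
  rewrite mem_set //=.
  have cv : (1 - (k.+1%:R^-1 : R)) @[k --> \oo] --> (1 : R).
    by rewrite -[X in _ --> X]subr0; apply: cvgB; [exact: cvg_cst|exact: cvg_harmonic].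
  apply: (@squeeze_cvgr _ _ _ _ (fun k => 1 - (k.+1%:R^-1 : R)) (fun=> 1)); last 2 first.
  - exact: cv.
  - exact: cvg_cst.
  have [M Mx] : exists M : nat, 2 / f x <= M%:R.
    exists (Num.truncn (2 / f x)).+1; apply: ltW.
    by rewrite truncnS_gt.
  exists M => // k /= Mk; apply/andP; split; last exact: ltW (logistic_lt1 _).
  apply: logistic_large.
  have kf : 2 <= k%:R * f x.
    by rewrite -ler_pdivrMr //; apply: le_trans Mx _; rewrite ler_nat.
  have := ler_wpM2l (ler0n R k) kf; rewrite mulrA; lra.
rewrite memNset /=; last by apply/negP; rewrite -leNgt.
apply: (@squeeze_cvgr _ _ _ _ (fun=> 0) (fun k => (k.+1%:R^-1 : R))); last 2 first.
- exact: cvg_cst.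
- exact: cvg_harmonic.
apply: nearW => k; apply/andP; split; first exact: ltW (logistic_gt0 _).
apply: logistic_small.
have := mulr_ge0_le0 (mulr_ge0 (ler0n R k) (ler0n R k)) fx; lra.
Qed.

Lemma trig_limit_measurable A : trig_limit A -> measurable A.
Proof.
move=> [f [tf _ lf]]; have mA : measurable_fun setT (\1_A : _ -> R).
  apply/measurable_EFinP; apply: (emeasurable_fun_cvg (fun k => EFin \o f k)).
    move=> k; apply/measurable_EFinP; apply: continuous_measurable_row.
    exact: trig_continuous (tf k).
  by move=> x _; apply: cvg_EFin; [exact: nearW|exact: lf].
have := mA measurableT [set 1] (measurable_set1 1); rewrite setTI.
rewrite (_ : _ @^-1` _ = A) //; apply/seteqP; split => x /=; rewrite indicE.
  by case: (boolP (x \in A)) => [/set_mem //|_] /= /eqP; rewrite eq_sym oner_eq0.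
by move=> Ax; rewrite mem_set.
Qed.

Let half_open := [set x : 'rV[R]_d | forall i,
  corner Om ord0 i <= x ord0 i < corner Om ord0 i + side Om].

(** Modulo faces of the cube only: a periodic function cannot separate opposite
    faces, so the equality is on the half-open cube, a set of full measure. *)
Lemma trig_limit_generate A : measurable A ->
  exists2 A', <<s trig_limit >> A' & A `&` half_open = A' `&` half_open.
Proof.
move: A; pose M := [set A | exists2 A', <<s trig_limit >> A' &
  A `&` half_open = A' `&` half_open].
have sM : sigma_algebra setT M.
  have [s0 sC sU] := smallest_sigma_algebra setT trig_limit.
  split.
  - by exists set0.
  - move=> A [A' sA' AA']; exists (setT `\` A'); first exact: sC.
    have e B : (setT `\` B) `&` half_open = half_open `\` (B `&` half_open).
      by apply/seteqP; split => x /=; tauto.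
    by rewrite !e AA'.
  - move=> F MF.
    have /boolp.choice [F' F'P] : forall n, exists A', <<s trig_limit >> A' /\
        F n `&` half_open = A' `&` half_open.
      by move=> n; have [A' h1 h2] := MF n; exists A'.
    exists (\bigcup_n F' n); first by apply: sU => n; have [] := F'P n.
    by rewrite !setI_bigcupl; apply: eq_bigcupr => n _; have [] := F'P n.
suff : measurable `<=` M by [].
apply: smallest_sub => //; rewrite -bigcup_seq; apply: bigcup_sub => i _ _ [B mB <-].
rewrite setTI; move: B mB.
pose N := [set B : set R | M [set x | B (x ord0 i)]].
suff : @measurable _ (measurableTypeR R) `<=` N by [].
have sN : sigma_algebra setT N.
  have [s0 sC sU] := sM; split.
  - exact: s0.
  - by move=> B /sC h; exact: h.
  - by move=> F NF; have := sU (fun n => [set x | F n (x ord0 i)]) NF.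
have -> : @measurable _ (measurableTypeR R) = <<s @RGenOInfty.G R >>.
  exact: (RGenOInfty.measurableE R).
apply: smallest_sub => // _ [q ->].
rewrite /N /M /=; have [qc|qc] := ltP q (corner Om ord0 i).
  exists setT; first by have [s0 sC _] := smallest_sigma_algebra setT trig_limit;
    have := sC _ s0; rewrite setD0.
  rewrite setTI; apply: setIidr => x /(_ i) /andP[xi _] /=.
  by rewrite in_itv /= andbT; exact: lt_le_trans xi.
have [qs|qs] := ltP q (corner Om ord0 i + side Om); last first.
  exists set0; first by have [] := smallest_sigma_algebra setT trig_limit.
  rewrite set0I -subset0 => x [] /=; rewrite in_itv /= andbT => qx /(_ i) /andP[_ xi].
  by move: (lt_trans qx xi); rewrite ltNge qs.
pose f (x : 'rV[R]_d) := cos (pi *+ 2 / side Om * x ord0 i + - (pi *+ 2 / side Om * ((q + (corner Om ord0 i + side Om)) / 2)))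
   + - cos (pi *+ 2 / side Om * ((corner Om ord0 i + side Om - q) / 2)).
exists [set x | 0 < f x].
  apply: sub_sigma_algebra; apply: trig_limit_pos.
  by apply: trigD; [exact: trig_cos|exact: trig_cst].
have key x : half_open x -> (q < x ord0 i) = (0 < f x).
  move=> /(_ i) xi; rewrite /f subr_gt0; apply: arc_ray => //; first exact: side_gt0.
  by rewrite qc qs.
apply/seteqP; split => x [] /=; rewrite ?in_itv /= ?andbT => h xh; split => //.
  by rewrite -key.
by rewrite key.
Qed.

(** The sets over which g integrates to 0 form a Dynkin system, which contains the
    limit sets by dominated convergence; these are stable under intersection and
    generate the measurable sets of the half-open cube. *)
Lemma fundamental_lemma (g : 'rV[R]_d -> R) : mu.-integrable D (EFin \o g) ->
  (forall psi, trig Om psi -> intO Om (fun x => g x * psi x) = 0) ->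
  ae_eq mu D (EFin \o g) (cst 0%E).
Proof.
move=> ig orth; have mD := measurable_cube Om.
pose G x := ((EFin \o g) \_ D) x.
have iG : mu.-integrable setT G by apply/(integrable_mkcond _ mD).
have mG : measurable_fun setT G by exact: measurable_int iG.
have Gfin x : G x \is a fin_num by rewrite /G patchE; case: ifP.
have orthG psi : trig Om psi -> (\int[mu]_x (G x * (psi x)%:E) = 0)%E.
  move=> tpsi; have [C _ bC] := continuous_bounded_box (corner Om) (side Om) (trig_continuous tpsi).
  have mpsi := continuous_measurable_row (trig_continuous tpsi).
  have igp : mu.-integrable D (fun x => (g x * psi x)%:E).
    have := @integrableMl _ _ _ mu D mD _ psi ig (measurable_funTS mpsi) (bounded_on bC).
    by apply: eq_integrable.
  have e := congr1 EFin (orth psi tpsi); rewrite /intO /Rintegral in e.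
  rewrite fineK in e; last exact: integrable_fin_num.
  apply: (etrans _ e); rewrite [RHS]integral_mkcond; apply: eq_integral => x _.
  by rewrite /G !patchE; case: ifP => //; rewrite mul0e.
have intA A : trig_limit A -> (\int[mu]_(x in A) G x = 0)%E.
  move=> lA; have mA := trig_limit_measurable lA; have [f [tf bf lf]] := lA.
  have mf k : measurable_fun setT (f k) := continuous_measurable_row (trig_continuous (tf k)).
  have := @dominated_cvg _ _ _ mu setT measurableT (fun k x => G x * (f k x)%:E)%E
     (fun x => G x * (\1_A x)%:E)%E (abse \o G).
  move=> H; rewrite integral_mkcond.
  rewrite (eq_integral (fun x => G x * (\1_A x)%:E)%E); last first.
    by move=> x _; rewrite patchE indicE; case: ifP; rewrite ?mule1 ?mule0.
  have cvG : (\int[mu]_x (G x * (f k x)%:E))%E @[k --> \oo] --> (\int[mu]_x (G x * (\1_A x)%:E))%E.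
    apply: H => //.
    - by move=> k; apply: emeasurable_funM => //; exact/measurable_EFinP.
    - move=> x _; apply: cvgeMl; first exact: Gfin.
      by apply: cvg_EFin; [exact: nearW|exact: lf].
    - by move=> x _; rewrite abse_fin_num.
    - exact: integrable_abse.
    - by move=> k x _; rewrite abseM /= -[leRHS]mule1 lee_pmul // lee_fin.
  have c0 : (\int[mu]_x (G x * (f k x)%:E))%E @[k --> \oo] --> 0%E.
    rewrite (_ : (fun k => _) = cst 0%E); first exact: cvg_cst.
    by apply/funext => k; exact: orthG.
  exact: (cvg_unique (@ereal_hausdorff R) cvG c0).
pose L A := measurable A /\ (\int[mu]_(x in A) G x = 0)%E.
have dynL : dynkin L.
  split.
  - by split => //; exact/intA/trig_limit_setT.
  - move=> A [mA A0]; have mAC : measurable (~` A) by exact: measurableC.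
    split => //; have := intA _ trig_limit_setT.
    rewrite -(setUv A) integral_setU // ?setUv //; last exact/disj_setPCl.
    by rewrite A0 add0e.
  - move=> F tF LF; have mF n : measurable (F n) by have [] := LF n.
    have mU : measurable (\bigcup_k F k) by exact: bigcup_measurable.
    split => //; rewrite integral_bigcup //; last exact: integrableS iG.
    by apply: eseries0 => n _ _; have [] := LF n.
have sL : <<s trig_limit >> `<=` L.
  rewrite -(setI_closed_g_dynkin_g_sigma_algebra trig_limitI).
  by apply: smallest_sub => // A lA; split; [exact: trig_limit_measurable|exact: intA].
have null : mu.-negligible (D `\` half_open).
  pose E := \big[setU/set0]_(i < d) [set x : 'rV[R]_d | x ord0 i = corner Om ord0 i + side Om].
  apply: (@negligibleS _ _ _ mu E); last first.
    rewrite /E; elim/big_ind: _ => [|A B A0 B0|i _]; [exact: negligible_set0|exact: negligibleU|].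
    eexists; split; [|exact: (@lebesgue_row_hyperplane R d i (corner Om ord0 i + side Om))|by []].
    exact: (@measurable_coord_preimage R d i [set _]).
  move=> x [Dx hx]; rewrite /E -bigcup_seq /=.
  apply: contrapT => nE; apply: hx => i; have /andP[-> xi] := Dx i.
  rewrite /= lt_neqAle xi andbT; apply/eqP => e; apply: nE.
  by exists i => //=; rewrite mem_index_enum.
have all0 A : measurable A -> (\int[mu]_(x in A) G x = 0)%E.
  move=> mA; have [A' /sL[mA' A'0] AA'] := trig_limit_generate mA.
  rewrite -A'0 integral_mkcond [RHS]integral_mkcond; apply: ae_eq_integral => //.
  - exact/(measurable_restrictT _ mA)/measurable_funTS.
  - exact/(measurable_restrictT _ mA')/measurable_funTS.
  apply: negligibleS null => x /=; rewrite /G !patchE => h.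
  have [Dx|nDx] := boolP (x \in D); last first.
    by exfalso; apply: h => _; rewrite (negbTE nDx); do 2 case: ifP.
  split; first exact: set_mem; move=> hx; apply: h => _.
  suff -> : (x \in A) = (x \in A') by [].
  apply/idP/idP => /set_mem Ax; apply: mem_set.
    by have [] : (A' `&` half_open) x by rewrite -AA'.
  by have [] : (A `&` half_open) x by rewrite AA'.
apply: (@integral_ae_eq _ _ _ mu D mD) => //.
move=> E ED mE; rewrite [RHS]integral0 -(all0 E mE); apply: eq_integral => x /set_mem Ex.
by rewrite /G patchE mem_set //; exact: ED.
Qed.

End fundamental_lemma.

(** * Integration over the cube *)

Section cube_calculus.
Context {R : realType} {d : nat} (Om : cube R d).

Local Notation D := (cube_set Om).
Local Notation mu := (lebesgue_row d).
Local Notation fn := ('rV[R]_d -> R).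
Local Notation I := (intO Om).
Implicit Types (f g h u v w : fn) (a c : R).

(** Working classes for functions on the cube: products of a bounded and a square
    integrable function are square integrable, products of two square integrable
    ones integrable. *)
Definition meas f := measurable_fun setT f.
Definition integ f := mu.-integrable D (EFin \o f).
Definition sq f := meas f /\ integ (fun x => f x ^+ 2).
Definition bdd f := meas f /\ exists C : R, forall x, D x -> `|f x| <= C.
Definition aeq f g := mu.-negligible [set x | D x /\ f x <> g x].

Let mD : measurable D := measurable_cube Om.

Lemma aeq_refl f : aeq f f.
Proof. by apply: negligibleS (@negligible_set0 _ _ _ mu) => x []. Qed.

Lemma aeq_eq f g : (forall x, D x -> f x = g x) -> aeq f g.
Proof. by move=> fg; apply: negligibleS (@negligible_set0 _ _ _ mu) => x [/fg]. Qed.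

Lemma aeq_sym f g : aeq f g -> aeq g f.
Proof. by apply: negligibleS => x /= [Dx h]; split => // e; apply: h. Qed.

Lemma aeq_trans f g h : aeq f g -> aeq g h -> aeq f h.
Proof.
move=> fg gh; apply: negligibleS (negligibleU fg gh) => x /= [Dx fh].
by have [e|ne] := pselect (f x = g x); [right; split => // e'; apply: fh; rewrite e|left].
Qed.

Lemma aeq_op2 (op : R -> R -> R) f f' g g' : aeq f f' -> aeq g g' ->
  aeq (fun x => op (f x) (g x)) (fun x => op (f' x) (g' x)).
Proof.
move=> ff gg; apply: negligibleS (negligibleU ff gg) => x /= [Dx ne].
have [e|?] := pselect (f x = f' x); last by left.
by right; split => // e'; apply: ne; rewrite e e'.
Qed.

Lemma intO_aeq f g : meas f -> meas g -> aeq f g -> I f = I g.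
Proof.
move=> mf mg fg; rewrite /intO /Rintegral; congr fine; apply: ae_eq_integral => //.
- exact/measurable_EFinP/measurable_funTS.
- exact/measurable_EFinP/measurable_funTS.
apply: negligibleS fg => x /= h; have Dx : D x by apply: contrapT => nD; apply: h => /nD.
by split => // e; apply: h => _; rewrite e.
Qed.

Lemma meas_cst c : meas (fun=> c).
Proof. exact: measurable_cst. Qed.

Lemma measD f g : meas f -> meas g -> meas (fun x => f x + g x).
Proof. by move=> mf mg; exact: measurable_funD. Qed.

Lemma measM f g : meas f -> meas g -> meas (fun x => f x * g x).
Proof. by move=> mf mg; exact: measurable_funM. Qed.

Lemma meas_lin a f g : meas f -> meas g -> meas (a *: f + g).
Proof. by move=> mf mg; apply: measD => //; apply: measM => //; exact: meas_cst. Qed.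

Lemma meas_comp (g : R -> R) f : continuous g -> meas f -> meas (fun x => g (f x)).
Proof.
move=> cg mf; apply: (@measurableT_comp _ _ _ _ _ _ g) => //.
exact: continuous_measurable_fun.
Qed.

Lemma integ0 : integ (fun=> 0).
Proof. exact: integrable0. Qed.

Lemma integD f g : integ f -> integ g -> integ (fun x => f x + g x).
Proof.
by move=> jf jg; have := integrableD mD jf jg; apply: eq_integrable.
Qed.

Lemma integZ a f : integ f -> integ (fun x => a * f x).
Proof.
by move=> jf; have := integrableZl mD a jf; apply: eq_integrable.
Qed.

Lemma integ_sum (J : Type) (r : seq J) (F : J -> fn) : (forall j, integ (F j)) ->
  integ (fun x => \sum_(j <- r) F j x).
Proof.
move=> jF; elim: r => [|j r IH].
  by apply: eq_integrable integ0 => // x _ /=; rewrite big_nil.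
by apply: eq_integrable (integD (jF j) IH) => // x _ /=; rewrite big_cons.
Qed.

Lemma integ_le f g : meas f -> integ g -> (forall x, D x -> `|f x| <= g x) -> integ f.
Proof.
move=> mf jg fg; apply: le_integrable jg => //.
  exact/measurable_EFinP/measurable_funTS.
by move=> x Dx /=; rewrite lee_fin; apply: le_trans (fg x Dx) (ler_norm _).
Qed.

Lemma intOD f g : integ f -> integ g -> I (fun x => f x + g x) = I f + I g.
Proof. exact: RintegralD. Qed.

Lemma intOB f g : integ f -> integ g -> I (fun x => f x - g x) = I f - I g.
Proof. exact: RintegralB. Qed.

Lemma intOZ a f : integ f -> I (fun x => a * f x) = a * I f.
Proof. exact: RintegralZl. Qed.

Lemma intO_eq f g : (forall x, D x -> f x = g x) -> I f = I g.
Proof. by move=> fg; apply: eq_Rintegral => x /set_mem; exact: fg. Qed.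

Lemma intO0 : I (fun=> 0) = 0.
Proof. by rewrite /intO Rintegral_cst // mul0r. Qed.

Lemma intO_sum (J : Type) (r : seq J) (F : J -> fn) : (forall j, integ (F j)) ->
  I (fun x => \sum_(j <- r) F j x) = \sum_(j <- r) I (F j).
Proof.
move=> jF; elim: r => [|j r IH].
  rewrite big_nil -[RHS]intO0; apply: intO_eq => x _; exact: big_nil.
rewrite big_cons -IH -intOD //; last exact: integ_sum.
by apply: intO_eq => x _; rewrite big_cons.
Qed.

Lemma intO_ge0 f : (forall x, D x -> 0 <= f x) -> 0 <= I f.
Proof. exact: Rintegral_ge0. Qed.

Lemma intO_le f g : integ f -> integ g -> (forall x, D x -> f x <= g x) -> I f <= I g.
Proof. exact: le_Rintegral. Qed.

Lemma intO_norm f : integ f -> `|I f| <= I (fun x => `|f x|).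
Proof. exact: le_normr_Rintegral. Qed.

Lemma integ_norm f : integ f -> integ (fun x => `|f x|).
Proof. exact: integrable_norm. Qed.

Lemma bdd_meas f : bdd f -> meas f. Proof. by case. Qed.
Lemma sq_meas f : sq f -> meas f. Proof. by case. Qed.

Lemma bdd_integ f : bdd f -> integ f.
Proof.
move=> [mf [C bC]]; apply: bounded_integrable bC => //; first exact: cube_finite.
exact: measurable_funTS.
Qed.

Lemma bdd_cst c : bdd (fun=> c).
Proof. by split; [exact: meas_cst|exists `|c|]. Qed.

Lemma bddD f g : bdd f -> bdd g -> bdd (fun x => f x + g x).
Proof.
move=> [mf [C bC]] [mg [C' bC']]; split; first exact: measD.
by exists (C + C') => x Dx; apply: le_trans (ler_normD _ _) _; rewrite lerD ?bC ?bC'.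
Qed.

Lemma bddM f g : bdd f -> bdd g -> bdd (fun x => f x * g x).
Proof.
move=> [mf [C bC]] [mg [C' bC']]; split; first exact: measM.
by exists (C * C') => x Dx; rewrite normrM ler_pM ?bC ?bC'.
Qed.

Lemma bddZ a f : bdd f -> bdd (fun x => a * f x).
Proof. exact/bddM/bdd_cst. Qed.

Lemma bdd_sum (J : Type) (r : seq J) (F : J -> fn) : (forall j, bdd (F j)) ->
  bdd (fun x => \sum_(j <- r) F j x).
Proof.
move=> bF; elim: r => [|j r IH].
  rewrite (_ : (fun x => _) = fun=> 0); first exact: bdd_cst.
  by apply/funext => x; rewrite big_nil.
rewrite (_ : (fun x => _) = fun x => F j x + \sum_(j <- r) F j x); first exact: bddD.
by apply/funext => x; rewrite big_cons.
Qed.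

Lemma bdd_comp (g : R -> R) f : continuous g -> bdd f -> bdd (fun x => g (f x)).
Proof.
move=> cg [mf [C bC]]; split; first exact: meas_comp.
have := continuous_compact (@continuous_subspaceT _ _ `[- C, C]%classic g cg) (@segment_compact R (- C) C).
move=> /compact_bounded[M [_ Mb]]; exists (Num.max M 0 + 1) => x Dx.
apply: Mb; first by rewrite (@le_lt_trans _ _ (Num.max M 0)) ?ltrDl // le_max lexx.
by exists (f x) => //=; rewrite in_itv /= -ler_norml; exact: bC.
Qed.

Lemma integ_bddM f g : bdd f -> integ g -> meas g -> integ (fun x => f x * g x).
Proof.
move=> [mf [C bC]] jg mg; apply: (@integ_le _ (fun x => C * `|g x|)); first exact: measM.
  by apply: integZ; exact: integ_norm.
by move=> x Dx; rewrite normrM ler_wpM2r // bC.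
Qed.

Lemma sqM f g : sq f -> sq g -> integ (fun x => f x * g x).
Proof.
move=> [mf jf] [mg jg]; apply: (@integ_le _ (fun x => f x ^+ 2 + g x ^+ 2)).
- exact: measM.
- exact: integD.
move=> x _; rewrite normrM -(real_normK (num_real (f x))) -(real_normK (num_real (g x))).
by have := sqr_ge0 (`|f x| - `|g x|); have := sqr_ge0 (`|f x| + `|g x|); nra.
Qed.

Lemma sq_lin a f g : sq f -> sq g -> sq (a *: f + g).
Proof.
move=> sf sg; split; first by apply: meas_lin; apply: sq_meas.
have fg := sqM sf sg; have [_ jf] := sf; have [_ jg] := sg.
apply: eq_integrable (integD (integZ (a ^+ 2) jf) (integD (integZ (2 * a) fg) jg)) => // x _ /=.
congr EFin; transitivity ((a * f x + g x) ^+ 2); [ring|by []].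
Qed.

Lemma sq_bddM f g : bdd f -> sq g -> sq (fun x => f x * g x).
Proof.
move=> bf [mg jg]; split; first by apply: measM => //; exact: bdd_meas.
have := integ_bddM (bddM bf bf) jg (measM mg mg).
by apply: eq_integrable => // x _ /=; congr EFin; ring.
Qed.

Lemma bdd_sq f : bdd f -> sq f.
Proof.
move=> bf; split; first exact: bdd_meas.
by apply: eq_integrable (bdd_integ (bddM bf bf)) => // x _ /=; rewrite expr2.
Qed.

Lemma sq_integ f : sq f -> integ f.
Proof.
move=> sf; have := sqM sf (bdd_sq (bdd_cst 1)).
by apply: eq_integrable => // x _ /=; rewrite mulr1.
Qed.

Lemma sqZ a f : sq f -> sq (fun x => a * f x).
Proof. exact/sq_bddM/bdd_cst. Qed.

Lemma intO_sq0 f : sq f -> I (fun x => f x ^+ 2) = 0 -> aeq f (fun=> 0).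
Proof.
move=> [mf jf] h0; have e := congr1 EFin h0; rewrite /intO /Rintegral in e.
rewrite fineK in e; last exact: integrable_fin_num.
have mf2 : measurable_fun D (fun x => (f x ^+ 2)%:E) by exact: measurable_int jf.
have [h _] := ae_eq_integral_abs mu mD mf2.
have [|N [mN N0 sN]] := h.
  by apply: (etrans _ e); apply: eq_integral => x _; rewrite gee0_abs // lee_fin sqr_ge0.
exists N; split => //; apply: subset_trans sN => x /= [Dx fx] hx; apply: fx.
by have /eqP := hx Dx; rewrite eqe sqrf_eq0 => /eqP.
Qed.

Lemma aeq0_integ f g : meas f -> meas g -> aeq f (fun=> 0) -> I (fun x => f x * g x) = 0.
Proof.
move=> mf mg f0; rewrite -[RHS]intO0; apply: intO_aeq; [exact: measM|exact: meas_cst|].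
apply: negligibleS f0 => x [Dx h]; split => // e; apply: h; by rewrite e mul0r.
Qed.

End cube_calculus.

(** * Weak derivatives *)

Section weak_derivatives.
Context {R : realType} {d : nat} (Om : cube R d).

Local Notation D := (cube_set Om).
Local Notation mu := (lebesgue_row d).
Local Notation fn := ('rV[R]_d -> R).
Local Notation I := (intO Om).
Local Notation sq := (sq Om).
Local Notation bdd := (bdd Om).
Local Notation integ := (integ Om).
Local Notation aeq := (aeq Om).
Implicit Types (f g h v w psi : fn) (a c : R) (i : 'I_d).

Lemma L2_sq f : L2 Om f -> sq f. Proof. by case. Qed.

Lemma L2_lin a f g : L2 Om f -> L2 Om g -> L2 Om (a *: f + g).
Proof.
move=> Lf Lg; have [mf jf] := sq_lin a (L2_sq Lf) (L2_sq Lg); split => //.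
have [pf _ _] := Lf; have [pg _ _] := Lg => x i.
change (a * f (x + side Om *: dir i) + g (x + side Om *: dir i) = a * f x + g x).
by rewrite pf pg.
Qed.

Lemma L2_cst c : L2 Om (fun=> c).
Proof. by have [] := bdd_sq (bdd_cst Om c); split. Qed.

Lemma continuous_bdd f : continuous f -> bdd f.
Proof.
move=> cf; split; first exact: continuous_measurable_row.
by have [C _ bC] := continuous_bounded_box (corner Om) (side Om) cf; exists C.
Qed.

Lemma smooth_bdd psi : smooth psi -> bdd psi.
Proof. by move=> /(_ [::])[/continuous_bdd]. Qed.

Lemma smooth_deriv_bdd psi i : smooth psi -> bdd ('D_(dir i) psi).
Proof. by move=> /(_ [:: i])[/continuous_bdd]. Qed.

Lemma intO_deriv_periodic psi i : Defs.periodic Om psi -> smooth psi ->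
  I ('D_(dir i) psi) = 0.
Proof.
move=> pp sp; have [_ dp] := sp [::]; have [cD _] := sp [:: i].
have dd x : is_derive x (dir i) psi ('D_(dir i) psi x) by apply: derivableP; exact: dp.
have := integral_deriv_periodic (corner Om) (side_gt0 Om) dd cD (fun x => pp x i).
by rewrite /intO /Rintegral => e; have /= := congr1 fine e.
Qed.

(** This makes the chosen representative [wderiv] linear up to null sets, although
    the choice itself is not linear. *)
Lemma is_weak_deriv_unique i v g g' :
  is_weak_deriv Om i v g -> is_weak_deriv Om i v g' -> aeq g g'.
Proof.
move=> [Lg wg] [Lg' wg']; have sg := L2_sq Lg; have sg' := L2_sq Lg'.
have sh := sq_lin (-1) sg' sg.
have [|N [mN N0 sN]] := fundamental_lemma (sq_integ sh).
  move=> psi tpsi; have sp := trig_smooth tpsi; have bp := smooth_bdd sp.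
  have pp := trig_periodic tpsi.
  rewrite (@intO_eq _ _ Om _ (fun x => g x * psi x - g' x * psi x)).
    rewrite intOB; [|exact: sqM (bdd_sq bp)|exact: sqM (bdd_sq bp)].
    by rewrite -[X in X - _]opprK -[X in _ - X]opprK -wg // -wg' // subrr.
  move=> x _; transitivity ((-1 * g' x + g x) * psi x); [by []|ring].
exists N; split => //; apply: subset_trans sN => x /= [Dx ne] h; apply: ne.
have := h Dx => -[] /eqP e; apply/esym/eqP.
by rewrite -subr_eq0 -oppr_eq0 opprB -mulN1r addrC.
Qed.

Lemma is_weak_deriv_lin i a v w g h : sq v -> sq w ->
  is_weak_deriv Om i v g -> is_weak_deriv Om i w h ->
  is_weak_deriv Om i (a *: v + w) (a *: g + h).
Proof.
move=> sv sw [Lg wg] [Lh wh]; split; first exact: L2_lin.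
move=> psi pp sp; have bp := bdd_sq (smooth_bdd sp).
have bd := bdd_sq (smooth_deriv_bdd i sp).
have lin f f' k : sq f -> sq f' -> sq k ->
    I (fun x => (a *: f + f') x * k x) = a * I (fun x => f x * k x) + I (fun x => f' x * k x).
  move=> sf sf' sk; have i1 := sqM sf sk; have i2 := sqM sf' sk.
  rewrite -(intOZ a i1) -(intOD (integZ a i1) i2).
  apply: intO_eq => x _; transitivity ((a * f x + f' x) * k x); [by []|ring].
rewrite !lin ?wg ?wh //; [ring|exact: L2_sq..].
Qed.

Lemma is_weak_deriv_cst i c : is_weak_deriv Om i (fun=> c) (fun=> 0).
Proof.
split; first exact: L2_cst.
move=> psi pp sp; have bd := smooth_deriv_bdd i sp.
rewrite intOZ; last exact: bdd_integ.
rewrite intO_deriv_periodic // mulr0 -[LHS]oppr0; congr (- _).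
by rewrite -[LHS](@intO0 _ _ Om); apply: intO_eq => x _; rewrite mul0r.
Qed.

Lemma H1_sq v : H1 Om v -> sq v. Proof. by case=> /L2_sq. Qed.

Lemma wderivP i v : H1 Om v -> is_weak_deriv Om i v (wderiv Om i v).
Proof. by move=> [_ /(_ i)[g wg]]; exact: (@xgetPex _ (fun=> 0) _ (ex_intro _ g wg)). Qed.

Lemma wderiv_sq i v : H1 Om v -> sq (wderiv Om i v).
Proof. by move=> /(wderivP i)[/L2_sq]. Qed.

Lemma H1_cst c : H1 Om (fun=> c).
Proof. by split; [exact: L2_cst|move=> i; exists (fun=> 0); exact: is_weak_deriv_cst]. Qed.

Lemma H1_submodule : submodule (H1 Om).
Proof.
split; first exact: (H1_cst 0).
move=> a v w Hv Hw; split; first by apply: L2_lin; [exact: Hv.1|exact: Hw.1].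
move=> i; exists (a *: wderiv Om i v + wderiv Om i w).
by apply: is_weak_deriv_lin; [exact: H1_sq|exact: H1_sq|exact: wderivP..].
Qed.

Lemma wderiv_lin i a v w : H1 Om v -> H1 Om w ->
  aeq (wderiv Om i (a *: v + w)) (a *: wderiv Om i v + wderiv Om i w).
Proof.
move=> Hv Hw; have Hvw : H1 Om (a *: v + w) by apply H1_submodule.2.
apply: (is_weak_deriv_unique (wderivP i Hvw)).
by apply: is_weak_deriv_lin; [exact: H1_sq|exact: H1_sq|exact: wderivP..].
Qed.

Lemma wderiv_cst i c : aeq (wderiv Om i (fun=> c)) (fun=> 0).
Proof. exact: (is_weak_deriv_unique (wderivP i (H1_cst c)) (is_weak_deriv_cst i c)). Qed.

(** An equality, not only almost everywhere: functions equal almost everywhere have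
    the same weak derivatives, hence the same choice among them. *)
Lemma wderiv_aeq i v w : meas v -> meas w -> aeq v w -> wderiv Om i v = wderiv Om i w.
Proof.
move=> mv mw vw; rewrite /wderiv; congr (xget _ _); apply/seteqP.
have key v' w' g : meas v' -> meas w' -> aeq v' w' ->
    is_weak_deriv Om i v' g -> is_weak_deriv Om i w' g.
  move=> mv' mw' vw' [Lg wg]; split => // psi pp sp; rewrite -wg //.
  have bd := bdd_meas (smooth_deriv_bdd i sp).
  apply: intO_aeq; [exact: measM|exact: measM|].
  by apply: (aeq_op2 *%R); [exact: aeq_sym|exact: aeq_refl].
by split => g; apply: key => //; exact: aeq_sym.
Qed.

Lemma wderiv_null i v : H1 Om v -> aeq v (fun=> 0) -> aeq (wderiv Om i v) (fun=> 0).
Proof.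
move=> Hv v0; rewrite (wderiv_aeq i (sq_meas (H1_sq Hv)) (meas_cst 0) v0).
exact: wderiv_cst.
Qed.

Lemma sq_pair_lin_r a f g h : sq h -> sq f -> sq g ->
  I (fun x => h x * (a *: f + g) x) = a * I (fun x => h x * f x) + I (fun x => h x * g x).
Proof.
move=> sh sf sg; have i1 := sqM sh sf; have i2 := sqM sh sg.
rewrite -(intOZ a i1) -(intOD (integZ a i1) i2).
by apply: intO_eq => x _; transitivity (h x * (a * f x + g x)); [|ring].
Qed.

Lemma sq_pairC f g : I (fun x => f x * g x) = I (fun x => g x * f x).
Proof. by apply: intO_eq => x _; rewrite mulrC. Qed.

Lemma sq_pair_lin_l a f g h : sq h -> sq f -> sq g ->
  I (fun x => (a *: f + g) x * h x) = a * I (fun x => f x * h x) + I (fun x => g x * h x).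
Proof. by move=> sh sf sg; rewrite (sq_pairC (a *: f + g) h) sq_pair_lin_r // (sq_pairC h f) (sq_pairC h g). Qed.

(** Every form of the scheme is a finite sum of such pairings, so that linearity and
    vanishing on null derivatives are proved once. *)
Definition wpair i h v := I (fun x => h x * wderiv Om i v x).

Lemma wpair_lin_r i h : sq h -> linear_on (H1 Om) (wpair i h).
Proof.
move=> sh a v w Hv Hw; rewrite /wpair.
have Hvw : H1 Om (a *: v + w) by apply H1_submodule.2.
rewrite -sq_pair_lin_r //; [|exact: wderiv_sq..].
apply: intO_aeq.
- by apply: measM; [exact: sq_meas sh|exact: sq_meas (wderiv_sq i Hvw)].
- apply: measM; first exact: sq_meas sh.
  by apply: sq_meas; apply: sq_lin; exact: wderiv_sq.
by apply: (aeq_op2 *%R); [exact: aeq_refl|exact: wderiv_lin].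
Qed.

Lemma wpair_lin_l i v : H1 Om v -> linear_on sq (wpair i ^~ v).
Proof. by move=> Hv a f g sf sg; apply: sq_pair_lin_l => //; exact: wderiv_sq. Qed.

Lemma wpair_null i h v : sq h -> H1 Om v -> aeq (wderiv Om i v) (fun=> 0) -> wpair i h v = 0.
Proof.
move=> sh Hv v0; rewrite /wpair sq_pairC; apply: aeq0_integ v0.
  exact: sq_meas (wderiv_sq i Hv).
exact: sq_meas sh.
Qed.

Lemma wpair_cst i h c : sq h -> wpair i h (fun=> c) = 0.
Proof. by move=> sh; apply: wpair_null => //; [exact: H1_cst|exact: wderiv_cst]. Qed.

(** The Dirichlet form with weight h. *)
Definition gradform h v w := \sum_i wpair i (fun x => h x * wderiv Om i v x) w.

Lemma gradformE h v w :
  gradform h v w = \sum_i I (fun x => h x * wderiv Om i v x * wderiv Om i w x).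
Proof. by []. Qed.

Lemma linear_on_bigsum (W : lmodType R) (S : W -> Prop) (J : Type) (r : seq J)
    (l : J -> W -> R) : (forall j, linear_on S (l j)) ->
  linear_on S (fun x => \sum_(j <- r) l j x).
Proof.
move=> ll a x y Sx Sy; rewrite mulr_sumr -big_split /=.
by apply: eq_bigr => j _; exact: ll.
Qed.

Lemma gradform_lin_r h v : bdd h -> H1 Om v -> linear_on (H1 Om) (gradform h v).
Proof.
move=> bh Hv; apply: linear_on_bigsum => i; apply: wpair_lin_r.
exact: sq_bddM (wderiv_sq i Hv).
Qed.

Lemma gradformC h v w : gradform h v w = gradform h w v.
Proof. by apply: eq_bigr => i _; apply: intO_eq => x _; rewrite mulrAC. Qed.

Lemma gradform_lin_l h v : bdd h -> H1 Om v -> linear_on (H1 Om) (gradform h ^~ v).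
Proof.
by move=> bh Hv a x y Hx Hy; rewrite ![gradform h _ v]gradformC gradform_lin_r.
Qed.

Lemma gradform_le h v c : bdd h -> H1 Om v -> (forall x, D x -> c <= h x) ->
  c * gradform (fun=> 1) v v <= gradform h v v.
Proof.
move=> bh Hv ch; rewrite mulr_sumr; apply: ler_sum => i _.
have sv := wderiv_sq i Hv; have s1 := sq_bddM (bdd_cst Om 1) sv; have s2 := sq_bddM bh sv.
rewrite -intOZ; last exact: sqM.
apply: intO_le; [by apply: integZ; exact: sqM|exact: sqM|].
move=> x Dx; rewrite mul1r -!mulrA ler_wpM2r ?ch //.
by rewrite -expr2 sqr_ge0.
Qed.

Lemma gradform_ge0 h v : (forall x, D x -> 0 <= h x) -> 0 <= gradform h v v.
Proof.
move=> h0; apply: sumr_ge0 => i _; apply: intO_ge0 => x Dx.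
by rewrite -mulrA mulr_ge0 ?h0 // -expr2 sqr_ge0.
Qed.

Lemma gradform_null v : H1 Om v -> gradform (fun=> 1) v v = 0 ->
  forall i, aeq (wderiv Om i v) (fun=> 0).
Proof.
move=> Hv; rewrite gradformE => /eqP; rewrite psumr_eq0 => [/allP e i|i _]; last first.
  by apply: intO_ge0 => x _; rewrite mul1r -expr2 sqr_ge0.
have /eqP e1 := e i (mem_index_enum i); apply: intO_sq0; first exact: wderiv_sq.
by rewrite -[RHS]e1; apply: intO_eq => x _; rewrite mul1r expr2.
Qed.

Lemma gradform_null_r h v w : bdd h -> H1 Om v -> H1 Om w ->
  (forall i, aeq (wderiv Om i w) (fun=> 0)) -> gradform h v w = 0.
Proof.
move=> bh Hv Hw w0; rewrite /gradform big1 // => i _; apply: wpair_null => //.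
exact: sq_bddM (wderiv_sq i Hv).
Qed.

End weak_derivatives.

(** * Integrals depending on a parameter *)

Section C1.
Context {R : realType}.

Definition C1 (g : R -> R) := (forall s, derivable g s 1) /\ continuous (derive1 g).

Lemma C1_is_derive g (s : R) : C1 g -> is_derive s (1 : R) g (derive1 g s).
Proof. by move=> [dg _]; rewrite derive1E; apply: derivableP; exact: dg. Qed.

Lemma C1_continuous g : C1 g -> continuous g.
Proof.
by move=> [dg _] s; apply: differentiable_continuous; apply/derivable1_diffP; exact: dg.
Qed.

Lemma continuous_bounded_segment (g : R -> R) (a b : R) : continuous g ->
  exists2 M : R, 0 <= M & forall s, a <= s <= b -> `|g s| <= M.
Proof.
move=> cg; have := continuous_compact (@continuous_subspaceT _ _ `[a, b]%classic g cg) (@segment_compact R a b).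
move=> /compact_bounded[M [_ Mb]]; exists (Num.max M 0 + 1).
  by rewrite addr_ge0 // le_max lexx orbT.
move=> s sab; apply: Mb; first by rewrite (@le_lt_trans _ _ (Num.max M 0)) ?ltrDl // le_max lexx.
by exists s => //=; rewrite in_itv.
Qed.

Lemma C1_lipschitz g C : C1 g -> exists2 K : R, 0 <= K &
  forall s t, `|s| <= C -> `|t| <= C -> `|g s - g t| <= K * `|s - t|.
Proof.
move=> C1g; have [K K0 bK] := continuous_bounded_segment (- C) C C1g.2.
exists K => // s t; wlog ts : s t / t <= s => [H|].
  move=> sC tC; have [st|ts] := leP s t; last by apply: H => //; exact: ltW.
  by rewrite distrC (distrC s); exact: H.
move=> sC tC; have /andP[s1 s2] : - C <= s <= C by rewrite -ler_norml.
have /andP[t1 t2] : - C <= t <= C by rewrite -ler_norml.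
have [||c] := @MVT_segment R g (derive1 g) t s ts.
- by move=> x _; exact: C1_is_derive.
- by apply: continuous_subspaceT; exact: C1_continuous.
rewrite in_itv /= => /andP[c1 c2] ->; rewrite normrM ler_wpM2r // bK //.
by rewrite (le_trans t1 c1) (le_trans c2 s2).
Qed.

Lemma classCk_C1 k (g : R -> R) : classCk k.+1 g -> C1 g.
Proof.
move=> [dg cg]; split; first exact: (dg 0%N).
case: k dg cg => [|k] dg cg; first exact: cg.
by move=> s; apply: differentiable_continuous; apply/derivable1_diffP; exact: (dg 1%N).
Qed.

Lemma classCk_derive1 k (g : R -> R) : classCk k.+1 g -> classCk k (derive1 g).
Proof.
move=> [dg cg]; have e j : derive1n j (derive1 g) = derive1n j.+1 g by rewrite derive1Sn.
by split => [j jk|]; rewrite e //; exact: dg.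
Qed.

End C1.

Section uniform_families.
Context {R : realType} {P : topologicalType} {X : Type} (E : set X).
Implicit Types (F G : P -> X -> R) (e : X -> R).

Definition bounded_on_set e := exists C : R, forall x, E x -> `|e x| <= C.

(** Continuity in the parameter for the sup norm over E, which passes to integrals. *)
Definition ucont F := forall p0 eps, 0 < eps ->
  \forall p \near p0, forall x, E x -> `|F p x - F p0 x| <= eps.

Lemma ucont_cst e : ucont (fun=> e).
Proof. by move=> p0 eps e0; apply: nearW => p x _; rewrite subrr normr0 ltW. Qed.

Lemma ucontD F G : ucont F -> ucont G -> ucont (fun p x => F p x + G p x).
Proof.
move=> uF uG p0 eps e0; have e2 : 0 < eps / 2 by rewrite divr_gt0.
apply: filterS2 (uF p0 _ e2) (uG p0 _ e2) => p hF hG x Ex.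
have := hF x Ex; have := hG x Ex; rewrite !ler_norml => /andP[? ?] /andP[? ?].
by apply/andP; split; lra.
Qed.

Lemma ucontM F G : (forall p, bounded_on_set (F p)) -> (forall p, bounded_on_set (G p)) ->
  ucont F -> ucont G -> ucont (fun p x => F p x * G p x).
Proof.
move=> bF bG uF uG p0 eps e0; have [C bC] := bF p0; have [C' bC'] := bG p0.
pose K := Num.max C 0 + Num.max C' 0 + 1.
have CK : C <= K /\ C' + 1 <= K /\ 0 < K.
  rewrite /K; have := le_max C C 0; have := le_max 0 C 0; have := le_max C' C' 0; have := le_max 0 C' 0.
  by rewrite !lexx ?orbT /=; lra.
have [CK1 [CK2 K0]] := CK.
have e2 : 0 < Num.min (eps / (2 * K)) 1 by rewrite lt_min ltr01 divr_gt0 ?mulr_gt0.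
have m1 : Num.min (eps / (2 * K)) 1 <= eps / (2 * K) by rewrite ge_min lexx.
have m2 : Num.min (eps / (2 * K)) 1 <= 1 by rewrite ge_min lexx orbT.
apply: filterS2 (uF p0 _ e2) (uG p0 _ e2) => p hF hG x Ex.
have hf := le_trans (hF x Ex) m1; have hg := le_trans (hG x Ex) m1.
have hg1 := le_trans (hG x Ex) m2.
have gK : `|G p x| <= K.
  apply: le_trans CK2; rewrite -(subrK (G p0 x) (G p x)) (le_trans (ler_normD _ _)) //.
  by rewrite addrC lerD // bC'.
have fK : `|F p0 x| <= K by apply: le_trans CK1; exact: bC.
have -> : F p x * G p x - F p0 x * G p0 x =
  (F p x - F p0 x) * G p x + F p0 x * (G p x - G p0 x) by ring.
apply: le_trans (ler_normD _ _) _; rewrite !normrM.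
have -> : eps = eps / (2 * K) * K + K * (eps / (2 * K)) by field; rewrite gt_eqF.
by rewrite lerD // ler_pM.
Qed.

Lemma ucontZ (c : P -> R) e : continuous c -> bounded_on_set e ->
  ucont (fun p x => c p * e x).
Proof.
move=> cc [C bC] p0 eps e0; pose K := Num.max C 0 + 1.
have CK : C <= K /\ 0 < K.
  rewrite /K; have := le_max C C 0; have := le_max 0 C 0; rewrite !lexx ?orbT /=; lra.
have e2 : 0 < eps / K by rewrite divr_gt0 // CK.2.
have /cvgrPdist_le h := cc p0; apply: filterS (h _ e2) => p hp x Ex.
rewrite -mulrBl normrM distrC -[eps](divfK (lt0r_neq0 CK.2)) ler_pM //.
exact: le_trans (bC x Ex) CK.1.
Qed.

Lemma ucont_sum (J : Type) (r : seq J) (F : J -> P -> X -> R) : (forall j, ucont (F j)) ->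
  ucont (fun p x => \sum_(j <- r) F j p x).
Proof.
move=> uF; elim: r => [|j r IH].
  rewrite (_ : (fun p x => _) = fun=> fun=> 0); first exact: ucont_cst.
  by apply/funext => p; apply/funext => x; rewrite big_nil.
rewrite (_ : (fun p x => _) = fun p x => F j p x + \sum_(j <- r) F j p x); first exact: ucontD.
by apply/funext => p; apply/funext => x; rewrite big_cons.
Qed.

Lemma ucont_comp (g : R -> R) F : C1 g -> (forall p, bounded_on_set (F p)) ->
  ucont F -> ucont (fun p x => g (F p x)).
Proof.
move=> C1g bF uF p0 eps e0; have [C bC] := bF p0.
have [K K0 lip] := C1_lipschitz (C + 1) C1g.
have e2 : 0 < Num.min (eps / (K + 1)) 1 by rewrite lt_min ltr01 divr_gt0 // ltr_wpDl.
have m1 : Num.min (eps / (K + 1)) 1 <= eps / (K + 1) by rewrite ge_min lexx.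
have m2 : Num.min (eps / (K + 1)) 1 <= 1 by rewrite ge_min lexx orbT.
apply: filterS (uF p0 _ e2) => p hF x Ex; have hx := hF x Ex.
apply: le_trans (lip _ _ _ _) _.
- rewrite -(subrK (F p0 x) (F p x)) (le_trans (ler_normD _ _)) // addrC lerD ?bC //.
  exact: le_trans m2.
- by apply: le_trans (bC x Ex) _; rewrite lerDl.
apply: (@le_trans _ _ ((K + 1) * (eps / (K + 1)))).
  by rewrite ler_pM ?lerDl // (le_trans hx).
by rewrite mulrC divfK // gt_eqF // ltr_wpDl.
Qed.

End uniform_families.

Section parametric_integrals.
Context {R : realType} {d : nat} (Om : cube R d).

Local Notation D := (cube_set Om).
Local Notation fn := ('rV[R]_d -> R).
Local Notation I := (intO Om).
Local Notation sq := (sq Om).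
Local Notation bdd := (bdd Om).
Local Notation integ := (integ Om).

Lemma bdd_set (f : fn) : bdd f -> bounded_on_set D f.
Proof. by case. Qed.

Lemma intO_bound (f h : fn) e : meas f -> integ h -> meas h -> 0 <= e ->
  (forall x, D x -> `|f x| <= e) -> `|I (fun x => f x * h x)| <= e * I (fun x => `|h x|).
Proof.
move=> mf jh mh e0 fe.
have jfh : integ (fun x => f x * h x).
  by apply: integ_bddM => //; split => //; exists e.
apply: le_trans (intO_norm jfh) _; rewrite -intOZ; last exact: integ_norm.
apply: intO_le; [exact: integ_norm|by apply: integZ; exact: integ_norm|].
by move=> x Dx; rewrite normrM ler_wpM2r // fe.
Qed.

Lemma intO_param (P : topologicalType) (H : P -> fn) h : (forall p, bdd (H p)) ->
  ucont D H -> integ h -> meas h -> forall p0 eps, 0 < eps ->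
  \forall p \near p0, `|I (fun x => H p x * h x) - I (fun x => H p0 x * h x)| <= eps.
Proof.
move=> bH uH jh mh p0 eps e0; set K := I (fun x => `|h x|) + 1.
have K0 : 0 < K by rewrite ltr_wpDl // intO_ge0.
have e2 : 0 < eps / K by rewrite divr_gt0.
apply: filterS (uH p0 _ e2) => p hp.
rewrite -intOB; [|exact: integ_bddM|exact: integ_bddM].
rewrite (@intO_eq _ _ Om _ (fun x => (H p x - H p0 x) * h x)); last by move=> x _; rewrite mulrBl.
apply: le_trans (intO_bound _ jh mh (ltW e2) hp) _.
  by apply: measurable_funB; apply: bdd_meas.
by rewrite mulrAC ler_pdivrMr // ler_pM2l // lerDl.
Qed.

Lemma intO_continuous (P : topologicalType) (H : P -> fn) h : (forall p, bdd (H p)) ->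
  ucont D H -> integ h -> meas h -> continuous (fun p => I (fun x => H p x * h x)).
Proof.
move=> bH uH jh mh p0; apply/cvgrPdist_le => eps e0.
by apply: filterS (intO_param bH uH jh mh p0 e0) => p; rewrite distrC.
Qed.

Lemma C1_affine_bdd (g : R -> R) (c0 c1 : fn) s : continuous g -> bdd c0 -> bdd c1 ->
  bdd (fun x => g (c0 x + s * c1 x)).
Proof. by move=> cg b0 b1; apply: bdd_comp => //; apply: bddD => //; exact: bddZ. Qed.

Lemma ucont_affine (c0 c1 : fn) : bdd c1 -> ucont D (fun (s : R) x => c0 x + s * c1 x).
Proof.
move=> b1; apply: ucontD; first exact: ucont_cst.
by apply: (@ucontZ R R _ _ (fun s => s)); [move=> s; exact: cvg_id|exact: bdd_set].
Qed.

(** Differentiation under the integral sign, the derivative being bounded because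
    the path stays in a bounded set for s near its value. *)
Lemma potential_is_derive (f : R -> R) (c0 c1 : fn) (s : R) : C1 f -> bdd c0 -> bdd c1 ->
  is_derive s (1 : R) (fun s => I (fun x => f (c0 x + s * c1 x)))
    (I (fun x => derive1 f (c0 x + s * c1 x) * c1 x)).
Proof.
move=> C1f b0 b1.
have ts (t : R) : s - 1 < t -> t < s + 1 -> `|t| <= `|s| + 1.
  move=> t1 t2; have := ler_norm s; have := ler_norm (- s); rewrite normrN => *.
  by rewrite ler_norml; apply/andP; split; lra.
have [m0 [C bC]] := b0; have [m1 [C' bC']] := b1.
pose K : R := `|C| + (`|s| + 1) * `|C'|.
have [G G0 bG] := continuous_bounded_segment (- K) K C1f.2.
have dx (t : R) x : is_derive t (1 : R) (fun t => f (c0 x + t * c1 x))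
    (derive1 f (c0 x + t * c1 x) * c1 x).
  have dl : is_derive t (1 : R) (fun t => c0 x + t * c1 x) (c1 x).
    have dg : is_derive t (1 : R) (cst (c0 x) + c1 x \*: (@idfun R)) (0 + c1 x *: 1).
      exact: is_deriveD.
    rewrite (_ : (fun t => _) = cst (c0 x) + c1 x \*: (@idfun R)).
      by apply: (is_derive_eq dg); rewrite add0r /GRing.scale /= mulr1.
    by apply/funext => r; rewrite mulrC.
  exact: (@is_derive1_comp R f _ t _ _ (C1_is_derive _ C1f) dl).
have d1E t x : partial1of2 (fun t x => f (c0 x + t * c1 x)) t x = derive1 f (c0 x + t * c1 x) * c1 x.
  by rewrite partial1of2E; exact: (@derive_val _ _ _ _ _ _ _ (dx t x)).
have hs : `]s - 1, s + 1[%classic s by rewrite /= in_itv /= ltrBlDr !ltrDl ltr01.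
have G1 : forall x : 'rV[R]_d, 0 <= G * `|C'| by move=> _; rewrite mulr_ge0.
have ub (t : R) x : `]s - 1, s + 1[%classic t -> D x ->
   `|partial1of2 (fun t x => f (c0 x + t * c1 x)) t x| <= G * `|C'|.
  rewrite /= in_itv /= => /andP[t1 t2] Dx; rewrite d1E normrM.
  have h1 : `|c1 x| <= `|C'| by apply: le_trans (bC' x Dx) (ler_norm _).
  rewrite ler_pM // bG // -ler_norml; apply: le_trans (ler_normD _ _) _.
  rewrite lerD ?(le_trans (bC x Dx)) ?ler_norm // normrM ler_pM //.
  exact: ts.
have intf (t : R) : `]s - 1, s + 1[%classic t ->
    (lebesgue_row d).-integrable D (EFin \o (fun x => f (c0 x + t * c1 x))).
  by move=> _; apply: (bdd_integ (C1_affine_bdd t (C1_continuous C1f) b0 b1)).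
have drv (t : R) x : `]s - 1, s + 1[%classic t -> D x -> derivable (fun t : R => f (c0 x + t * c1 x)) t 1.
  by move=> _ _; have [] := dx t x.
have intG : (lebesgue_row d).-integrable D (EFin \o (fun=> G * `|C'|)).
  exact: (bdd_integ (bdd_cst Om _)).
split.
  exact: (derivable_under_integral (measurable_cube Om) hs intf drv G1 intG ub).
have := differentiation_under_integral (measurable_cube Om) hs intf drv G1 intG ub.
rewrite derive1E => ->; apply: intO_eq => x Dx; exact: d1E.
Qed.

Lemma continuous_potential_deriv (g : R -> R) (c0 c1 h : fn) : C1 g ->
  bdd c0 -> bdd c1 -> integ h -> meas h ->
  continuous (fun s : R => I (fun x => g (c0 x + s * c1 x) * h x)).
Proof.
move=> C1g b0 b1 jh mh; apply: intO_continuous => //.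
  by move=> s; apply: C1_affine_bdd => //; exact: C1_continuous.
apply: ucont_comp => //; last exact: ucont_affine.
by move=> s; apply: bdd_set; apply: bddD => //; exact: bddZ.
Qed.

(** Along an affine path the time integral of f'(phi) against the constant velocity
    is the exact difference of the potential energies. This identity makes the
    energy balance an equality. *)
Lemma chain_rule_slab (f : R -> R) (c0 c1 : fn) (a b : R) : a < b -> C1 f -> C1 (derive1 f) ->
  bdd c0 -> bdd c1 ->
  \int[lebesgue_measure]_(s in `[a, b]) I (fun x => derive1 f (c0 x + s * c1 x) * c1 x) =
  I (fun x => f (c0 x + b * c1 x)) - I (fun x => f (c0 x + a * c1 x)).
Proof.
move=> ab C1f C1f' b0 b1.
have := itv_integral_deriv ab (fun s => potential_is_derive s C1f b0 b1)
  (continuous_potential_deriv C1f' b0 b1 (bdd_integ b1) (bdd_meas b1)).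
by rewrite /Rintegral => ->.
Qed.

(** Joint uniform continuity in the time and space variables, since the parameter
    acts on the integrand at all times of the slab. *)
Lemma slab_param (P : topologicalType) (H : P -> R -> fn) (h : fn) (a b : R) : a <= b ->
  (forall p s, bdd (H p s)) -> (forall p, ucont D (H p)) ->
  ucont [set sx : R * 'rV[R]_d | a <= sx.1 <= b /\ D sx.2] (fun p sx => H p sx.1 sx.2) ->
  integ h -> meas h ->
  continuous (fun p => \int[lebesgue_measure]_(s in `[a, b]) I (fun x => H p s x * h x)).
Proof.
move=> ab bH uH uP jh mh p0; apply/cvgrPdist_le => eps e0.
set K := I (fun x => `|h x|) + 1; have K0 : 0 < K by rewrite ltr_wpDl // intO_ge0.
set L := b - a + 1; have L0 : 0 < L by rewrite ltr_wpDl // subr_ge0.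
have e2 : 0 < eps / (K * L) by rewrite divr_gt0 ?mulr_gt0.
have int_s p : lebesgue_measure.-integrable `[a, b] (EFin \o (fun s => I (fun x => H p s x * h x))).
  apply: continuous_compact_integrable; first exact: segment_compact.
  by apply: continuous_subspaceT; exact: intO_continuous.
have mI : measurable (`[a, b]%classic : set (measurableTypeR R)) by exact: measurable_itv.
apply: filterS (uP p0 _ e2) => p hp.
rewrite -RintegralB //; apply: le_trans (le_normr_Rintegral _ _) _ => //.
  by have := integrableB mI (int_s p0) (int_s p); apply: eq_integrable.
apply: (@le_trans _ _ (\int[lebesgue_measure]_(s in `[a, b]) (eps / (K * L) * K))).
  apply: le_Rintegral => //.
  - have := integrable_abse (integrableB mI (int_s p0) (int_s p)).
    by apply: eq_integrable.
  - apply: continuous_compact_integrable; first exact: segment_compact.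
    by apply: continuous_subspaceT; exact: cst_continuous.
  move=> s /=; rewrite in_itv /= => sab.
  rewrite distrC -intOB; [|exact: integ_bddM|exact: integ_bddM].
  rewrite (@intO_eq _ _ Om _ (fun x => (H p s x - H p0 s x) * h x)); last by move=> x _; rewrite mulrBl.
  apply: le_trans (intO_bound _ jh mh (ltW e2) _) _.
  - by apply: measurable_funB; apply: bdd_meas.
  - by move=> x Dx; exact: (hp (s, x)).
  by rewrite ler_wpM2l ?ltW // /K ltrDl.
rewrite Rintegral_cst //= lebesgue_measure_itv /= lte_fin.
have -> : eps / (K * L) * K = eps / L by field; rewrite !gt_eqF.
have : eps / L * (b - a) <= eps.
  by rewrite mulrAC ler_pdivrMr // ler_pM2l // /L lerDl.
by case: ltP => _ ? //=; rewrite ?mulr0 ?ltW.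
Qed.

End parametric_integrals.

(** * The bilinear and trilinear forms *)

Section forms.
Context {R : realType} {d : nat} (Om : cube R d).

Local Notation D := (cube_set Om).
Local Notation fn := ('rV[R]_d -> R).
Local Notation vf := ('I_d -> 'rV[R]_d -> R).
Local Notation I := (intO Om).
Local Notation sq := (sq Om).
Local Notation bdd := (bdd Om).
Local Notation integ := (integ Om).
Local Notation H1 := (H1 Om).
Local Notation wpair := (wpair Om).
Local Notation gradform := (gradform Om).
Implicit Types (f g h u v w p q : fn).

Definition transport (phi : fn) (w : vf) (psi : fn) :=
  \sum_i wpair i (fun x => phi x * w i x) psi.

Definition convection (a b c : vf) := 2^-1 * \sum_i \sum_j
  (wpair j (fun x => a j x * c i x) (b i) - wpair j (fun x => a j x * b i x) (c i)).

Definition viscosity h (u v : vf) := \sum_i gradform h (u i) (v i).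

Lemma ipvE (a b : vf) : (forall i, integ (fun x => a i x * b i x)) ->
  ipv Om a b = \sum_i I (fun x => a i x * b i x).
Proof. exact: intO_sum. Qed.

Lemma ipv_sq (a b : vf) : (forall i, sq (a i)) -> (forall i, sq (b i)) ->
  ipv Om a b = \sum_i ip Om (a i) (b i).
Proof. by move=> sa sb; apply: ipvE => i; exact: sqM. Qed.

Lemma ipv_gradform h v w : bdd h -> H1 v -> H1 w ->
  ipv Om (fun i x => h x * grad Om v i x) (grad Om w) = gradform h v w.
Proof.
move=> bh Hv Hw; apply: ipvE => i; apply: sqM; last exact: wderiv_sq.
exact: sq_bddM (wderiv_sq i Hv).
Qed.

Lemma ipv_grad v w : H1 v -> H1 w ->
  ipv Om (grad Om v) (grad Om w) = gradform (fun=> 1) v w.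
Proof.
move=> Hv Hw; rewrite -(ipv_gradform (bdd_cst Om 1) Hv Hw).
by apply: intO_eq => x _; apply: eq_bigr => i _; rewrite mul1r.
Qed.

Lemma ipv_transport phi (w : vf) psi : bdd phi -> (forall i, sq (w i)) -> H1 psi ->
  ipv Om (fun i x => phi x * w i x) (grad Om psi) = transport phi w psi.
Proof.
move=> bp sw Hp; apply: ipvE => i; apply: sqM; last exact: wderiv_sq.
exact: sq_bddM.
Qed.

Lemma ipm_sq (A B : 'I_d -> 'I_d -> fn) : (forall i j, sq (A i j)) -> (forall i j, sq (B i j)) ->
  ipm Om A B = \sum_i \sum_j I (fun x => A i j x * B i j x).
Proof.
move=> sA sB; rewrite /ipm intO_sum.
  by apply: eq_bigr => i _; apply: intO_sum => j; exact: sqM.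
by move=> i; apply: integ_sum => j; exact: sqM.
Qed.

Lemma ipm_viscosity h (u v : vf) : bdd h -> (forall i, H1 (u i)) -> (forall i, H1 (v i)) ->
  ipm Om (fun i j x => h x * gradv Om u i j x) (gradv Om v) = viscosity h u v.
Proof.
move=> bh Hu Hv; apply: ipm_sq => i j; last exact: wderiv_sq.
exact: sq_bddM (wderiv_sq j (Hu i)).
Qed.

Lemma ipm_grad (u v : vf) : (forall i, H1 (u i)) -> (forall i, H1 (v i)) ->
  ipm Om (gradv Om u) (gradv Om v) = viscosity (fun=> 1) u v.
Proof.
move=> Hu Hv; rewrite -(ipm_viscosity (bdd_cst Om 1) Hu Hv).
apply: intO_eq => x _; apply: eq_bigr => i _; apply: eq_bigr => j _.
by rewrite mul1r.
Qed.

Lemma ip_divg p (v : vf) : sq p -> (forall i, H1 (v i)) ->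
  ip Om p (divg Om v) = \sum_i wpair i p (v i).
Proof.
move=> sp Hv; rewrite /ip /divg -intO_sum; last by move=> i; apply: sqM => //; exact: wderiv_sq.
by apply: intO_eq => x _; rewrite mulr_sumr.
Qed.

Lemma ip_divgC p (v : vf) : ip Om (divg Om v) p = ip Om p (divg Om v).
Proof. exact: sq_pairC. Qed.

Lemma skw_convection (a b c : vf) : (forall i, bdd (a i)) -> (forall i, bdd (b i)) ->
  (forall i, bdd (c i)) -> (forall i, H1 (b i)) -> (forall i, H1 (c i)) ->
  skw Om a b c = convection a b c.
Proof.
move=> ba bb bc Hb Hc; rewrite /skw /convection; congr (_ * _).
have key (b' c' : vf) : (forall i, bdd (c' i)) -> (forall i, H1 (b' i)) ->
    ipv Om (Defs.conv Om a b') c' = \sum_i \sum_j wpair j (fun x => a j x * c' i x) (b' i).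
  move=> bc' Hb'; have jj i j : integ (fun x => a j x * c' i x * wderiv Om j (b' i) x).
    by apply: sqM; [exact: bdd_sq (bddM (ba j) (bc' i))|exact: wderiv_sq].
  transitivity (I (fun x => \sum_i \sum_j a j x * c' i x * wderiv Om j (b' i) x)).
    apply: intO_eq => x _; apply: eq_bigr => i _; rewrite mulr_suml.
    by apply: eq_bigr => j _; rewrite mulrAC.
  rewrite intO_sum; last by move=> i; exact: integ_sum.
  by apply: eq_bigr => i _; rewrite intO_sum.
rewrite key //; under [RHS]eq_bigr do rewrite sumrB.
rewrite sumrB; congr (_ - _).
rewrite -(key c b) //; apply: intO_eq => x _.
by apply: eq_bigr => i _; rewrite mulrC.
Qed.

(** Skew-symmetry, term by term: this is why convection does no work. *)
Lemma convection_alt (a b : vf) : convection a b b = 0.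
Proof.
by rewrite /convection big1 ?mulr0 // => i _; rewrite big1 // => j _; rewrite subrr.
Qed.

End forms.

(** * Finite element spaces *)

Section periodic_functions.
Context {R : realType} {d : nat} (Om : cube R d).
Local Notation fn := ('rV[R]_d -> R).

Lemma periodic_int (v : fn) (i : 'I_d) (z : int) x : Defs.periodic Om v ->
  v (x + (z%:~R * side Om) *: dir i) = v x.
Proof.
move=> pv; have pos (n : nat) y : v (y + (n%:R * side Om) *: dir i) = v y.
  elim: n y => [|n IH] y; first by rewrite mul0r scale0r addr0.
  by rewrite -natr1 mulrDl mul1r scalerDl addrA pv IH.
case: z => n; first exact: pos.
rewrite NegzE mulrNz mulNr scaleNr -[in RHS](subrK ((n.+1%:R * side Om) *: dir i) x).
by rewrite pos.
Qed.

Lemma periodic_lattice (v : fn) (z : 'I_d -> int) x : Defs.periodic Om v ->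
  v (x + \sum_i ((z i)%:~R * side Om) *: dir i) = v x.
Proof.
move=> pv; elim: (index_enum _) x => [|i r IH] x; first by rewrite big_nil addr0.
by rewrite big_cons addrA IH periodic_int.
Qed.

(** The floor in each coordinate gives the lattice vector to subtract. *)
Lemma periodic_cube (v : fn) x : Defs.periodic Om v ->
  exists2 y, cube_set Om y & v x = v y.
Proof.
move=> pv; have s0 := side_gt0 Om.
pose z i := - Num.floor ((x ord0 i - corner Om ord0 i) / side Om).
exists (x + \sum_i ((z i)%:~R * side Om) *: dir i); last by rewrite periodic_lattice.
move=> i; rewrite mxE summxE (bigD1 i) //= big1 => [|j ji]; last first.
  by rewrite !mxE eqxx eq_sym (negbTE ji) mulr0.
rewrite !mxE !eqxx mulr1 addr0 /z mulrNz.
have /andP[f1 f2] := floor_itv ((x ord0 i - corner Om ord0 i) / side Om).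
move: f1 f2; set fl := Num.floor _; rewrite intrD.
rewrite ler_pdivlMr // ltr_pdivrMr // mulrDl mul1r mulNr.
by move: (fl%:~R * side Om) => t h1 h2; apply/andP; split; lra.
Qed.

End periodic_functions.

Section polynomials.
Context {R : realType} {d : nat}.
Local Notation fn := ('rV[R]_d -> R).

Definition monomial (k : nat) (m : {ffun 'I_d -> 'I_k.+1}) : fn :=
  fun x => \prod_i x ord0 i ^+ m i.

Lemma monomial_continuous k (m : {ffun 'I_d -> 'I_k.+1}) : continuous (monomial m).
Proof.
apply: (@continuous_big R 'I_d *%R 1 xpredT (@mul_continuous R)) => i _ x.
have cx := @coord_continuous R _ _ ord0 i x.
exact: (continuous_comp cx (@exprn_continuous R (m i) _)).
Qed.

Lemma polynomial_continuous k (p : fn) : polynomial_le k p -> continuous p.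
Proof.
move=> [c pc]; have -> : p = fun x => \sum_(m : {ffun 'I_d -> 'I_k.+1} | (\sum_i m i <= k)%N)
    c m * monomial m x by apply/funext.
have h (m : {ffun 'I_d -> 'I_k.+1}) : continuous (fun x : 'rV[R]_d => c m * monomial m x).
  by move=> x; exact: (cvgM (cvg_cst (c m)) (@monomial_continuous k m x)).
by apply: continuous_big => [|m _]; [exact: add_continuous|exact: h].
Qed.

Lemma polynomial_cst k (a : R) : @polynomial_le R d k (fun=> a).
Proof.
exists (fun m => if m == [ffun=> ord0] then a else 0) => x.
rewrite (bigD1 [ffun=> ord0]) /=; last by rewrite big1 // => i _; rewrite ffunE.
rewrite eqxx big1 => [|i _]; last by rewrite ffunE expr0.
by rewrite mulr1 big1 ?addr0 // => m /andP[_ /negbTE ->]; rewrite mul0r.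
Qed.

End polynomials.

Section finite_elements.
Context {R : realType} {d : nat} (Om : cube R d) (M : mesh R d).
Hypothesis cover : \bigcup_(i : 'I_(ncells M)) cell i = cube_set Om.

Local Notation D := (cube_set Om).
Local Notation fn := ('rV[R]_d -> R).

Lemma cell_cube (i : 'I_(ncells M)) x : cell i x -> D x.
Proof. by move=> cx; rewrite -cover; exists i. Qed.

Lemma piecewise_poly_lin k a (v w : fn) :
  piecewise_poly M k v -> piecewise_poly M k w -> piecewise_poly M k (a *: v + w).
Proof.
move=> pv pw i; have [p [c pc] vp] := pv i; have [q [c' qc] wq] := pw i.
exists (a *: p + q) => [|x cx]; last first.
  by change (a * v x + w x = a * p x + q x); rewrite vp // wq.
exists (fun m => a * c m + c' m) => x.
change (a * p x + q x = \sum_(m : {ffun 'I_d -> 'I_k.+1} | (\sum_i m i <= k)%N)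
  (a * c m + c' m) * \prod_i x ord0 i ^+ m i).
rewrite pc qc mulr_sumr -big_split /=; apply: eq_bigr => m _.
by rewrite mulrDl mulrA.
Qed.

Lemma piecewise_poly_bounded k (v : fn) : piecewise_poly M k v -> bounded_on_set D v.
Proof.
move=> pv; have bc (i : 'I_(ncells M)) : exists C : R, forall x, @cell R d M i x -> `|v x| <= C.
  have [p pp vp] := pv i.
  have [C _ bC] := continuous_bounded_box (corner Om) (side Om) (polynomial_continuous pp).
  by exists C => x cx; rewrite vp // bC //; exact: cell_cube cx.
have [C bC] := boolp.choice bc; exists (\sum_i `|C i|) => x.
rewrite -cover => -[i _ cx]; apply: le_trans (bC i x cx) _.
by rewrite (bigD1 i) //= (le_trans (ler_norm _)) // lerDl sumr_ge0.
Qed.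

(** The coefficients on all cells are coordinates: the cells cover the cube, and a
    periodic function vanishing on the cube vanishes everywhere. *)
Lemma piecewise_poly_fin_span k (S : fn -> Prop) : submodule S ->
  (forall v, S v -> Defs.periodic Om v /\ piecewise_poly M k v) -> fin_span S.
Proof.
move=> Ss Sv; pose J : finType := ('I_(ncells M) * {ffun 'I_d -> 'I_k.+1})%type.
pose ev (c :'rV[R]_#|J|) i (x : 'rV[R]_d) :=
  \sum_(m : {ffun 'I_d -> 'I_k.+1} | (\sum_i m i <= k)%N)
    c ord0 (enum_rank ((i, m) : J)) * monomial m x.
apply: (@fin_span_rep R fn S #|J| (fun v c => forall (i : 'I_(ncells M)) x, cell i x -> v x = ev c i x)) => //.
- move=> v /Sv[_ pv].
  have /boolp.choice[c cP] : forall i : 'I_(ncells M), exists c : {ffun 'I_d -> 'I_k.+1} -> R,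
      forall x, cell i x ->
      v x = \sum_(m : {ffun 'I_d -> 'I_k.+1} | (\sum_i m i <= k)%N) c m * monomial m x.
    by move=> i; have [p [c pc] vp] := pv i; exists c => x cx; rewrite vp // pc.
  exists (\row_j c (enum_val j).1 (enum_val j).2) => i x cx.
  by rewrite (cP i x cx); apply: eq_bigr => m _; rewrite mxE enum_rankK.
- move=> a v w c c' vc wc i x cx.
  change (a * v x + w x = ev (a *: c + c') i x).
  rewrite (vc i x cx) (wc i x cx) /ev mulr_sumr -big_split /=; apply: eq_bigr => m _.
  by rewrite !mxE mulrDl mulrA.
- move=> v /Sv[pv _] v0; apply/funext => x.
  have [y + ->] := periodic_cube x pv; rewrite -cover => -[i _ cy].
  by rewrite (v0 i y cy) /ev big1 // => m _; rewrite mxE mul0r.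
Qed.

Lemma Vh_submodule : submodule (Vh Om M).
Proof.
split; first by split; [exact: H1_cst|move=> i; exists (fun=> 0); [exact: polynomial_cst|]].
move=> a v w [Hv pv] [Hw pw]; split; first by apply (H1_submodule Om).2.
exact: piecewise_poly_lin.
Qed.

Lemma Vh_cst c : Vh Om M (fun=> c).
Proof. by split; [exact: H1_cst|move=> i; exists (fun=> c); [exact: polynomial_cst|]]. Qed.

Lemma Vh_bdd v : Vh Om M v -> bdd Om v.
Proof.
by move=> [Hv pv]; split; [exact: sq_meas (H1_sq Hv)|exact: piecewise_poly_bounded pv].
Qed.

Lemma Vh_fin_span : fin_span (Vh Om M).
Proof.
apply: (@piecewise_poly_fin_span 2); first exact: Vh_submodule.
by move=> v [[[pv _ _] _] ppv].
Qed.

Lemma Qh_submodule : submodule (Qh Om M).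
Proof.
split.
  split; [split; [exact: L2_cst|exact: intO0]|exact: H1_cst|].
  by move=> i; exists (fun=> 0); [exact: polynomial_cst|].
move=> a p q [[Lp p0] Hp pp] [[Lq q0] Hq pq]; split; last exact: piecewise_poly_lin.
  split; first exact: L2_lin.
  have jp := sq_integ (L2_sq Lp); have jq := sq_integ (L2_sq Lq).
  by rewrite (intOD (integZ a jp) jq) (intOZ a jp) p0 q0 mulr0 addr0.
by apply (H1_submodule Om).2.
Qed.

Lemma Qh_fin_span : fin_span (Qh Om M).
Proof.
apply: (@piecewise_poly_fin_span 1); first exact: Qh_submodule.
by move=> v [[[pv _ _] _] _ ppv].
Qed.

End finite_elements.

(** * Linearity and continuity of the forms *)

Section linear_functionals.
Context {R : realType} {W : lmodType R}.
Implicit Types (S : W -> Prop) (l : W -> R).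

Lemma linear_on_add S l l' : linear_on S l -> linear_on S l' -> linear_on S (fun x => l x + l' x).
Proof. by move=> h h' a x y Sx Sy; rewrite h // h' //; ring. Qed.

Lemma linear_on_scale S c l : linear_on S l -> linear_on S (fun x => c * l x).
Proof. by move=> h a x y Sx Sy; rewrite h //; ring. Qed.

Lemma linear_on_opp S l : linear_on S l -> linear_on S (fun x => - l x).
Proof. by move=> h a x y Sx Sy; rewrite h //; ring. Qed.

Lemma linear_on_sub S l l' : linear_on S l -> linear_on S l' -> linear_on S (fun x => l x - l' x).
Proof. by move=> h h'; apply: linear_on_add => //; exact: linear_on_opp. Qed.

Lemma linear_on_subset S S' l : (forall x, S' x -> S x) -> linear_on S l -> linear_on S' l.
Proof. by move=> sub h a x y /sub Sx /sub Sy; exact: h. Qed.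

Lemma linear_on_continuous S n (e : 'I_n -> W) l : submodule S -> (forall j, S (e j)) ->
  linear_on S l -> continuous (fun x : 'rV[R]_n => l (\sum_j x ord0 j *: e j)).
Proof.
move=> Ss Se ll; rewrite (_ : (fun _ => _) = fun x : 'rV[R]_n => \sum_j x ord0 j * l (e j)).
  have h j : continuous (fun x : 'rV[R]_n => x ord0 j * l (e j)).
    by move=> x; have cx := @coord_continuous R _ _ ord0 j x; exact: (cvgM cx (cvg_cst _)).
  by apply: continuous_big => [|j _]; [exact: add_continuous|exact: h].
by apply/funext => x; rewrite (linear_on_sum _ _ Ss ll Se).
Qed.

(** Continuity in both places at once, for the trilinear forms and for weights
    depending on the unknown: linearity in one argument reduces it to finitely many
    fixed vectors. *)
Lemma linear_on_continuous2 S n (e : 'I_n -> W) (l : 'rV[R]_n -> W -> R) :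
  submodule S -> (forall j, S (e j)) -> (forall x, linear_on S (l x)) ->
  (forall v, S v -> continuous (l^~ v)) ->
  continuous (fun x : 'rV[R]_n => l x (\sum_j x ord0 j *: e j)).
Proof.
move=> Ss Se ll lc; rewrite (_ : (fun _ => _) = fun x : 'rV[R]_n => \sum_j x ord0 j * l x (e j)).
  have h j : continuous (fun x : 'rV[R]_n => x ord0 j * l x (e j)).
    by move=> x; have cx := @coord_continuous R _ _ ord0 j x; exact: (cvgM cx (lc _ (Se j) x)).
  by apply: continuous_big => [|j _]; [exact: add_continuous|exact: h].
by apply/funext => x; rewrite (linear_on_sum _ _ Ss (ll x) Se).
Qed.

End linear_functionals.

Section vector_spaces.
Context {R : realType} {d : nat}.
Local Notation fn := ('rV[R]_d -> R).

(** Vector fields, and whole states of the discrete system, are families of functions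
    in V. *)
Definition componentwise k (V : fn -> Prop) (s : 'I_k -> fn) := forall i, V (s i).

Lemma componentwise_submodule k V : submodule V -> submodule (@componentwise k V).
Proof.
by move=> [V0 VD]; split => [i|a s t Vs Vt i]; [exact: V0|exact: (VD a _ _ (Vs i) (Vt i))].
Qed.

Lemma sum_component k n (E : 'I_n -> 'I_k -> fn) (x : 'rV[R]_n) i :
  (\sum_j x ord0 j *: E j) i = \sum_j x ord0 j *: E j i.
Proof. by rewrite fct_sumE. Qed.

Lemma componentwise_fin_span k V : submodule V -> fin_span V -> fin_span (@componentwise k V).
Proof.
move=> sV [n [e [Ve span]]].
apply: (@fin_span_rep R ('I_k -> fn) _ (k * n)
  (fun s c => forall i, s i = \sum_j (vec_mx c) i j *: e j)).
- exact: componentwise_submodule.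
- move=> s Vs; have [c cP] := boolp.choice (fun i => span _ (Vs i)).
  exists (mxvec (\matrix_(i, j) c i j)) => i; rewrite mxvecK cP.
  by apply: eq_bigr => j _; rewrite mxE.
- move=> a s t c c' sc tc i; change (a *: s i + t i = \sum_j (vec_mx (a *: c + c')) i j *: e j).
  rewrite sc tc scaler_sumr -big_split /=; apply: eq_bigr => j _.
  by rewrite !linearP /= !mxE scalerDl scalerA.
- move=> s _ s0; apply/funext => i; rewrite s0 big1 // => j _.
  by rewrite linear0 mxE scale0r.
Qed.

End vector_spaces.

Section form_lemmas.
Context {R : realType} {d : nat} (Om : cube R d).
Local Notation D := (cube_set Om).
Local Notation fn := ('rV[R]_d -> R).
Local Notation vf := ('I_d -> 'rV[R]_d -> R).
Local Notation I := (intO Om).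
Local Notation sq := (sq Om).
Local Notation bdd := (bdd Om).
Local Notation H1 := (H1 Om).
Local Notation wpair := (wpair Om).
Local Notation gradform := (gradform Om).
Local Notation transport := (transport Om).
Local Notation convection := (convection Om).
Local Notation viscosity := (viscosity Om).
Variables (V : fn -> Prop).
Hypotheses (sV : submodule V) (VH1 : forall v, V v -> H1 v) (Vb : forall v, V v -> bdd v).
Local Notation Vd := (@componentwise R d d V).

Let Vsq v : V v -> sq v. Proof. by move/Vb; exact: bdd_sq. Qed.

Lemma ip_lin_r u : sq u -> linear_on V (ip Om u).
Proof. by move=> su a v w Vv Vw; apply: sq_pair_lin_r => //; exact: Vsq. Qed.

Lemma ip_lin_l u : sq u -> linear_on V ((ip Om)^~ u).
Proof. by move=> su a v w Vv Vw; apply: sq_pair_lin_l => //; exact: Vsq. Qed.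

Lemma ipC (u v : fn) : ip Om u v = ip Om v u.
Proof. exact: sq_pairC. Qed.

Lemma ip_ge0 (u : fn) : 0 <= ip Om u u.
Proof. by apply: intO_ge0 => x _; rewrite -expr2 sqr_ge0. Qed.

Lemma ip_null u : sq u -> ip Om u u = 0 -> aeq Om u (fun=> 0).
Proof. by move=> su e; apply: intO_sq0 su _; rewrite -[RHS]e; apply: intO_eq => x _; rewrite expr2. Qed.

Lemma ip_null_l (u v : fn) : meas u -> meas v -> aeq Om u (fun=> 0) -> ip Om u v = 0.
Proof. exact: aeq0_integ. Qed.

Lemma gradform_lin h u : bdd h -> V u -> linear_on V (gradform h u).
Proof. by move=> bh Vu; apply: (linear_on_subset VH1); apply: gradform_lin_r => //; exact: VH1. Qed.

Lemma transport_lin phi (w : vf) : bdd phi -> (forall i, sq (w i)) ->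
  linear_on V (transport phi w).
Proof.
move=> bp sw; apply: linear_on_bigsum => i; apply: (linear_on_subset VH1).
by apply: wpair_lin_r; exact: sq_bddM.
Qed.

Lemma component_lin (l : 'I_d -> fn -> R) : (forall i, linear_on V (l i)) ->
  linear_on Vd (fun v => \sum_i l i (v i)).
Proof. by move=> ll; apply: linear_on_bigsum => i a v w Vv Vw; exact: (ll i a _ _ (Vv i) (Vw i)). Qed.

Lemma wpair_mul_lin i h psi : bdd h -> H1 psi ->
  linear_on V (fun v => wpair i (fun x => h x * v x) psi).
Proof.
move=> bh Hp a v w Vv Vw.
rewrite -(wpair_lin_l i Hp a (sq_bddM bh (Vsq Vv)) (sq_bddM bh (Vsq Vw))).
congr (wpair _ _ _); apply/funext => x.
transitivity (h x * (a * v x + w x)); first by [].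
transitivity (a * (h x * v x) + h x * w x); [ring|by []].
Qed.

Lemma transport_lin_field phi psi : bdd phi -> H1 psi ->
  linear_on Vd (fun w => transport phi w psi).
Proof.
move=> bp Hp.
by apply: (component_lin (l := fun i v => wpair i (fun x => phi x * v x) psi)) => i; exact: wpair_mul_lin.
Qed.

Lemma convection_lin (a b : vf) : Vd a -> Vd b -> linear_on Vd (convection a b).
Proof.
move=> Va Vvb; apply: (@linear_on_scale _ _ _ 2^-1 (fun c => \sum_i \sum_j
  (wpair j (fun x => a j x * c i x) (b i) - wpair j (fun x => a j x * b i x) (c i)))).
apply: linear_on_bigsum => i; apply: linear_on_bigsum => j.
apply: linear_on_sub => r v w Vv Vw.
  exact: (wpair_mul_lin j (Vb (Va j)) (VH1 (Vvb i)) r (Vv i) (Vw i)).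
have s : sq (fun x => a j x * b i x) by apply: sq_bddM (Vb (Va j)) (Vsq (Vvb i)).
exact: (wpair_lin_r j s r (VH1 (Vv i)) (VH1 (Vw i))).
Qed.

Lemma viscosity_lin h (u : vf) : bdd h -> Vd u -> linear_on Vd (viscosity h u).
Proof.
move=> bh Vu.
by apply: (component_lin (l := fun i => gradform h (u i))) => i; exact: gradform_lin.
Qed.

Section continuity.
Variables (P : topologicalType) (H : P -> fn).
Hypotheses (Hb : forall p, bdd (H p)) (Hu : ucont D H).

Lemma wpair_continuous i psi : H1 psi -> continuous (fun p => wpair i (H p) psi).
Proof.
move=> Hp; have s := wderiv_sq i Hp.
by apply: intO_continuous => //; [exact: sq_integ|exact: sq_meas s].
Qed.

Lemma gradform_continuous v w : H1 v -> H1 w -> continuous (fun p => gradform (H p) v w).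
Proof.
move=> Hv Hw; have h i : continuous (fun p => wpair i (fun x => H p x * wderiv Om i v x) w).
  have sv := wderiv_sq i Hv; have sw := wderiv_sq i Hw.
  have := intO_continuous Hb Hu (sqM sv sw) (measM (sq_meas sv) (sq_meas sw)).
  rewrite (_ : (fun p => _) = fun p => wpair i (fun x => H p x * wderiv Om i v x) w) //.
  by apply/funext => p; apply: intO_eq => x _; rewrite mulrA.
by apply: continuous_big => [|i _]; [exact: add_continuous|exact: h].
Qed.

End continuity.

Section combination.
Variables (n : nat) (e : 'I_n -> fn) (c : R) (u : fn).
Hypotheses (Ve : forall j, V (e j)) (Vu : V u).

Lemma combination_ucont : ucont D (fun x : 'rV[R]_n => c *: (\sum_j x ord0 j *: e j) + u).
Proof.
have h j : ucont D (fun (x : 'rV[R]_n) y => x ord0 j * e j y).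
  by apply: ucontZ; [exact: coord_continuous|exact/bdd_set/Vb].
have hc : ucont D (fun (x : 'rV[R]_n) y => c * \sum_j x ord0 j * e j y).
  apply: (@ucontM _ _ _ _ (fun=> fun=> c)).
  - by move=> _; exists `|c|.
  - move=> x; have [_] := Vb (submodule_sum (index_enum _) (fun j => x ord0 j) sV Ve).
    by move=> [C bC]; exists C => y Dy; have := bC y Dy; rewrite fct_sumE.
  - exact: ucont_cst.
  - exact: ucont_sum.
have := ucontD hc (@ucont_cst _ _ _ D u).
rewrite (_ : (fun p x => _) = fun x : 'rV[R]_n => c *: (\sum_j x ord0 j *: e j) + u) //.
apply/funext => x; apply/funext => y.
by change (c * (\sum_j x ord0 j * e j y) + u y = c * (\sum_j x ord0 j *: e j) y + u y); rewrite fct_sumE.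
Qed.

End combination.

End form_lemmas.

(** * The chemical potential averaged over a slab *)

Section slab_average.
Context {R : realType} {d : nat} (Om : cube R d).
Local Notation D := (cube_set Om).
Local Notation fn := ('rV[R]_d -> R).
Local Notation I := (intO Om).
Variables (f : R -> R) (a tau : R) (p0 : fn).
Hypotheses (C1f : C1 f) (C1f' : C1 (derive1 f)) (tau0 : 0 < tau) (bp0 : bdd Om p0).

(** The time integral of f'(phi) against xi over the slab starting at a, for phi
    affine from p0 to p0 + chi. *)
Definition slab_potential (chi xi : fn) : R :=
  \int[lebesgue_measure]_(s in `[a, a + tau])
    I (fun x => derive1 f (p0 x + (s - a) / tau * chi x) * xi x).

Let time_continuous : continuous (fun s : R => (s - a) / tau).
Proof. by move=> s; exact: (cvgM (cvgB cvg_id (cvg_cst a)) (cvg_cst tau^-1)). Qed.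

Let slab_ucont chi : bdd Om chi ->
  ucont D (fun (s : R) x => derive1 f (p0 x + (s - a) / tau * chi x)).
Proof.
move=> bc; apply: ucont_comp => //.
  by move=> s; apply: bdd_set; apply: bddD => //; exact: bddZ.
by apply: ucontD; [exact: ucont_cst|apply: ucontZ => //; exact: bdd_set].
Qed.

Let slab_bdd chi (s : R) : bdd Om chi ->
  bdd Om (fun x => derive1 f (p0 x + (s - a) / tau * chi x)).
Proof. by move=> bc; apply: C1_affine_bdd => //; exact: C1_continuous. Qed.

Let slab_integrable chi xi : bdd Om chi -> bdd Om xi ->
  lebesgue_measure.-integrable `[a, a + tau]
    (EFin \o (fun s => I (fun x => derive1 f (p0 x + (s - a) / tau * chi x) * xi x))).
Proof.
move=> bc bx; apply: continuous_compact_integrable; first exact: segment_compact.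
apply: continuous_subspaceT; apply: (intO_continuous (H := fun s x => derive1 f (p0 x + (s - a) / tau * chi x))).
- by move=> s; exact: slab_bdd.
- exact: slab_ucont.
- exact: bdd_integ.
- exact: bdd_meas bx.
Qed.

Lemma slab_potential_lin chi (S : fn -> Prop) : (forall v, S v -> bdd Om v) ->
  bdd Om chi -> linear_on S (slab_potential chi).
Proof.
move=> Sb bc r v w /Sb bv /Sb bw; rewrite /slab_potential.
have mI : measurable (`[a, a + tau]%classic : set (measurableTypeR R)) by exact: measurable_itv.
have iv := slab_integrable bc bv; have iw := slab_integrable bc bw.
rewrite -RintegralZl // -RintegralD //; last first.
  by apply: eq_integrable (integrableZl mI r iv).
apply: eq_Rintegral => s _; apply: sq_pair_lin_r.
- exact: bdd_sq (slab_bdd s bc).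
- exact: bdd_sq.
- exact: bdd_sq.
Qed.

Lemma slab_potential_null chi xi : bdd Om chi -> meas xi -> aeq Om xi (fun=> 0) ->
  slab_potential chi xi = 0.
Proof.
move=> bc mx x0; rewrite /slab_potential (@eq_Rintegral _ _ _ _ _ (fun=> 0)).
  by rewrite Rintegral_cst ?mul0r.
move=> s _; rewrite sq_pairC; apply: aeq0_integ => //.
exact: bdd_meas (slab_bdd s bc).
Qed.

Lemma slab_potential_chain chi : bdd Om chi ->
  slab_potential chi chi = tau * (I (fun x => f (p0 x + chi x)) - I (fun x => f (p0 x))).
Proof.
move=> bc; have b1 : bdd Om (fun x => tau^-1 * chi x) by exact: bddZ.
have b0 : bdd Om (fun x => p0 x + (- (a / tau)) * chi x) by apply: bddD => //; exact: bddZ.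
have ab : a < a + tau by rewrite ltrDl.
have t0 : tau != 0 by rewrite gt_eqF.
have := chain_rule_slab ab C1f C1f' b0 b1.
rewrite (@intO_eq _ _ Om (fun x => f (_ + _ + (a + tau) * _)) (fun x => f (p0 x + chi x))); last first.
  by move=> x _; congr f; field.
rewrite (@intO_eq _ _ Om (fun x => f (_ + _ + a * _)) (fun x => f (p0 x))); last first.
  by move=> x _; congr f; field.
move=> <-; rewrite -RintegralZl //; last first.
  apply: continuous_compact_integrable; first exact: segment_compact.
  apply: continuous_subspaceT.
  exact: (continuous_potential_deriv C1f' b0 b1 (bdd_integ b1) (bdd_meas b1)).
apply: eq_Rintegral => s _; rewrite -intOZ.
  apply: intO_eq => x _; rewrite (_ : p0 x + - (a / tau) * chi x + s * (tau^-1 * chi x) = p0 x + (s - a) / tau * chi x).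
    by field.
  by field.
apply: bdd_integ; apply: bddM => //; apply: C1_affine_bdd => //; exact: C1_continuous.
Qed.

Lemma slab_potential_continuous n (e : 'I_n -> fn) xi : (forall j, bdd Om (e j)) -> bdd Om xi ->
  continuous (fun x : 'rV[R]_n => slab_potential (\sum_j x ord0 j *: e j) xi).
Proof.
move=> be bx.
have bsum (x : 'rV[R]_n) : bdd Om (\sum_j x ord0 j *: e j).
  have := bdd_sum (index_enum _) (fun j => bddZ (x ord0 j) (be j)).
  by rewrite (_ : (fun y => _) = \sum_j x ord0 j *: e j) //; apply/funext => y; rewrite fct_sumE.
apply: (slab_param (H := fun (x : 'rV[R]_n) s y =>
   derive1 f (p0 y + (s - a) / tau * (\sum_j x ord0 j *: e j) y))).
- by rewrite lerDl ltW.
- by move=> x s; exact: slab_bdd.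
- by move=> x; exact: slab_ucont.
- set E := [set sx : R * 'rV[R]_d | _].
  have b01 : bounded_on_set E (fun sx : R * 'rV[R]_d => (sx.1 - a) / tau).
    exists 1 => -[s y] [/= /andP[s1 s2] _]; rewrite ger0_norm.
      by rewrite ler_pdivrMr // mul1r lerBlDl.
    by rewrite divr_ge0 ?subr_ge0 // ltW.
  have bsumE (x : 'rV[R]_n) : bounded_on_set E (fun sx => (\sum_j x ord0 j *: e j) sx.2).
    by have [_ [C bC]] := bsum x; exists C => -[s y] [_ Dy]; exact: bC.
  have bprod (x : 'rV[R]_n) : bounded_on_set E (fun sx => (sx.1 - a) / tau * (\sum_j x ord0 j *: e j) sx.2).
    have [C bC] := b01; have [C' bC'] := bsumE x; exists (C * C') => sx Ex.
    by rewrite normrM ler_pM ?bC ?bC'.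
  apply: ucont_comp => //.
    move=> x; have [_ [C bC]] := bp0; have [C' bC'] := bprod x; exists (C + C') => sx Ex.
    by apply: le_trans (ler_normD _ _) _; rewrite lerD ?bC' // bC //; case: Ex.
  apply: ucontD; first exact: ucont_cst.
  apply: (@ucontM _ _ _ E (fun=> fun sx : R * 'rV[R]_d => (sx.1 - a) / tau)) => //; first exact: ucont_cst.
  rewrite (_ : (fun x sx => _) = fun (x : 'rV[R]_n) (sx : R * 'rV[R]_d) => \sum_j x ord0 j * e j sx.2).
    apply: ucont_sum => j; apply: ucontZ; first exact: coord_continuous.
    by have [_ [C bC]] := be j; exists C => -[s y] [_ Dy]; exact: bC.
  by apply/funext => x; apply/funext => sx; rewrite fct_sumE.
- exact: bdd_integ.
- exact: bdd_meas bx.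
Qed.

End slab_average.

(** * Solvability of one time step *)

Section step.
Context {R : realType} {d : nat} (Om : cube R d).
Local Notation D := (cube_set Om).
Local Notation fn := ('rV[R]_d -> R).
Local Notation vf := ('I_d -> 'rV[R]_d -> R).
Local Notation I := (intO Om).
Local Notation ip := (ip Om).
Local Notation gradform := (gradform Om).
Local Notation transport := (transport Om).
Local Notation convection := (convection Om).
Local Notation viscosity := (viscosity Om).
Variables (V Q : fn -> Prop).
Hypotheses (sV : submodule V) (fV : fin_span V).
Hypotheses (VH1 : forall v, V v -> H1 Om v) (Vb : forall v, V v -> bdd Om v).
Hypotheses (sQ : submodule Q) (fQ : fin_span Q) (Qsq : forall q, Q q -> sq Om q).
Variables (gamma b1 : R) (b eta f : R -> R).
Hypotheses (gamma0 : 0 < gamma) (b10 : 0 < b1).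
Hypotheses (C1b : C1 b) (C1eta : C1 eta) (C1f : C1 f) (C1f' : C1 (derive1 f)).
Hypotheses (b_ge : forall s, b1 <= b s) (eta_ge0 : forall s, 0 <= eta s).
Hypothesis f_ge0 : forall s, 0 <= f s.
Variables (a tau : R) (p0 : fn) (u0 : vf).
Hypotheses (tau0 : 0 < tau) (Vp0 : V p0) (Vu0 : forall i, V (u0 i)).

Local Notation Vd := (@componentwise R d d V).
Local Notation state := ('I_d.+2 -> 'rV[R]_d -> R).

Let Vsq v : V v -> sq Om v. Proof. by move/Vb; exact: bdd_sq. Qed.

Definition divfree (w : vf) := Vd w /\ forall q, Q q -> ip (divg Om w) q = 0.

(** The Dirichlet form is definite on the orthogonal complement of these functions,
    hence coercive there, the space being finite-dimensional. *)
Definition gradfree (v : fn) := V v /\ forall i, aeq Om (wderiv Om i v) (fun=> 0).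

Definition gradfree_orth (v : fn) := V v /\ forall k, gradfree k -> ip v k = 0.

Definition chi_of (s : state) : fn := s ord0.
Definition mu_of (s : state) : fn := s (lift ord0 ord0).
Definition vel_of (s : state) : vf := fun i => s (lift ord0 (lift ord0 i)).
(** The mean of phi over the slab, since phi is affine in time. *)
Definition mid (s : state) : fn := 2^-1 *: chi_of s + p0.

Definition admissible (s : state) :=
  [/\ gradfree_orth (chi_of s), gradfree_orth (mu_of s) & divfree (vel_of s)].

Definition mass_residual (s : state) (psi : fn) :=
  ip (chi_of s) psi - tau * transport (mid s) (vel_of s) psi
  + tau * gradform (fun x => b (mid s x)) (mu_of s) psi.

Definition potential_residual (s : state) (xi : fn) :=
  ip (mu_of s) xi - gamma * gradform (fun=> 1) (mid s) xi
  - tau^-1 * slab_potential Om f a tau p0 (chi_of s) xi.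

(** The unknown velocity is the mean one over the slab, so its increment is
    2 (vel - u0). *)
Definition momentum_residual (s : state) (v : vf) :=
  2 * (\sum_i ip (vel_of s i - u0 i) (v i))
  + tau * convection (vel_of s) (vel_of s) v
  + tau * viscosity (fun x => eta (mid s x)) (vel_of s) v
  + tau * transport (mid s) v (mu_of s).

(** The potential equation is tested with the increment and the mass equation with
    the chemical potential, with opposite signs: then the residual of a state at
    itself is its energy balance. *)
Definition residual (s t : state) :=
  mass_residual s (mu_of t) - potential_residual s (chi_of t)
  + momentum_residual s (vel_of t).

(** This controls the state modulo null functions, because chi and mu are sought
    orthogonal to the functions with null gradient. *)
Definition state_form (s t : state) :=
  gradform (fun=> 1) (chi_of s) (chi_of t) + gradform (fun=> 1) (mu_of s) (mu_of t)
  + \sum_i ip (vel_of s i) (vel_of t i).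

Let b1' : bdd Om (fun=> 1) := bdd_cst Om 1.
Let cV : forall k, submodule (@componentwise R d k V) := fun k => componentwise_submodule k sV.

Let ip_lin v : V v -> linear_on V (ip v).
Proof. by move=> Vv; apply: (ip_lin_r Vb); exact: Vsq. Qed.

Lemma gradfree_submodule : submodule gradfree.
Proof.
split; first by split; [exact: sV.1|move=> i; exact: (wderiv_cst Om i 0)].
move=> c v w [Vv v0] [Vw w0]; split; first by apply sV.2.
move=> i; apply: aeq_trans (wderiv_lin i c (VH1 Vv) (VH1 Vw)) _.
have := aeq_op2 (fun x y => c * x + y) (v0 i) (w0 i); move/aeq_trans; apply.
by apply: aeq_eq => x _; rewrite mulr0 addr0.
Qed.

Lemma gradfree_orth_submodule : submodule gradfree_orth.
Proof.
split; first by split; [exact: sV.1|move=> k [Vk _]; exact: (linear_on0 sV (ip_lin_l Vb (Vsq Vk)))].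
move=> c v w [Vv v0] [Vw w0]; split; first by apply sV.2.
by move=> k Kk; rewrite (ip_lin_l Vb (Vsq Kk.1)) // v0 // w0 // mulr0 addr0.
Qed.

Lemma divg_lin q : Q q -> linear_on Vd (fun w => ip (divg Om w) q).
Proof.
move=> Qq c v w Vv Vw; have key x : Vd x -> ip (divg Om x) q = \sum_i wpair Om i q (x i).
  by move=> Vx; rewrite ip_divgC ip_divg //; [exact: Qsq|move=> i; exact: VH1].
rewrite !key //; last by apply (cV d).2.
have ll := @component_lin R d V (fun i => wpair Om i q).
apply: (ll _ c v w) => // i; apply: (linear_on_subset VH1).
exact: wpair_lin_r (Qsq Qq).
Qed.

Lemma divfree_submodule : submodule divfree.
Proof.
split; first by split; [exact: (cV d).1|move=> q Qq; exact: (linear_on0 (cV d) (divg_lin Qq))].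
move=> c v w [Vv v0] [Vw w0]; split; first by apply (cV d).2.
by move=> q Qq; rewrite (divg_lin Qq) // v0 // w0 // mulr0 addr0.
Qed.

Let chi_ofD c s t : chi_of (c *: s + t) = c *: chi_of s + chi_of t. Proof. by []. Qed.
Let mu_ofD c s t : mu_of (c *: s + t) = c *: mu_of s + mu_of t. Proof. by []. Qed.
Let vel_ofD c s t : vel_of (c *: s + t) = c *: vel_of s + vel_of t. Proof. by []. Qed.

Lemma admissible_submodule : submodule admissible.
Proof.
have [K0 KD] := gradfree_orth_submodule; have [Z0 ZD] := divfree_submodule.
split; first by split.
move=> c s t [s1 s2 s3] [t1 t2 t3]; rewrite /admissible chi_ofD mu_ofD vel_ofD.
by split; [exact: KD|exact: KD|exact: ZD].
Qed.

Let admV s : admissible s -> componentwise V s.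
Proof.
move=> [[V1 _] [V2 _] [V3 _]] i; case: (unliftP ord0 i) => [j|] -> //.
by case: (unliftP ord0 j) => [k|] -> //; exact: V3.
Qed.

Lemma admissible_fin_span : fin_span admissible.
Proof.
apply: (fin_span_sub (cV _) (componentwise_fin_span _ sV fV) admissible_submodule).
exact: admV.
Qed.

Let Vmid s : admissible s -> V (mid s).
Proof. by move=> [[V1 _] _ _]; exact: (sV.2 2^-1 _ _ V1 Vp0). Qed.

Let bmid s g : continuous g -> admissible s -> bdd Om (fun x => g (mid s x)).
Proof. by move=> cg As; apply: bdd_comp => //; exact/Vb/Vmid. Qed.

Let Vvelu s i : admissible s -> V (vel_of s i - u0 i).
Proof. by move=> [_ _ [Vs _]]; apply: submoduleB. Qed.

Let mass_lin s : admissible s -> linear_on V (mass_residual s).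
Proof.
move=> As; have [[V1 _] [V2 _] [V3 _]] := As.
apply: linear_on_add; last first.
  by apply: linear_on_scale; apply: gradform_lin => //; apply: bmid => //; exact: C1_continuous.
apply: linear_on_sub; first exact: ip_lin.
apply: linear_on_scale; apply: transport_lin => //; first exact/Vb/Vmid.
by move=> i; exact: Vsq.
Qed.

Let potential_lin s : admissible s -> linear_on V (potential_residual s).
Proof.
move=> As; have [[V1 _] [V2 _] _] := As.
apply: linear_on_sub; last first.
  by apply: linear_on_scale; apply: slab_potential_lin => //; exact: Vb.
apply: linear_on_sub; first exact: ip_lin.
by apply: linear_on_scale; apply: gradform_lin => //; exact: Vmid.
Qed.

Let momentum_lin s : admissible s -> linear_on Vd (momentum_residual s).
Proof.
move=> As; have [_ [V2 _] [V3 _]] := As.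
apply: linear_on_add; last first.
  by apply: linear_on_scale; apply: transport_lin_field => //; [exact/Vb/Vmid|exact: VH1].
apply: linear_on_add; last first.
  by apply: linear_on_scale; apply: viscosity_lin => //; apply: bmid => //; exact: C1_continuous.
apply: linear_on_add; last by apply: linear_on_scale; exact: convection_lin.
apply: linear_on_scale.
apply: (component_lin (l := fun i => ip (vel_of s i - u0 i))) => i.
exact/ip_lin/Vvelu.
Qed.

Lemma residual_lin s : admissible s -> linear_on admissible (residual s).
Proof.
move=> As c t t' [[V1 _] [V2 _] [V3 _]] [[V1' _] [V2' _] [V3' _]].
have key (x y z x' y' z' : R) : c * x + x' - (c * y + y') + (c * z + z') = c * (x - y + z) + (x' - y' + z') by ring.
rewrite /residual -key.
have -> : mass_residual s (mu_of (c *: t + t')) = c * mass_residual s (mu_of t) + mass_residual s (mu_of t').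
  by rewrite mu_ofD; exact: (mass_lin As c V2 V2').
have -> : potential_residual s (chi_of (c *: t + t')) = c * potential_residual s (chi_of t) + potential_residual s (chi_of t').
  by rewrite chi_ofD; exact: (potential_lin As c V1 V1').
have -> : momentum_residual s (vel_of (c *: t + t')) = c * momentum_residual s (vel_of t) + momentum_residual s (vel_of t').
  by rewrite vel_ofD; exact: (momentum_lin As c V3 V3').
reflexivity.
Qed.

Let orth_null v : gradfree_orth v -> gradform (fun=> 1) v v = 0 ->
  aeq Om v (fun=> 0).
Proof.
move=> [Vv orth] g0; apply: ip_null; first exact: Vsq.
by apply: orth; split => //; apply: gradform_null => //; exact: VH1.
Qed.

Let wderiv_null' v i : V v -> aeq Om v (fun=> 0) -> aeq Om (wderiv Om i v) (fun=> 0).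
Proof. by move=> Vv; apply: wderiv_null; exact: VH1. Qed.

Let ip_null' u v : V u -> V v -> aeq Om v (fun=> 0) -> ip u v = 0.
Proof.
move=> Vu Vv v0; rewrite ipC; apply: ip_null_l => //; exact: sq_meas (Vsq _).
Qed.

Let transport_null phi w psi : bdd Om phi -> (forall i, sq Om (w i)) -> V psi ->
  (forall i, aeq Om (wderiv Om i psi) (fun=> 0)) -> transport phi w psi = 0.
Proof.
move=> bp sw Vp p00; rewrite /transport big1 // => i _.
by apply: wpair_null => //; [exact: sq_bddM|exact: VH1].
Qed.

Let wpair_null_field i (h : fn) v psi : bdd Om h -> V v -> V psi -> aeq Om v (fun=> 0) ->
  wpair Om i (fun x => h x * v x) psi = 0.
Proof.
move=> bh Vv Vp v0; apply: aeq0_integ.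
- by apply: measM; [exact: bdd_meas bh|exact: bdd_meas (Vb Vv)].
- exact: sq_meas (wderiv_sq i (VH1 Vp)).
apply: aeq_trans (aeq_op2 *%R (aeq_refl Om h) v0) _.
by apply: aeq_eq => x _; rewrite mulr0.
Qed.

(** Null vectors of the energy form are almost everywhere 0, so the residual does not
    see them as tests. *)
Lemma residual_null s r : admissible s -> admissible r -> state_form r r = 0 -> residual s r = 0.
Proof.
move=> As Ar; have [[V1 _] [V2 _] [V3 _]] := As; move: (Ar) => [k1 k2 [W3 _]].
have key (x y z : R) : 0 <= x -> 0 <= y -> 0 <= z -> x + y + z = 0 -> [/\ x = 0, y = 0 & z = 0].
  by move=> *; split; lra.
have p3 : 0 <= \sum_i ip (vel_of r i) (vel_of r i) by apply: sumr_ge0 => i _; exact: ip_ge0.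
move=> /key[||//|g1 g2 /eqP]; [exact: gradform_ge0|exact: gradform_ge0|].
rewrite psumr_eq0; last by move=> i _; exact: ip_ge0.
move=> /allP g3; have n1 := orth_null k1 g1; have n2 := orth_null k2 g2.
have n3 i : aeq Om (vel_of r i) (fun=> 0).
  by apply: ip_null; [exact: Vsq|exact/eqP/g3/mem_index_enum].
have [W1 _] := k1; have [W2 _] := k2.
have m := Vmid As.
have e1 : mass_residual s (mu_of r) = 0.
  rewrite /mass_residual ip_null' // transport_null //; last by move=> i; exact: wderiv_null'.
  - rewrite gradform_null_r ?mulr0 ?subr0 ?addr0 //.
    + by apply: bmid => //; exact: C1_continuous.
    + exact: VH1.
    + exact: VH1.
    + by move=> i; exact: wderiv_null'.
  - exact: Vb.
  - by move=> i; exact: Vsq.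
have e2 : potential_residual s (chi_of r) = 0.
  rewrite /potential_residual ip_null' // gradform_null_r //; last by move=> i; exact: wderiv_null'.
  - rewrite slab_potential_null ?mulr0 ?subr0 //; first exact: Vb.
    + exact: Vb.
    + exact: bdd_meas (Vb W1).
  - exact: VH1.
  - exact: VH1.
have e3 : momentum_residual s (vel_of r) = 0.
  rewrite /momentum_residual big1 => [|i _]; last by apply: ip_null' => //; exact: Vvelu.
  rewrite /convection big1 => [|i _]; last first.
    rewrite big1 // => j _; rewrite wpair_null_field //; last exact: Vb.
    rewrite wpair_null ?subr0 //; last by exact: wderiv_null'.
    - by apply: sq_bddM; [exact: Vb|exact: Vsq].
    - exact: VH1.
  rewrite /viscosity big1 => [|i _]; last first.
    apply: gradform_null_r; [|exact: VH1|exact: VH1|by move=> j; exact: wderiv_null'].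
    by apply: bmid => //; exact: C1_continuous.
  rewrite /transport big1 => [|i _]; last by apply: wpair_null_field => //; exact: Vb.
  by rewrite !mulr0 !addr0.
by rewrite /residual e1 e2 e3 subr0 addr0.
Qed.

Let contD (T : topologicalType) (g h : T -> R) :
  continuous g -> continuous h -> continuous (fun x => g x + h x).
Proof. by move=> cg ch x; exact: (cvgD (cg x) (ch x)). Qed.

Let contZ (T : topologicalType) c (g : T -> R) : continuous g -> continuous (fun x => c * g x).
Proof. by move=> cg x; exact: (cvgM (cvg_cst c) (cg x)). Qed.

Let contB (T : topologicalType) (g h : T -> R) :
  continuous g -> continuous h -> continuous (fun x => g x - h x).
Proof. by move=> cg ch x; exact: (cvgB (cg x) (ch x)). Qed.

Lemma convection_lin1 (u v : vf) : Vd u -> Vd v -> linear_on Vd (fun w => convection w u v).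
Proof.
move=> Vu Vv; apply: (@linear_on_scale _ _ _ 2^-1 (fun w : vf => \sum_i \sum_j
  (wpair Om j (fun x => w j x * v i x) (u i) - wpair Om j (fun x => w j x * u i x) (v i)))).
have key j (h psi : fn) : V h -> V psi ->
    linear_on Vd (fun w => wpair Om j (fun x => w j x * h x) psi).
  move=> Vh Vp r w w' Vw Vw'.
  have := wpair_mul_lin Vb j (Vb Vh) (VH1 Vp) r (Vw j) (Vw' j).
  have e (w'' : fn) : wpair Om j (fun x => h x * w'' x) psi = wpair Om j (fun x => w'' x * h x) psi.
    by congr (wpair _ _ _ _); apply/funext => x; rewrite mulrC.
  by rewrite !e.
apply: linear_on_bigsum => i; apply: linear_on_bigsum => j.
by apply: linear_on_sub; apply: key.
Qed.

Lemma convection_lin2 (u v : vf) : Vd u -> Vd v -> linear_on Vd (fun w => convection u w v).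
Proof.
move=> Vu Vv; apply: (@linear_on_scale _ _ _ 2^-1 (fun w : vf => \sum_i \sum_j
  (wpair Om j (fun x => u j x * v i x) (w i) - wpair Om j (fun x => u j x * w i x) (v i)))).
apply: linear_on_bigsum => i; apply: linear_on_bigsum => j.
apply: linear_on_sub => r w w' Vw Vw'; last first.
  exact: (wpair_mul_lin Vb j (Vb (Vu j)) (VH1 (Vv i)) r (Vw i) (Vw' i)).
have s : sq Om (fun x => u j x * v i x) by apply: sq_bddM (Vb (Vu j)) (Vsq (Vv i)).
exact: (wpair_lin_r j s r (VH1 (Vw i)) (VH1 (Vw' i))).
Qed.

Let viscosity_linl h v : bdd Om h -> Vd v -> linear_on Vd (fun w => viscosity h w v).
Proof.
move=> bh Vv r w w' Vw Vw'; have e u : viscosity h u v = viscosity h v u.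
  by apply: eq_bigr => i _; rewrite gradformC.
by rewrite !e (viscosity_lin VH1 bh Vv).
Qed.

Let ipl psi : V psi -> linear_on V (fun v => ip v psi).
Proof. by move=> Vp; apply: (ip_lin_l Vb); exact: Vsq. Qed.

Let gradforml h psi : bdd Om h -> V psi -> linear_on V (fun v => gradform h v psi).
Proof. by move=> bh Vp; apply: (linear_on_subset VH1); apply: gradform_lin_l => //; exact: VH1. Qed.

Section continuity.
Variables (n : nat) (E : 'I_n -> state).
Hypothesis AE : forall i, admissible (E i).
Local Notation comb x := (\sum_i x ord0 i *: E i).

Let Acomb (x : 'rV[R]_n) : admissible (comb x).
Proof. exact: submodule_sum admissible_submodule AE. Qed.

Let mid_ucont : ucont D (fun x : 'rV[R]_n => mid (comb x)).
Proof.
have h := @combination_ucont _ _ Om V sV Vb n (fun j => chi_of (E j)) 2^-1 p0.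
rewrite (_ : (fun _ => _) = fun x : 'rV[R]_n => 2^-1 *: (\sum_j x ord0 j *: chi_of (E j)) + p0).
  by apply: h => // j; have [[]] := AE j.
by apply/funext => x; rewrite /mid /chi_of sum_component.
Qed.

Let mid_bdd (x : 'rV[R]_n) : bdd Om (mid (comb x)). Proof. exact/Vb/Vmid. Qed.

Let comp_mid_ucont g : C1 g -> ucont D (fun (x : 'rV[R]_n) y => g (mid (comb x) y)).
Proof. by move=> Cg; apply: ucont_comp => // x; exact: bdd_set. Qed.

Let comp_mid_bdd g : C1 g -> forall x : 'rV[R]_n, bdd Om (fun y => g (mid (comb x) y)).
Proof. by move=> Cg x; apply: bmid => //; exact: C1_continuous. Qed.

Let cont_lin (l : state -> R) : linear_on admissible l ->
  continuous (fun x : 'rV[R]_n => l (comb x)).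
Proof. exact: linear_on_continuous admissible_submodule AE. Qed.

Let cont_lin2 (l : 'rV[R]_n -> state -> R) : (forall x, linear_on admissible (l x)) ->
  (forall s, admissible s -> continuous (l^~ s)) ->
  continuous (fun x : 'rV[R]_n => l x (comb x)).
Proof. exact: linear_on_continuous2 admissible_submodule AE. Qed.

Let on_chi l : linear_on V l -> linear_on admissible (fun s => l (chi_of s)).
Proof. by move=> ll c s t [[V1 _] _ _] [[V2 _] _ _]; rewrite chi_ofD; exact: ll. Qed.
Let on_mu l : linear_on V l -> linear_on admissible (fun s => l (mu_of s)).
Proof. by move=> ll c s t [_ [V1 _] _] [_ [V2 _] _]; rewrite mu_ofD; exact: ll. Qed.
Let on_vel l : linear_on Vd l -> linear_on admissible (fun s => l (vel_of s)).
Proof. by move=> ll c s t [_ _ [V1 _]] [_ _ [V2 _]]; rewrite vel_ofD; exact: ll. Qed.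

Let transport_mid_continuous w psi : Vd w -> V psi ->
  continuous (fun x : 'rV[R]_n => transport (mid (comb x)) w psi).
Proof.
move=> Vw Vp; apply: continuous_big => [|i _]; first exact: add_continuous.
apply: (wpair_continuous (H := fun (x : 'rV[R]_n) y => mid (comb x) y * w i y)).
- by move=> x; apply: bddM => //; exact: Vb.
- apply: (ucontM (G := fun=> w i)) => //.
  + by move=> x; exact: bdd_set.
  + by move=> x; exact/bdd_set/Vb.
  + exact: ucont_cst.
- exact: VH1.
Qed.

Let mass_continuous psi : V psi ->
  continuous (fun x : 'rV[R]_n => mass_residual (comb x) psi).
Proof.
move=> Vp; apply: contD; first apply: contB.
- exact: (cont_lin (on_chi (ipl Vp))).
- apply: contZ; apply: (cont_lin2 (l := fun x s => transport (mid (comb x)) (vel_of s) psi)).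
    by move=> x; apply: (on_vel (transport_lin_field _ _ _)) => //; exact: VH1.
  by move=> s [_ _ [Vs _]]; exact: transport_mid_continuous.
- apply: contZ.
  apply: (cont_lin2 (l := fun x s => gradform (fun y => b (mid (comb x) y)) (mu_of s) psi)).
    by move=> x; apply: (on_mu (gradforml _ _)) => //; exact: comp_mid_bdd.
  move=> s [_ [Vs _] _]; apply: gradform_continuous; [exact: comp_mid_bdd|exact: comp_mid_ucont|exact: VH1|exact: VH1].
Qed.

Let potential_continuous xi : V xi ->
  continuous (fun x : 'rV[R]_n => potential_residual (comb x) xi).
Proof.
move=> Vx; apply: contB; first apply: contB.
- exact: (cont_lin (on_mu (ipl Vx))).
- apply: contZ; rewrite (_ : (fun _ => _) = fun x : 'rV[R]_n =>
    2^-1 * gradform (fun=> 1) (chi_of (comb x)) xi + gradform (fun=> 1) p0 xi).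
    apply: contD; last exact: cst_continuous.
    by apply: contZ; apply: (cont_lin (on_chi (gradforml b1' Vx))).
  apply/funext => x; have [[Vc _] _ _] := Acomb x.
  exact: (gradforml b1' Vx).
- apply: contZ; rewrite (_ : (fun _ => _) = fun x : 'rV[R]_n =>
    slab_potential Om f a tau p0 (\sum_j x ord0 j *: chi_of (E j)) xi).
    apply: slab_potential_continuous => //; [exact: Vb| |exact: Vb].
    by move=> j; have [[/Vb]] := AE j.
  by apply/funext => x; rewrite /chi_of sum_component.
Qed.

Let momentum_continuous v : Vd v ->
  continuous (fun x : 'rV[R]_n => momentum_residual (comb x) v).
Proof.
move=> Vv; apply: contD; first (apply: contD; first apply: contD).
- apply: contZ; rewrite (_ : (fun _ => _) = fun x : 'rV[R]_n =>
    \sum_i ip (vel_of (comb x) i) (v i) - \sum_i ip (u0 i) (v i)).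
    apply: contB; last exact: cst_continuous.
    apply: (cont_lin (l := fun s => \sum_i ip (vel_of s i) (v i))).
    apply: (on_vel (l := fun w : vf => \sum_i ip (w i) (v i))).
    by apply: (component_lin (l := fun i w => ip w (v i))) => i; exact: ipl.
  apply/funext => x; rewrite -sumrB; apply: eq_bigr => i _.
  have [_ _ [Vw _]] := Acomb x.
  exact: (linear_onB (ipl (Vv i)) (Vw i) (Vu0 i)).
- apply: contZ; apply: (cont_lin2 (l := fun x s => convection (vel_of s) (vel_of (comb x)) v)).
    by move=> x; have [_ _ [Vw _]] := Acomb x; exact: (on_vel (convection_lin1 _ _)).
  move=> s [_ _ [Vs _]]; apply: (cont_lin (l := fun t => convection (vel_of s) (vel_of t) v)).
  exact: (on_vel (convection_lin2 _ _)).
- apply: contZ.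
  apply: (cont_lin2 (l := fun x s => viscosity (fun y => eta (mid (comb x) y)) (vel_of s) v)).
    by move=> x; apply: (on_vel (viscosity_linl _ _)) => //; exact: comp_mid_bdd.
  move=> s [_ _ [Vs _]]; apply: continuous_big => [|i _]; first exact: add_continuous.
  by apply: gradform_continuous; [exact: comp_mid_bdd|exact: comp_mid_ucont|exact: VH1|exact: VH1].
- apply: contZ; apply: (cont_lin2 (l := fun x s => transport (mid (comb x)) v (mu_of s))).
    by move=> x; apply: (on_mu (transport_lin _ _ _)) => // i; exact: Vsq.
  by move=> s [_ [Vs _] _]; exact: transport_mid_continuous.
Qed.

Lemma residual_continuous t : admissible t ->
  continuous (fun x : 'rV[R]_n => residual (comb x) t).
Proof.
move=> [[V1 _] [V2 _] [V3 _]]; apply: contD; first apply: contB.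
- exact: mass_continuous.
- exact: potential_continuous.
- exact: momentum_continuous.
Qed.

End continuity.

Let state_formC s t : state_form s t = state_form t s.
Proof.
rewrite /state_form gradformC [gradform _ (mu_of s) _]gradformC; congr (_ + _).
by apply: eq_bigr => i _; rewrite ipC.
Qed.

Let state_form_lin s : admissible s -> linear_on admissible (state_form s).
Proof.
move=> [[V1 _] [V2 _] [V3 _]] c t t' [[T1 _] [T2 _] [T3 _]] [[U1 _] [U2 _] [U3 _]].
have h1 := gradform_lin VH1 b1' V1 c T1 U1.
have h2 := gradform_lin VH1 b1' V2 c T2 U2.
have h3 := component_lin (l := fun i => ip (vel_of s i)) (fun i => ip_lin (V3 i)) c T3 U3.
have key (x y z x' y' z' : R) : c * x + x' + (c * y + y') + (c * z + z') = c * (x + y + z) + (x' + y' + z') by ring.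
by rewrite /state_form chi_ofD mu_ofD vel_ofD -key h1 h2; congr (_ + _); exact: h3.
Qed.

Let state_form_ge0 s : 0 <= state_form s s.
Proof.
have p3 : 0 <= \sum_i ip (vel_of s i) (vel_of s i) by apply: sumr_ge0 => i _; exact: ip_ge0.
by apply: addr_ge0 => //; apply: addr_ge0; exact: gradform_ge0.
Qed.

Let kin (u v : vf) := \sum_i ip (u i) (v i).

Let residual_diag s : admissible s ->
  residual s s = tau * gradform (fun x => b (mid s x)) (mu_of s) (mu_of s)
   + tau * viscosity (fun x => eta (mid s x)) (vel_of s) (vel_of s)
   + gamma * (2^-1 * gradform (fun=> 1) (chi_of s) (chi_of s) + gradform (fun=> 1) p0 (chi_of s))
   + (I (fun x => f (p0 x + chi_of s x)) - I (fun x => f (p0 x)))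
   + 2 * (kin (vel_of s) (vel_of s) - kin u0 (vel_of s)).
Proof.
move=> [[V1 _] [V2 _] [V3 _]].
rewrite /residual /mass_residual /potential_residual /momentum_residual convection_alt mulr0.
rewrite (slab_potential_chain a C1f C1f' tau0 (Vb Vp0) (Vb V1)) mulKf ?gt_eqF //.
rewrite (gradforml b1' V1 2^-1 V1 Vp0).
have -> : \sum_i ip (vel_of s i - u0 i) (vel_of s i) = kin (vel_of s) (vel_of s) - kin u0 (vel_of s).
  by rewrite /kin -sumrB; apply: eq_bigr => i _; rewrite (linear_onB (ipl (V3 i)) (V3 i) (Vu0 i)).
rewrite (ipC Om (mu_of s)).
move: (ip _ _) (transport _ _ _) (gradform _ _ _) (viscosity _ _ _) => x1 x2 x3 x4.
move: (gradform _ _ _) (gradform _ _ _) (I _) (I _) (kin _ _) (kin _ _) => *; ring.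
Qed.

(** The Dirichlet form is nonnegative at the mean of phi, and the kinetic energy at
    vel - u0; this absorbs the mixed terms with the data. *)
Let coercive_bound s : admissible s ->
  gamma / 4 * gradform (fun=> 1) (chi_of s) (chi_of s) + tau * b1 * gradform (fun=> 1) (mu_of s) (mu_of s)
   + kin (vel_of s) (vel_of s)
   - (gamma * gradform (fun=> 1) p0 p0 + I (fun x => f (p0 x)) + kin u0 u0) <= residual s s.
Proof.
have mid_key (x y z : R) : 2^-1 * (2^-1 * x + y) + (2^-1 * y + z) = 4^-1 * x + y + z by field.
have key (x1 x2 x3 x4 x5 x6 x7 x8 k1 k2 k3 : R) : b1 * x2 <= x1 -> 0 <= x6 -> 0 <= x7 ->
    0 <= 4^-1 * x3 + x4 + x5 -> 0 <= k1 - 2 * k2 + k3 ->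
    gamma / 4 * x3 + tau * b1 * x2 + k1 - (gamma * x5 + x8 + k3)
      <= tau * x1 + tau * x6 + gamma * (2^-1 * x3 + x4) + (x7 - x8) + 2 * (k1 - k2).
  move=> h1 /(mulr_ge0 (ltW tau0)) h2 h3 /(mulr_ge0 (ltW gamma0)) h4 h5.
  by have := ler_wpM2l (ltW tau0) h1; rewrite mulrA; lra.
move=> As; rewrite residual_diag //; have [[V1 _] [V2 _] [V3 _]] := As.
have h1 := gradform_le (bmid (C1_continuous C1b) As) (VH1 V2) (fun x _ => b_ge (mid s x)).
have h2 : 0 <= viscosity (fun x => eta (mid s x)) (vel_of s) (vel_of s).
  by apply: sumr_ge0 => i _; apply: gradform_ge0.
have h3 : 0 <= I (fun x => f (p0 x + chi_of s x)) by apply: intO_ge0.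
have h4 : 0 <= gradform (fun=> 1) (mid s) (mid s) by apply: gradform_ge0.
have h5 : 0 <= kin (vel_of s - u0) (vel_of s - u0) by apply: sumr_ge0 => i _; exact: ip_ge0.
have e5 : kin (vel_of s - u0) (vel_of s - u0) =
    kin (vel_of s) (vel_of s) - 2 * kin u0 (vel_of s) + kin u0 u0.
  rewrite /kin mulr_sumr -sumrB -big_split /=; apply: eq_bigr => i _.
  have Vd' := submoduleB sV (V3 i) (Vu0 i).
  rewrite (linear_onB (ipl Vd') (V3 i) (Vu0 i)) (linear_onB (ip_lin (V3 i)) (V3 i) (Vu0 i)).
  rewrite (linear_onB (ip_lin (Vu0 i)) (V3 i) (Vu0 i)) (ipC Om (vel_of s i) (u0 i)).
  move: (ip _ _) (ip _ _) (ip _ _) => *; ring.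
have e4 : gradform (fun=> 1) (mid s) (mid s) = 4^-1 * gradform (fun=> 1) (chi_of s) (chi_of s)
    + gradform (fun=> 1) p0 (chi_of s) + gradform (fun=> 1) p0 p0.
  rewrite {1}/mid (gradforml b1' (Vmid As) 2^-1 V1 Vp0).
  rewrite (gradform_lin VH1 b1' V1 2^-1 V1 Vp0) (gradform_lin VH1 b1' Vp0 2^-1 V1 Vp0).
  rewrite (gradformC Om _ (chi_of s) p0).
  exact: mid_key.
by apply: key => //; [rewrite -e4|rewrite -e5].
Qed.

(** The transport terms and the pairing of chi with mu cancel on the diagonal, and
    convection vanishes; what is left is bounded below by a multiple of the energy
    form minus the energy of the data. *)
Lemma residual_zero : exists2 s, admissible s & forall t, admissible t -> residual s t = 0.
Proof.
pose C0 := gamma * gradform (fun=> 1) p0 p0 + I (fun x => f (p0 x)) + kin u0 u0.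
pose c := Num.min (gamma / 4) (Num.min (tau * b1) 1).
have c0 : 0 < c by rewrite !lt_min ltr01 andbT divr_gt0 ?mulr_gt0.
have [c1 c2 c3] : [/\ c <= gamma / 4, c <= tau * b1 & c <= 1].
  by rewrite /c; split; rewrite !ge_min ?lexx ?orbT.
have key (K x y z : R) : 0 <= x -> 0 <= y -> 0 <= z -> K + 1 <= (x + y + z) * c ->
    0 < gamma / 4 * x + tau * b1 * y + z - K.
  move=> x0 y0 z0; have := ler_wpM2r x0 c1; have := ler_wpM2r y0 c2; have := ler_wpM2r z0 c3; lra.
apply: (galerkin (q := state_form) admissible_submodule admissible_fin_span _ _ _ (rho := (C0 + 1) / c)).
- exact: state_form_lin.
- by move=> s t _ _; exact: state_formC.
- by move=> s _; exact: state_form_ge0.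
- exact: residual_lin.
- exact: residual_null.
- by move=> n E t AE At; exact: residual_continuous.
- move=> s As; rewrite ler_pdivrMr // => rho.
  apply: lt_le_trans (coercive_bound As); rewrite -/C0.
  have g1 : 0 <= gradform (fun=> 1) (chi_of s) (chi_of s) by exact: gradform_ge0.
  have g2 : 0 <= gradform (fun=> 1) (mu_of s) (mu_of s) by exact: gradform_ge0.
  have g3 : 0 <= kin (vel_of s) (vel_of s) by apply: sumr_ge0 => i _; exact: ip_ge0.
  exact: key.
Qed.

Let gradfree_part v : V v -> exists2 k, gradfree k & gradfree_orth (v - k).
Proof.
move=> Vv; have sK := gradfree_submodule.
have [||||k Kk kP] := riesz_on (q := ip) (l := ip v) sK
    (fin_span_sub sV fV sK (fun x (h : gradfree x) => h.1)).
- by move=> x [Vx _]; apply: (linear_on_subset _ (ip_lin Vx)) => y [].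
- by move=> x [Vx _]; apply: (linear_on_subset _ (ipl Vx)) => y [].
- by apply: (linear_on_subset _ (ip_lin Vv)) => y [].
- by move=> x [Vx _] x0; apply: ip_null' => //; apply: ip_null => //; exact: Vsq.
exists k => //; have [Vk _] := Kk; split; first exact: submoduleB.
by move=> x Kx; have [Vx _] := Kx; rewrite (linear_onB (ipl Vx) Vv Vk) kP // subrr.
Qed.

Let test (chi mu : fn) (w : vf) : state := fun i =>
  if unlift ord0 i is Some j then if unlift ord0 j is Some k then w k else mu else chi.

Let chi_test chi mu w : chi_of (test chi mu w) = chi.
Proof. by rewrite /chi_of /test unlift_none. Qed.
Let mu_test chi mu w : mu_of (test chi mu w) = mu.
Proof. by rewrite /mu_of /test liftK unlift_none. Qed.
Let vel_test chi mu w : vel_of (test chi mu w) = w.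
Proof. by apply/funext => i; rewrite /vel_of /test !liftK. Qed.

Let admissible_test chi mu w : gradfree_orth chi -> gradfree_orth mu -> divfree w ->
  admissible (test chi mu w).
Proof. by rewrite /admissible chi_test mu_test vel_test. Qed.

Let gradform_gradfree h v k : bdd Om h -> V v -> gradfree k -> gradform h v k = 0.
Proof. by move=> bh Vv [Vk k0]; apply: gradform_null_r => //; exact: VH1. Qed.

Let ssq : submodule (sq Om).
Proof. by split; [exact/bdd_sq/bdd_cst|move=> r g g' sg sg'; exact: sq_lin]. Qed.

Let pressure_lin (v : vf) : (forall i, H1 Om (v i)) ->
  linear_on (sq Om) (fun q => \sum_i wpair Om i q (v i)).
Proof. by move=> H1v; apply: linear_on_bigsum => i; exact: wpair_lin_l. Qed.

(** From the zero on the reduced spaces to the full equations. The mass equation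
    extends to all tests since chi is orthogonal to the functions with null
    gradient. The potential equation fails only against these, and is repaired by
    adding such a function to mu, which the other equations do not see. The
    pressure is the multiplier of the discrete divergence constraint. *)
Theorem step_solution : exists (chi mu : fn) (w : vf) (p : fn),
  let m := 2^-1 *: chi + p0 in
  [/\ V chi, V mu, divfree w, Q p &
   [/\ forall psi, V psi -> ip chi psi = tau * transport m w psi - tau * gradform (fun x => b (m x)) mu psi,
       forall xi, V xi -> ip mu xi = gamma * gradform (fun=> 1) m xi + tau^-1 * slab_potential Om f a tau p0 chi xi &
       forall v, Vd v -> 2 * (\sum_i ip (w i - u0 i) (v i)) =
         - (tau * convection w w v) - tau * viscosity (fun x => eta (m x)) w v
         + tau * ip p (divg Om v) - tau * transport m v mu]].
Proof.
have key (x y z t r : R) : x + y + z + t = r -> x = - y - z + r - t by lra.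
have key2 (x y z t : R) : x + (y - z - t) = 0 -> y + x = z + t by lra.
have [s As s0] := residual_zero; have [[V1 c1] [V2 c2] [V3 c3]] := As.
have [ob0 _] := gradfree_orth_submodule; have [Z0 _] := divfree_submodule.
have Vm := Vmid As; have bm g : C1 g -> bdd Om (fun x => g (mid s x)) by move=> Cg; exact: bmid (C1_continuous Cg) As.
have lmass := mass_lin As; have lpot := potential_lin As; have lmom := momentum_lin As.
have z1 := linear_on0 sV lmass; have z2 := linear_on0 sV lpot; have z3 := linear_on0 (cV d) lmom.
have sK := gradfree_submodule.
have E1 psi : V psi -> mass_residual s psi = 0.
  move=> Vp; have [k Kk Ok] := gradfree_part Vp; have [Vk k0] := Kk.
  have := s0 _ (admissible_test ob0 Ok Z0).
  rewrite /residual chi_test mu_test vel_test z2 z3 subr0 addr0 (linear_onB lmass Vp Vk).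
  move=> /subr0_eq ->.
  rewrite /mass_residual (c1 _ Kk).
  rewrite (gradform_gradfree (bm _ C1b) V2 Kk).
  rewrite transport_null //.
  - by rewrite !mulr0 subr0 addr0.
  - exact: Vb.
  - by move=> i; exact: Vsq.
have E2 xi : gradfree_orth xi -> potential_residual s xi = 0.
  move=> Ox; have := s0 _ (admissible_test Ox ob0 Z0).
  by rewrite /residual chi_test mu_test vel_test z1 z3 sub0r addr0 => /eqP; rewrite oppr_eq0 => /eqP.
have E3 v : divfree v -> momentum_residual s v = 0.
  move=> Zv; have := s0 _ (admissible_test ob0 ob0 Zv).
  by rewrite /residual chi_test mu_test vel_test z1 z2 subr0 add0r.
(* the part of mu invisible to the Dirichlet form, read off the potential equation *)
have [k Kk kP] : exists2 k, gradfree k & forall x, gradfree x -> ip k x = - potential_residual s x.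
  apply: (riesz_on (q := ip) (l := fun x => - potential_residual s x) sK
    (fin_span_sub sV fV sK (fun x (h : gradfree x) => h.1))).
  - by move=> x [Vx _]; apply: (linear_on_subset _ (ip_lin Vx)) => y [].
  - by move=> x [Vx _]; apply: (linear_on_subset _ (ipl Vx)) => y [].
  - by apply: linear_on_opp; apply: (linear_on_subset _ lpot) => y [].
  - move=> x Kx x0; have [Vx _] := Kx; have n0 := ip_null (Vsq Vx) x0.
    rewrite /potential_residual ip_null' // gradform_gradfree // slab_potential_null //.
    + by rewrite !mulr0 !subr0 oppr0.
    + exact: Vb.
    + exact: Vb.
    + exact: bdd_meas (Vb Vx).
have [Vk k0] := Kk.
have [np [e [Qe spanQ]]] := fQ.
have [y yP] : exists y : 'I_np -> R, forall v, Vd v ->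
    momentum_residual s v = \sum_j y j * ip (divg Om v) (e j).
  have ldiv j : linear_on Vd (fun v => ip (divg Om v) (e j)) by exact: divg_lin.
  apply: (functional_in_span (cV d) (componentwise_fin_span d sV fV) ldiv lmom).
  move=> v Vv v0; apply: E3; split; first exact: Vv.
  move=> q Qq; have [c ->] := spanQ q Qq.
  have H1v i : H1 Om (v i) by exact: VH1.
  have lq := pressure_lin H1v.
  rewrite ip_divgC ip_divg //; last by apply: (submodule_sum _ _ ssq) => j; exact/Qsq.
  rewrite (linear_on_sum _ _ ssq lq (fun j => Qsq (Qe j))) big1 // => j _.
  by rewrite -ip_divg //; [rewrite -ip_divgC v0 mulr0|exact: Qsq].
exists (chi_of s), (mu_of s + k), (vel_of s), (tau^-1 *: \sum_j y j *: e j).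
move=> m; have em : m = mid s by [].
clearbody m; rewrite {}em {m}; split.
- exact: V1.
- exact: submoduleD.
- by split.
- by apply: submoduleZ => //; apply: (submodule_sum _ _ sQ).
split.
- move=> psi Vp; have := E1 psi Vp.
  rewrite gradformC (linear_onD (gradform_lin VH1 (bm _ C1b) Vp) V2 Vk).
  rewrite (gradform_gradfree (bm _ C1b) Vp Kk) addr0 gradformC /mass_residual.
  move: (ip _ _) (_ * _) (_ * _) => *; lra.
- move=> xi Vx; have [k' Kk' Ok'] := gradfree_part Vx; have [Vk' _] := Kk'.
  have := E2 _ Ok'; rewrite (linear_onB lpot Vx Vk') => /subr0_eq e2.
  have eo : ip k (xi - k') = 0 by rewrite ipC; apply Ok'.2.
  move: eo; rewrite (linear_onB (ip_lin Vk) Vx Vk') (kP _ Kk') -e2 opprK.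
  rewrite (linear_onD (ipl Vx) V2 Vk) /potential_residual.
  exact: key2.
- move=> v Vv; have := yP v Vv; rewrite /momentum_residual.
  have bv : transport (mid s) v (mu_of s + k) = transport (mid s) v (mu_of s).
    have lt : linear_on V (transport (mid s) v) by apply: transport_lin => //; [exact: Vb|move=> i; exact: Vsq].
    by rewrite (linear_onD lt V2 Vk) [transport _ _ k]transport_null ?addr0 //; [exact: Vb|move=> i; exact: Vsq].
  have -> : tau * ip (tau^-1 *: \sum_j y j *: e j) (divg Om v) = \sum_j y j * ip (divg Om v) (e j).
    have H1v i : H1 Om (v i) by exact: VH1.
    have lq := pressure_lin H1v.
    have sS : sq Om (\sum_j y j *: e j) by apply: (submodule_sum _ _ ssq) => j; exact/Qsq.
    rewrite (ip_divg (submoduleZ tau^-1 ssq sS) H1v).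
    have t0 : tau != 0 by rewrite gt_eqF.
    have e1 := linear_onZ tau^-1 ssq lq sS; have e3 := congr1 (fun z => tau * z) e1.
    apply: etrans e3 _; rewrite (mulVKf t0).
    rewrite (linear_on_sum _ _ ssq lq (fun j => Qsq (Qe j))); apply: eq_bigr => j _.
    by rewrite ip_divgC (ip_divg (Qsq (Qe j)) H1v).
  by rewrite bv; exact: key.
Qed.

End step.

(** * Elliptic projection of the initial data *)

Section projections.
Context {R : realType} {d : nat} (Om : cube R d) (M : mesh R d).
Hypothesis cover : \bigcup_i @cell R d M i = cube_set Om.
Local Notation fn := ('rV[R]_d -> R).
Local Notation vf := ('I_d -> 'rV[R]_d -> R).
Local Notation V := (Vh Om M).
Local Notation Q := (Qh Om M).
Local Notation ip := (ip Om).
Local Notation gradform := (gradform Om).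
Local Notation viscosity := (viscosity Om).

Let VH1 v : V v -> H1 Om v. Proof. by case. Qed.
Let Vb v : V v -> bdd Om v. Proof. exact: Vh_bdd. Qed.
Let Vsq v : V v -> sq Om v. Proof. by move=> /VH1/H1_sq. Qed.
Let sV : submodule V := Vh_submodule Om M.
Let b1 : bdd Om (fun=> 1) := bdd_cst Om 1.
Let Qsq q : Q q -> sq Om q. Proof. by case=> _ /H1_sq. Qed.

Let ip_linH (u : fn) : sq Om u -> linear_on (H1 Om) (ip u).
Proof. by move=> su a v w /H1_sq Vv /H1_sq Vw; exact: sq_pair_lin_r. Qed.

Let ip_linHl (u : fn) : sq Om u -> linear_on (H1 Om) ((ip)^~ u).
Proof. by move=> su a v w /H1_sq Vv /H1_sq Vw; exact: sq_pair_lin_l. Qed.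

Let null_pair (v w : fn) : H1 Om v -> H1 Om w -> ip w w = 0 -> ip v w = 0 /\ gradform (fun=> 1) v w = 0.
Proof.
move=> Hv Hw w0; have n0 := ip_null (H1_sq Hw) w0; split.
  by rewrite ipC; exact: (ip_null_l (sq_meas (H1_sq Hw)) (sq_meas (H1_sq Hv)) n0).
by apply: (gradform_null_r b1 Hv Hw) => i; apply: wderiv_null.
Qed.

(** Riesz representation for the inner product of H1. *)
Lemma pi1h_exists v : H1 Om v -> exists vh, is_pi1h Om M v vh.
Proof.
move=> Hv.
pose q x w := ip x w + gradform (fun=> 1) x w.
have [x Vx|y Vy||x Vx x0|vh Vvh vP] := riesz_on (q := q) (l := q v) sV (Vh_fin_span cover).
- apply: linear_on_add; last exact: gradform_lin.
  by apply: (linear_on_subset VH1); apply: ip_linH; exact: Vsq.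
- apply: linear_on_add.
    by apply: (linear_on_subset VH1); apply: ip_linHl; exact: Vsq.
  by apply: (linear_on_subset VH1); apply: gradform_lin_l => //; exact: VH1.
- apply: (linear_on_subset VH1); apply: linear_on_add; first exact/ip_linH/H1_sq.
  exact: gradform_lin_r.
- have [|e1 e2] := null_pair Hv (VH1 Vx); last by rewrite /q e1 e2 addr0.
  have p1 := ip_ge0 Om x; have p2 : 0 <= gradform (fun=> 1) x x by exact: gradform_ge0.
  by move: x0; rewrite /q; lra.
exists vh; split => // w Vw; have Hw := VH1 Vw; have Hvh := VH1 Vvh.
change (v \- vh) with (v - vh).
have Hd : H1 Om (v - vh) by apply: (submoduleB (H1_submodule Om)).
rewrite (ipv_grad Hd Hw) (linear_onB (ip_linHl (H1_sq Hw)) Hv Hvh).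
rewrite (linear_onB (gradform_lin_l b1 Hw) Hv Hvh).
by rewrite addrACA -opprD -/(q v w) -/(q vh w) vP // subrr.
Qed.

Lemma P1h_exists v : (forall i, H1 Om (v i)) -> exists vh, is_P1h Om M v vh.
Proof.
move=> Hv.
pose q (x w : vf) := \sum_i (ip (x i) (w i) + gradform (fun=> 1) (x i) (w i)).
have sZ : submodule (divfree Om V Q) by exact: (divfree_submodule sV VH1 Qsq).
have fZ : fin_span (divfree Om V Q).
  apply: (fin_span_sub (componentwise_submodule d sV) (componentwise_fin_span d sV (Vh_fin_span cover)) sZ).
  by move=> x [].
have ZH1 (x : vf) : divfree Om V Q x -> forall i, H1 Om (x i) by case=> Vx _ i; exact/VH1/Vx.
have linr (x : vf) : (forall i, H1 Om (x i)) -> linear_on (divfree Om V Q) (q x).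
  move=> Hx; apply: (linear_on_subset (fun y (h : divfree Om V Q y) => h.1)).
  apply: (component_lin (l := fun i w => ip (x i) w + gradform (fun=> 1) (x i) w)) => i.
  apply: (linear_on_subset VH1); apply: linear_on_add; first exact/ip_linH/H1_sq.
  exact: gradform_lin_r.
have linl (y : vf) : (forall i, H1 Om (y i)) -> linear_on (fun x : vf => forall i, H1 Om (x i)) (q^~ y).
  move=> Hy a x x' Hx Hx'; rewrite /q mulr_sumr -big_split /=; apply: eq_bigr => i _.
  have := ip_linHl (H1_sq (Hy i)) a (Hx i) (Hx' i); have := gradform_lin_l b1 (Hy i) a (Hx i) (Hx' i).
  change ((a *: x + x') i) with (a *: x i + x' i) => -> ->.
  move: (gradform _ _ _) (gradform _ _ _) (ip _ _) (ip _ _) => *; ring.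
have [x Zx|y Zy||x Zx /eqP x0|vh Zvh vP] := riesz_on (q := q) (l := q v) sZ fZ.
- by apply: linr; exact: ZH1.
- by apply: (linear_on_subset ZH1); apply: linl; exact: ZH1.
- exact: linr.
- have p1 i : 0 <= gradform (fun=> 1) (x i) (x i) by exact: gradform_ge0.
  rewrite /q big1 // => i _; have Hx := ZH1 _ Zx i.
  have [|-> ->] := null_pair (Hv i) Hx; last by rewrite addr0.
  move: x0; rewrite psumr_eq0 => [/allP /(_ i (mem_index_enum i)) /eqP|j _].
    by have := p1 i; have := ip_ge0 Om (x i); lra.
  by apply: addr_ge0 => //; exact: ip_ge0.
exists vh; split => // w Zw; have Hw := ZH1 _ Zw; have Hvh := ZH1 _ Zvh.
change (fun i : 'I_d => v i \- vh i) with (v - vh).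
have Hd i : H1 Om ((v - vh) i) by apply: (submoduleB (H1_submodule Om)).
rewrite (ipm_grad Hd Hw) ipv_sq; [|by move=> i; exact: H1_sq|by move=> i; exact: H1_sq].
rewrite /viscosity -big_split /=; rewrite -/(q (v - vh) w) (linear_onB (linl _ Hw) Hv Hvh).
by rewrite vP // subrr.
Qed.

End projections.

(** * Integrals in time *)

Section time_integrals.
Context {R : realType}.
Local Notation leb := (@lebesgue_measure R).
Implicit Types (a b c tau : R) (g h : R -> R).

(** Nothing is known about the fields at the grid points, and the integrals do not
    see them; but measurability on the closed interval still has to be recovered
    from the interior. *)
Definition agree_inside a b g h := forall s, a < s < b -> g s = h s.

Let open_closed (a b : R) (f : R -> \bar R) : measurable_fun `]a, b[ f ->
  (\int[leb]_(s in `[a, b]) f s = \int[leb]_(s in `]a, b[) f s)%E.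
Proof. by move=> mf; rewrite integral_itv_bndoo. Qed.

Let agree_measurable a b g h : continuous h -> agree_inside a b g h -> measurable_fun `]a, b[ g.
Proof.
move=> ch gh; apply: (eq_measurable_fun h).
  by move=> s /set_mem /=; rewrite in_itv /= => /gh.
by apply: measurable_funTS; exact: continuous_measurable_fun.
Qed.

Lemma agree_integral a b g h : continuous h -> agree_inside a b g h ->
  \int[leb]_(s in `[a, b]) g s = \int[leb]_(s in `[a, b]) h s.
Proof.
move=> ch gh; have mg := agree_measurable ch gh.
have mh : measurable_fun `]a, b[ h by apply: measurable_funTS; exact: continuous_measurable_fun.
rewrite /Rintegral (open_closed (f := EFin \o g)); last exact/measurable_EFinP.
rewrite (open_closed (f := EFin \o h)); last exact/measurable_EFinP.
by congr fine; apply: eq_integral => s /set_mem /=; rewrite in_itv /= => /gh ->.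
Qed.

Lemma agree_integrable a b g h : continuous h -> agree_inside a b g h ->
  leb.-integrable `[a, b] (EFin \o g).
Proof.
move=> ch gh; have mg := agree_measurable ch gh.
have /integrableP[_ hoo] : leb.-integrable `[a, b] (EFin \o h).
  by apply: continuous_compact_integrable; [exact: segment_compact|exact: continuous_subspaceT].
have mh : measurable_fun `]a, b[ h by apply: measurable_funTS; exact: continuous_measurable_fun.
apply/integrableP; split; first by apply/measurable_EFinP; exact: measurable_fun_itv_cc mg.
move: hoo; rewrite open_closed; last by apply/measurable_EFinP; exact: measurableT_comp.
rewrite open_closed; last by apply/measurable_EFinP; exact: measurableT_comp.
apply: le_lt_trans; rewrite le_eqVlt; apply/orP; left; apply/eqP.
by apply: eq_integral => s /set_mem /=; rewrite in_itv /= => /gh ->.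
Qed.

Lemma integrable_glue a b c g : a <= b -> b <= c ->
  leb.-integrable `[a, b] (EFin \o g) -> leb.-integrable `[b, c] (EFin \o g) ->
  leb.-integrable `[a, c] (EFin \o g) /\
  \int[leb]_(s in `[a, c]) g s = \int[leb]_(s in `[a, b]) g s + \int[leb]_(s in `[b, c]) g s.
Proof.
move=> ab bc i1 i2.
have e : `[a, c]%classic = `[a, b]%classic `|` `]b, c]%classic.
  by rewrite -itv_bndbnd_setU.
have i3 : leb.-integrable `]b, c] (EFin \o g).
  by apply: integrableS i2 => // s /=; rewrite !in_itv /= => /andP[/ltW -> ->].
have dis : [disjoint `[a, b]%classic & `]b, c]%classic].
  apply/disj_setPS => s [] /=; rewrite !in_itv /= => /andP[_ sb] /andP[bs _].
  by move: bs; rewrite ltNge sb.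
have i : leb.-integrable `[a, c] (EFin \o g).
  have /integrableP[m1 f1] := i1; have /integrableP[m3 f3] := i3.
  have mU : measurable_fun (`[a, b]%classic `|` `]b, c]%classic) (EFin \o g).
    by apply/measurable_funU.
  apply/integrableP; rewrite e; split => //.
  rewrite ge0_integral_setU //; first by rewrite lte_add_pinfty.
  exact: measurableT_comp.
split => //; rewrite e Rintegral_setU //; last by rewrite -e.
by congr (_ + _); rewrite Rintegral_itv_obnd_cbnd.
Qed.

Lemma affine_integral a tau k0 k1 : 0 < tau ->
  \int[leb]_(s in `[a, a + tau]) ((s - a) / tau * k1 + k0) = tau * (2^-1 * k1 + k0).
Proof.
move=> tau0; pose F (s : R) := k0 * s + (2 * tau)^-1 * k1 * (s - a) ^+ 2.
have t0 : tau != 0 by rewrite gt_eqF.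
have dF (t : R) : is_derive t (1 : R) F ((t - a) / tau * k1 + k0).
  apply: is_derive_eq; rewrite /GRing.scale /=.
  by field.
have cF : continuous (fun s : R => (s - a) / tau * k1 + k0).
  by move=> s; apply: (cvgD (cvgM (cvgM (cvgB cvg_id (cvg_cst a)) (cvg_cst tau^-1)) (cvg_cst k1)) (cvg_cst k0)).
have ab : a < a + tau by rewrite ltrDl.
rewrite /Rintegral (itv_integral_deriv ab dF cF) /= /F; field.
exact: t0.
Qed.

End time_integrals.

(** * Piecewise polynomials in time *)

Section slabs.
Context {R : realType} {d : nat} (T : R) (N : nat).
Hypotheses (T0 : 0 < T) (N0 : (0 < N)%N).
Local Notation leb := (@lebesgue_measure R).
Local Notation fn := ('rV[R]_d -> R).
Local Notation tgrid := (tgrid T N).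
Local Notation slab := (slab T N).
Local Notation tau := (T / N%:R).

Definition in_slab n (s : R) := tgrid n < s < tgrid n.+1.

(** Affine time on the slab n, from 0 to 1. *)
Definition local_time n (s : R) := (s - tgrid n) / tau.

Lemma step_gt0 : 0 < tau. Proof. by rewrite divr_gt0 // ltr0n. Qed.
Let tau0 := step_gt0.
Let tau_neq0 : tau != 0. Proof. by rewrite gt_eqF. Qed.

Lemma tgridS n : tgrid n.+1 = tgrid n + tau.
Proof. by rewrite /tgrid -addn1 natrD mulrDl mul1r. Qed.

Lemma tgrid0 : tgrid 0 = 0. Proof. by rewrite /tgrid mul0r. Qed.

Lemma tgrid_last : tgrid N = T.
Proof. by rewrite /tgrid mulrC divfK // pnatr_eq0 -lt0n. Qed.

Lemma tgrid_le m n : (m <= n)%N -> tgrid m <= tgrid n.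
Proof. by move=> mn; rewrite /tgrid ler_wpM2r ?ler_nat // ltW. Qed.

Lemma tgrid_ge0 n : 0 <= tgrid n. Proof. by rewrite -tgrid0 tgrid_le. Qed.

Lemma tgrid_leT n : (n <= N)%N -> tgrid n <= T.
Proof. by move/tgrid_le; rewrite tgrid_last. Qed.

Lemma tgrid_lt n : tgrid n < tgrid n.+1. Proof. by rewrite tgridS ltrDl. Qed.

Lemma local_time_continuous n : continuous (local_time n).
Proof. by move=> s; exact: (cvgM (cvgB cvg_id (cvg_cst (tgrid n))) (cvg_cst tau^-1)). Qed.

Lemma slab_agree n g h : continuous h -> (forall s, in_slab n s -> g s = h s) ->
  slab n.+1 g = \int[leb]_(s in `[tgrid n, tgrid n + tau]) h s.
Proof. by move=> ch gh; rewrite /Defs.slab -tgridS; exact: agree_integral. Qed.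

Lemma affine_continuous n (k0 k1 : R) : continuous (fun s => local_time n s * k1 + k0).
Proof.
move=> s; have c1 := @local_time_continuous n s.
have c2 : local_time n r * k1 @[r --> s] --> local_time n s * k1.
  exact: (cvgM c1 (cvg_cst k1)).
exact: (cvgD c2 (cvg_cst k0)).
Qed.

Lemma slab_affine n g k0 k1 : (forall s, in_slab n s -> g s = local_time n s * k1 + k0) ->
  slab n.+1 g = tau * (2^-1 * k1 + k0).
Proof.
move=> gE; rewrite (slab_agree (@affine_continuous n k0 k1) gE).
exact: affine_integral.
Qed.

Lemma slab_cst n g k : (forall s, in_slab n s -> g s = k) -> slab n.+1 g = tau * k.
Proof.
move=> gE; have := @slab_affine n g k 0; rewrite mulr0 add0r; apply=> s /gE ->.
by rewrite mulr0 add0r.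
Qed.

(** Integration of a linear functional along an affine path evaluates it at the
    midpoint. *)
Lemma slab_linear (W : lmodType R) (S : W -> Prop) L chi p0 n g :
  linear_on S L -> S chi -> S p0 ->
  (forall s, in_slab n s -> g s = L (local_time n s *: chi + p0)) ->
  slab n.+1 g = tau * L (2^-1 *: chi + p0).
Proof.
move=> lL Sc Sp gE; rewrite lL //; apply: slab_affine => s /gE ->.
exact: lL.
Qed.

(** Integrability comes with the sum, because it is needed at each gluing. *)
Lemma slabs_sum m n g : (m <= n)%N ->
  (forall k, (m <= k < n)%N -> exists2 h : R -> R, continuous h & forall s, in_slab k s -> g s = h s) ->
  leb.-integrable `[tgrid m, tgrid n] (EFin \o g) /\
  \int[leb]_(s in `[tgrid m, tgrid n]) g s = \sum_(m <= k < n) slab k.+1 g.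
Proof.
have base k : leb.-integrable `[tgrid k, tgrid k] (EFin \o g) /\
    \int[leb]_(s in `[tgrid k, tgrid k]) g s = 0.
  split; last by rewrite set_itv1 Rintegral_set1.
  apply: (@agree_integrable _ _ _ _ (fun=> 0)) => [|s /andP[/lt_trans h /h]].
    exact: cst_continuous.
  by rewrite ltxx.
elim: n => [|n IH] mn H.
  by move: mn; rewrite leqn0 => /eqP ->; rewrite big_geq.
move: mn; rewrite leq_eqVlt => /orP[/eqP ->|mn]; first by rewrite big_geq.
have [|i1 e1] := IH mn.
  by move=> k /andP[mk kn]; apply: H; rewrite mk ltnS ltnW.
have [|h ch gh] := H n; first by rewrite ltnS leqnn andbT.
have i2 := agree_integrable ch gh.
have [i ->] := integrable_glue (@tgrid_le m n mn) (ltW (tgrid_lt n)) i1 i2.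
by split => //; rewrite e1 big_nat_recr.
Qed.

Lemma Pk0P (X : fn -> Prop) v n : Pk T N 0 X v -> (n < N)%N ->
  exists2 c, X c & forall s, in_slab n s -> v s = c.
Proof.
move=> [_ /(_ n)] H /H[c [Xc cP]]; exists (c ord0) => // s ins.
by apply/funext => x; rewrite cP // big_ord1 expr0 mul1r.
Qed.

(** Inside the slab the affine form is that of the piecewise polynomial; at its ends
    it is forced by continuity. *)
Lemma Pk1P (X : fn -> Prop) v n : submodule X -> Pkc T N 1 X v -> (n < N)%N ->
  exists chi p0, [/\ X chi, X p0, forall s, in_slab n s -> v s = local_time n s *: chi + p0,
    v (tgrid n) = p0 & v (tgrid n.+1) = chi + p0].
Proof.
move=> sX [[_ /(_ n) H] cv] nN; have [c [Xc cP]] := H nN.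
have fkey (r g t x y : R) : t != 0 -> y + r * x = (r - g) / t * (t * x) + (g * x + y).
  by move=> h; field.
pose c0 := c ord0; pose c1 := c (lift ord0 ord0).
pose chi := tau *: c1; pose p0 := tgrid n *: c1 + c0.
have inE s : in_slab n s -> v s = local_time n s *: chi + p0.
  move=> ins; apply/funext => x; rewrite cP // big_ord_recl big_ord1 expr0 expr1 mul1r.
  change (c0 x + s * c1 x = (s - tgrid n) / tau * (tau * c1 x) + (tgrid n * c1 x + c0 x)).
  exact: fkey.
have key x : v (tgrid n) x = p0 x /\ v (tgrid n.+1) x = chi x + p0 x.
  have sub : {within `[tgrid n, tgrid n.+1], continuous (fun t => v t x)}.
    apply: continuous_subspaceW (cv x) => s /=; rewrite !in_itv /= => /andP[s1 s2].
    by rewrite (le_trans (tgrid_ge0 n) s1) (le_trans s2) // tgrid_leT.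
  have [_ cl cr] := (continuous_within_itvP _ (tgrid_lt n)).1 sub.
  have ca := @affine_continuous n (p0 x) (chi x).
  have inx s : in_slab n s -> v s x = local_time n s * chi x + p0 x by move=> /inE ->.
  split.
    apply: (cvg_unique (@norm_hausdorff _ _) cl).
    have -> : p0 x = local_time n (tgrid n) * chi x + p0 x by rewrite /local_time subrr !mul0r add0r.
    have := cvg_at_right_filter (ca (tgrid n)); apply: cvg_trans; apply: near_eq_cvg.
    near=> s; rewrite -inx //; apply/andP; split; near: s.
      exact: nbhs_right_gt.
    by apply: nbhs_right_lt; exact: tgrid_lt.
  apply: (cvg_unique (@norm_hausdorff _ _) cr).
  have -> : chi x + p0 x = local_time n (tgrid n.+1) * chi x + p0 x.
    by rewrite /local_time tgridS addrAC subrr add0r divff // mul1r.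
  have := cvg_at_left_filter (ca (tgrid n.+1)); apply: cvg_trans; apply: near_eq_cvg.
  near=> s; rewrite -inx //; apply/andP; split; near: s.
    by apply: nbhs_left_gt; exact: tgrid_lt.
  exact: nbhs_left_lt.
exists chi, p0; split => //.
- exact: (submoduleZ tau sX (Xc (lift ord0 ord0))).
- exact: (sX.2 (tgrid n) _ _ (Xc (lift ord0 ord0)) (Xc ord0)).
- by apply/funext => x; case: (key x).
- by apply/funext => x; case: (key x).
Unshelve. all: by end_near. Qed.

Lemma dt_slab (v : R -> fn) n chi p0 : (forall s, in_slab n s -> v s = local_time n s *: chi + p0) ->
  forall s, in_slab n s -> dt v s = tau^-1 *: chi.
Proof.
move=> vE s ins; apply/funext => x; rewrite /dt derive1E.
have near_s : \near s, local_time n s * chi x + p0 x = v s x.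
  have op : open [set s | in_slab n s].
    have := @interval_open R (BRight (tgrid n)) (BLeft (tgrid n.+1)) isT isT.
    by rewrite set_itvE.
  have : nbhs s [set s | in_slab n s] by apply: open_nbhs_nbhs; split.
  by apply: filterS => r /vE ->.
have D : is_derive s (1 : R) (fun s => local_time n s * chi x + p0 x) (tau^-1 * chi x).
  by apply: is_derive_eq; rewrite /GRing.scale /=; ring.
by have := near_eq_is_derive near_s D; move=> DD; rewrite derive_val.
Qed.

End slabs.

(** * The equations on one slab *)

Section slab_equations.
Context {R : realType} {d : nat} (Om : cube R d) (T : R) (N : nat).
Hypotheses (T0 : 0 < T) (N0 : (0 < N)%N).
Local Notation fn := ('rV[R]_d -> R).
Local Notation vf := ('I_d -> 'rV[R]_d -> R).
Local Notation ip := (ip Om).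
Local Notation gradform := (gradform Om).
Local Notation transport := (transport Om).
Local Notation convection := (convection Om).
Local Notation viscosity := (viscosity Om).
Local Notation tgrid := (tgrid T N).
Local Notation slab := (slab T N).
Local Notation in_slab := (in_slab T N).
Local Notation local_time := (local_time T N).
Local Notation tau := (T / N%:R).
Variables (V Q : fn -> Prop).
Hypotheses (sV : submodule V).
Hypotheses (VH1 : forall v, V v -> H1 Om v) (Vb : forall v, V v -> bdd Om v).
Hypotheses (Qsq : forall q, Q q -> sq Om q).
Local Notation Vd := (@componentwise R d d V).
Variables (gamma : R) (b eta f : R -> R).
Hypotheses (cb : continuous b) (ceta : continuous eta) (C1f' : C1 (derive1 f)).

(** The equations integrated over the slab n, for the increments chi and w of the
    affine fields starting at p0 and q0. The fields phib and ub are kept free: for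
    a given solution they are known to be the midpoints only almost everywhere. *)
Definition slab_scheme n (p0 chi phib mu : fn) (q0 w ub : vf) (p : fn) :=
  let m := 2^-1 *: chi + p0 in let um := 2^-1 *: w + q0 in
  [/\ forall psi, V psi ->
        ip chi psi = tau * transport m ub psi - tau * gradform (fun x => b (phib x)) mu psi,
      forall xi, V xi -> tau * ip mu xi =
        gamma * (tau * gradform (fun=> 1) m xi) + slab_potential Om f (tgrid n) tau p0 chi xi,
      forall v, Vd v -> \sum_i ip (w i) (v i) =
        - (tau * convection um ub v) - tau * viscosity (fun x => eta (phib x)) ub v
        + tau * ip p (divg Om v) - tau * transport m v mu &
      forall q, Q q -> tau * ip (divg Om um) q = 0].

Variables (n : nat) (phi phib mu p : R -> fn) (u ub : R -> vf).
Variables (p0 chi phib' mu' p' : fn) (q0 w ub' : vf).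
Hypotheses (Vp0 : V p0) (Vchi : V chi) (Vphib : V phib') (Vmu : V mu') (Qp : Q p').
Hypotheses (Vq0 : Vd q0) (Vw : Vd w) (Vub : Vd ub').
Hypothesis phiE : forall s, in_slab n s -> phi s = local_time n s *: chi + p0.
Hypothesis phibE : forall s, in_slab n s -> phib s = phib'.
Hypothesis muE : forall s, in_slab n s -> mu s = mu'.
Hypothesis pE : forall s, in_slab n s -> p s = p'.
Hypothesis uE : forall i s, in_slab n s -> u s i = local_time n s *: w i + q0 i.
Hypothesis ubE : forall i s, in_slab n s -> ub s i = ub' i.

Let tau0 : 0 < tau := step_gt0 T0 N0.
Let tau_neq0 : tau != 0. Proof. by rewrite gt_eqF. Qed.
Let Vsq v : V v -> sq Om v. Proof. by move/Vb; exact: bdd_sq. Qed.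
Let b1 : bdd Om (fun=> 1) := bdd_cst Om 1.
Let Vpath s : V (local_time n s *: chi + p0). Proof. exact: sV.2. Qed.
Let Vpathu s i : V (local_time n s *: w i + q0 i). Proof. exact: sV.2. Qed.
Let ubE' s : in_slab n s -> ub s = ub'. Proof. by move=> h; apply/funext => i; exact: ubE. Qed.
Let uE' s : in_slab n s -> u s = local_time n s *: w + q0.
Proof. by move=> h; apply/funext => i; rewrite uE. Qed.
Let bphib : bdd Om (fun x => b (phib' x)). Proof. exact: bdd_comp (Vb Vphib). Qed.
Let betaphib : bdd Om (fun x => eta (phib' x)). Proof. exact: bdd_comp (Vb Vphib). Qed.

Local Notation m := (2^-1 *: chi + p0).
Local Notation um := (2^-1 *: w + q0).

Let transport_lin_density (v : vf) psi : Vd v -> H1 Om psi ->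
  linear_on V (fun h => transport h v psi).
Proof.
move=> Vv Hpsi; apply: linear_on_bigsum => i a h k Vh Vk.
have e g : wpair Om i (fun x => g x * v i x) psi = wpair Om i (fun x => v i x * g x) psi.
  by congr (wpair _ _ _ _); apply/funext => x; rewrite mulrC.
by rewrite !e; exact: (wpair_mul_lin Vb i (Vb (Vv i)) Hpsi a Vh Vk).
Qed.

Section scalar_tests.
Variables (psi : R -> fn) (psi' : fn).
Hypotheses (Vpsi : V psi') (psiE : forall s, in_slab n s -> psi s = psi').

Let ipl v : V v -> linear_on V (fun x => ip x v).
Proof. by move=> Vv; apply: (ip_lin_l Vb); exact: Vsq. Qed.

Lemma slab_dt : slab n.+1 (fun s => ip (dt phi s) (psi s)) = ip chi psi'.
Proof.
rewrite (@slab_cst _ _ _ T0 N0 _ _ (tau^-1 * ip chi psi')); first by rewrite mulVKf.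
move=> s h; rewrite (dt_slab T0 N0 phiE h) (psiE h).
exact: (linear_onZ tau^-1 sV (ipl Vpsi) Vchi).
Qed.

Lemma slab_transport :
  slab n.+1 (fun s => ipv Om (fun i x => phi s x * ub s i x) (grad Om (psi s)))
    = tau * transport m ub' psi'.
Proof.
have lt := transport_lin_density Vub (VH1 Vpsi).
apply: (slab_linear T0 N0 lt Vchi Vp0) => s h; rewrite (psiE h) (phiE h) (ubE' h).
by apply: ipv_transport; [exact: Vb|move=> i; exact: Vsq|exact: VH1].
Qed.

Lemma slab_mobility :
  slab n.+1 (fun s => ipv Om (fun i x => b (phib s x) * grad Om (mu s) i x) (grad Om (psi s)))
    = tau * gradform (fun x => b (phib' x)) mu' psi'.
Proof.
apply: (slab_cst T0 N0) => s h; rewrite (psiE h) (phibE h) (muE h).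
by apply: ipv_gradform; [|exact: VH1|exact: VH1].
Qed.

Lemma slab_mu : slab n.+1 (fun s => ip (mu s) (psi s)) = tau * ip mu' psi'.
Proof. by apply: (slab_cst T0 N0) => s h; rewrite (psiE h) (muE h). Qed.

Lemma slab_gradient :
  slab n.+1 (fun s => ipv Om (grad Om (phi s)) (grad Om (psi s))) = tau * gradform (fun=> 1) m psi'.
Proof.
have lg : linear_on V (fun h => gradform (fun=> 1) h psi').
  by apply: (linear_on_subset VH1); apply: gradform_lin_l => //; exact: VH1.
apply: (slab_linear T0 N0 lg Vchi Vp0) => s h; rewrite (psiE h) (phiE h).
by apply: ipv_grad; exact: VH1.
Qed.

Lemma slab_chemical :
  slab n.+1 (fun s => ip (fun x => derive1 f (phi s x)) (psi s))
    = slab_potential Om f (tgrid n) tau p0 chi psi'.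
Proof.
have Hc : continuous (fun s => intO Om (fun x => derive1 f (p0 x + local_time n s * chi x) * psi' x)).
  apply: (intO_continuous (H := fun s x => derive1 f (p0 x + local_time n s * chi x))).
  - by move=> s; apply: C1_affine_bdd; [exact: C1_continuous|exact: Vb|exact: Vb].
  - apply: ucont_comp => //.
      by move=> s; apply: bdd_set; apply: bddD; [exact: Vb|apply: bddZ; exact: Vb].
    apply: ucontD; first exact: ucont_cst.
    by apply: ucontZ; [exact: local_time_continuous|apply: bdd_set; exact: Vb].
  - exact/bdd_integ/Vb.
  - by case: (Vb Vpsi).
rewrite (slab_agree Hc) // => s h; rewrite (psiE h) (phiE h).
apply: intO_eq => x _; congr (derive1 f _ * _).
by rewrite addrC.
Qed.

End scalar_tests.

Section vector_tests.
Variables (v : R -> vf) (v' : vf).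
Hypotheses (Vv : Vd v') (vE : forall i s, in_slab n s -> v s i = v' i).
Let vE' s : in_slab n s -> v s = v'. Proof. by move=> h; apply/funext => i; exact: vE. Qed.
Let vH1 i : H1 Om (v' i). Proof. exact: VH1. Qed.
Let vb i : bdd Om (v' i). Proof. exact: Vb. Qed.
Let ubH1 i : H1 Om (ub' i). Proof. exact: VH1. Qed.
Let ubb i : bdd Om (ub' i). Proof. exact: Vb. Qed.

Lemma slab_dtv : slab n.+1 (fun s => ipv Om (fun i => dt (fun t => u t i) s) (v s))
  = \sum_i ip (w i) (v' i).
Proof.
rewrite (@slab_cst _ _ _ T0 N0 _ _ (tau^-1 * \sum_i ip (w i) (v' i))); first by rewrite mulVKf.
move=> s h; rewrite (vE' h).
have -> : (fun i => dt (fun t => u t i) s) = fun i => tau^-1 *: w i.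
  by apply/funext => i; exact: (dt_slab T0 N0 (uE i) h).
rewrite ipv_sq; [|by move=> i; apply: sqZ; exact: Vsq|by move=> i; exact: Vsq].
rewrite mulr_sumr; apply: eq_bigr => i _.
have l := ip_lin_l Vb (Vsq (Vv i)).
exact: (linear_onZ tau^-1 sV l (Vw i)).
Qed.

Lemma slab_skw : slab n.+1 (fun s => skw Om (u s) (ub s) (v s)) = tau * convection um ub' v'.
Proof.
have lc := convection_lin1 VH1 Vb Vub Vv.
apply: (slab_linear T0 N0 lc Vw Vq0) => s h; rewrite (vE' h) (uE' h) (ubE' h).
by apply: skw_convection => // i; exact/Vb/Vpathu.
Qed.

Lemma slab_viscosity :
  slab n.+1 (fun s => ipm Om (fun i j x => eta (phib s x) * gradv Om (ub s) i j x) (gradv Om (v s)))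
    = tau * viscosity (fun x => eta (phib' x)) ub' v'.
Proof.
apply: (slab_cst T0 N0) => s h; rewrite (vE' h) (ubE' h) (phibE h).
exact: ipm_viscosity.
Qed.

Lemma slab_pressure : slab n.+1 (fun s => ip (p s) (divg Om (v s))) = tau * ip p' (divg Om v').
Proof. by apply: (slab_cst T0 N0) => s h; rewrite (vE' h) (pE h). Qed.

Lemma slab_capillary :
  slab n.+1 (fun s => ipv Om (fun i x => phi s x * v s i x) (grad Om (mu s)))
    = tau * transport m v' mu'.
Proof.
have lt := transport_lin_density Vv (VH1 Vmu).
apply: (slab_linear T0 N0 lt Vchi Vp0) => s h; rewrite (muE h) (phiE h) (vE' h).
by apply: ipv_transport; [exact: Vb|move=> i; exact: Vsq|exact: VH1].
Qed.

End vector_tests.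

Lemma slab_div (q : R -> fn) q' : Q q' -> (forall s, in_slab n s -> q s = q') ->
  slab n.+1 (fun s => ip (divg Om (u s)) (q s)) = tau * ip (divg Om um) q'.
Proof.
move=> Qq qE; apply: (slab_linear T0 N0 (divg_lin sV VH1 Qsq Qq) Vw Vq0) => s h.
by rewrite (qE _ h) (uE' h).
Qed.

End slab_equations.

(** * Mass and energy balance on one slab *)

Section conservation.
Context {R : realType} {d : nat} (Om : cube R d) (T : R) (N : nat).
Hypotheses (T0 : 0 < T) (N0 : (0 < N)%N).
Local Notation fn := ('rV[R]_d -> R).
Local Notation vf := ('I_d -> 'rV[R]_d -> R).
Local Notation ip := (ip Om).
Local Notation I := (intO Om).
Local Notation gradform := (gradform Om).
Local Notation viscosity := (viscosity Om).
Local Notation tau := (T / N%:R).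
Variables (V Q : fn -> Prop).
Hypotheses (sV : submodule V).
Hypotheses (VH1 : forall v, V v -> H1 Om v) (Vb : forall v, V v -> bdd Om v).
Hypotheses (V1 : V (fun=> 1)) (Qsq : forall q, Q q -> sq Om q).
Local Notation Vd := (@componentwise R d d V).
Variables (gamma : R) (b eta f : R -> R).
Hypotheses (cb : continuous b) (ceta : continuous eta) (C1f : C1 f) (C1f' : C1 (derive1 f)).

Let tau0 : 0 < tau := step_gt0 T0 N0.
Let tau_neq0 : tau != 0. Proof. by rewrite gt_eqF. Qed.
Let Vsq v : V v -> sq Om v. Proof. by move/Vb; exact: bdd_sq. Qed.
Let b1 : bdd Om (fun=> 1) := bdd_cst Om 1.
Let ipl v : V v -> linear_on V (fun x => ip x v).
Proof. by move=> Vv; apply: (ip_lin_l Vb); exact: Vsq. Qed.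
Let ipr v : V v -> linear_on V (ip v).
Proof. by move=> Vv; apply: (ip_lin_r Vb); exact: Vsq. Qed.

Lemma energyE (phi : fn) (u : vf) : V phi -> Vd u ->
  energy Om gamma f phi u = gamma / 2 * gradform (fun=> 1) phi phi + I (fun x => f (phi x))
    + 2^-1 * \sum_i ip (u i) (u i).
Proof.
move=> Vp Vu; have sg i := wderiv_sq i (VH1 Vp); have su i := Vsq (Vu i).
have i1 i : integ Om (fun x => wderiv Om i phi x ^+ 2) by case: (sg i).
have i2 i : integ Om (fun x => u i x ^+ 2) by case: (su i).
have i3 : integ Om (fun x => f (phi x)).
  by apply: bdd_integ; apply: bdd_comp; [exact: C1_continuous|exact: Vb].
have j1 : integ Om (fun x => gamma / 2 * \sum_i wderiv Om i phi x ^+ 2).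
  by apply: integZ; exact: integ_sum.
have j2 : integ Om (fun x => 2^-1 * \sum_i u i x ^+ 2) by apply: integZ; exact: integ_sum.
rewrite /energy (intOD (integD j1 i3) j2) (intOD j1 i3).
rewrite (intOZ _ (integ_sum _ i1)) (intOZ _ (integ_sum _ i2)) !intO_sum //.
congr (_ * _ + _ + _ * _).
  by apply: eq_bigr => i _; apply: intO_eq => x _; rewrite mul1r expr2.
Qed.

Lemma dissipationE (phi mu : fn) (u : vf) : V phi -> V mu -> Vd u ->
  dissipation Om b eta phi mu u = gradform (fun x => b (phi x)) mu mu
    + viscosity (fun x => eta (phi x)) u u.
Proof.
move=> Vp Vm Vu; have bb : bdd Om (fun x => b (phi x)) by apply: bdd_comp => //; exact: Vb.
have be : bdd Om (fun x => eta (phi x)) by apply: bdd_comp => //; exact: Vb.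
have sm i := wderiv_sq i (VH1 Vm); have su i j := wderiv_sq j (VH1 (Vu i)).
rewrite -(ipv_gradform bb (VH1 Vm) (VH1 Vm)) -(ipm_viscosity be (fun i => VH1 (Vu i)) (fun i => VH1 (Vu i))).
rewrite /ipv /ipm -intOD.
- by apply: intO_eq => x _; rewrite !mulr_sumr; congr (_ + _);
    apply: eq_bigr => i _; rewrite ?mulr_sumr -?mulrA -?expr2 //;
    apply: eq_bigr => j _; rewrite -mulrA -expr2.
- by apply: integ_sum => i; exact: (sqM (sq_bddM bb (sm i)) (sm i)).
- apply: integ_sum => i; apply: integ_sum => j.
  exact: (sqM (sq_bddM be (su i j)) (su i j)).
Qed.

Variables (n : nat) (p0 chi phib mu p : fn) (q0 w ub : vf).
Hypotheses (Vp0 : V p0) (Vchi : V chi) (Vphib : V phib) (Vmu : V mu) (Qp : Q p).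
Hypotheses (Vq0 : Vd q0) (Vw : Vd w) (Vub : Vd ub).
Hypothesis scheme : slab_scheme Om T N V Q gamma b eta f n p0 chi phib mu q0 w ub p.

(** The test function 1 has no gradient. *)
Lemma mass_step : I (chi + p0) = I p0.
Proof.
have [e1 _ _ _] := scheme; have := e1 _ V1; rewrite /transport big1 => [|i _]; last first.
  by apply: wpair_cst; apply: sq_bddM; [apply: Vb; exact: sV.2|exact: Vsq].
rewrite gradform_null_r; last 1 first.
- by move=> i; exact: wderiv_cst.
- rewrite !mulr0 subr0 => c0.
  have ic : integ Om chi by exact/bdd_integ/Vb.
  have ip0 : integ Om p0 by exact/bdd_integ/Vb.
  rewrite (intOD ic ip0) -[RHS]add0r -c0; congr (_ + _).
  by apply: intO_eq => x _; rewrite mulr1.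
- by apply: bdd_comp => //; exact: Vb.
- exact: VH1.
- exact: VH1.
Qed.

Hypothesis ub_mid : forall i, aeq Om (ub i) ((2^-1 *: w + q0) i).

(** Test the mass equation with mu, the potential equation with chi, the momentum
    equation with ub. The transport of phi by ub cancels against the capillary
    force; convection and pressure do no work; and the change of a quadratic form
    is twice its value between midpoint and increment. The equality of ub and the
    midpoint velocity almost everywhere gives the last point and the
    orthogonality of ub to the pressure. *)
Lemma energy_step :
  energy Om gamma f (chi + p0) (w + q0) + tau * dissipation Om b eta phib mu ub
  = energy Om gamma f p0 q0.
Proof.
have Vm : V (2^-1 *: chi + p0) by exact: sV.2.
have Vum i : V ((2^-1 *: w + q0) i) by exact: (sV.2 2^-1 _ _ (Vw i) (Vq0 i)).
have VwD : Vd (w + q0) by move=> i; exact: (submoduleD sV (Vw i) (Vq0 i)).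
have VcD : V (chi + p0) by exact: submoduleD.
have gkey (x y z : R) : 2^-1 * x + y = 2^-1 * (x + y + (y + z) - z) by field.
have key (cm TR B gc F1 F0 k Vi g1 g0 k1 k0 : R) : cm = tau * TR - tau * B ->
    tau * cm = gamma * (tau * gc) + tau * (F1 - F0) ->
    k = - (tau * 0) - tau * Vi + tau * 0 - tau * TR ->
    gc = 2^-1 * (g1 - g0) -> k = 2^-1 * (k1 - k0) ->
    gamma / 2 * g1 + F1 + 2^-1 * k1 + tau * (B + Vi) = gamma / 2 * g0 + F0 + 2^-1 * k0.
  move=> e1 e2 e3 e4 e5; rewrite e4 in e2; have e2' : cm = gamma * (2^-1 * (g1 - g0)) + (F1 - F0).
    by apply: (mulfI tau_neq0); rewrite e2; ring.
  have : tau * TR = cm + tau * B by rewrite e1; ring.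
  rewrite e2'; move: e3; rewrite e5 !mulr0; lra.
have [e1 e2 e3 e4] := scheme.
have {e1} := e1 _ Vmu; have {e2} := e2 _ Vchi; have {e3} := e3 _ Vub.
rewrite (slab_potential_chain (tgrid T N n) C1f C1f' tau0 (Vb Vp0) (Vb Vchi)) (ipC Om mu chi).
rewrite convection_alt.
have -> : ip p (divg Om ub) = 0.
  rewrite ip_divg; [|exact: Qsq|by move=> i; exact: VH1].
  have -> : \sum_i wpair Om i p (ub i) = \sum_i wpair Om i p ((2^-1 *: w + q0) i).
    apply: eq_bigr => i _; rewrite /wpair (wderiv_aeq i _ _ (ub_mid i)) //.
      exact: bdd_meas (Vb (Vub i)).
    exact: bdd_meas (Vb (Vum i)).
  rewrite -ip_divg; [|exact: Qsq|by move=> i; exact: VH1].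
  by rewrite -ip_divgC; apply: (mulfI tau_neq0); rewrite e4 // mulr0.
have -> : \sum_i ip (w i) (ub i) = \sum_i ip (w i) ((2^-1 *: w + q0) i).
  apply: eq_bigr => i _; apply: intO_aeq.
  - by apply: measM; [exact: bdd_meas (Vb (Vw i))|exact: bdd_meas (Vb (Vub i))].
  - by apply: measM; [exact: bdd_meas (Vb (Vw i))|exact: bdd_meas (Vb (Vum i))].
  - exact: aeq_op2 (aeq_refl Om (w i)) (ub_mid i).
rewrite !energyE // dissipationE // => e3 e2 e1.
apply: (key _ _ _ _ _ _ _ _ _ _ _ _ e1 _ e3).
- rewrite e2; congr (_ + _ * (_ - _)); apply: intO_eq => x _; congr f.
  exact: addrC.
- have gl x : V x -> linear_on V (fun h => gradform (fun=> 1) h x).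
    by move=> Vx; apply: (linear_on_subset VH1); apply: gradform_lin_l => //; exact: VH1.
  rewrite (linear_onD (gl _ VcD) Vchi Vp0).
  rewrite !(linear_onD (gradform_lin VH1 b1 _) Vchi Vp0) //.
  rewrite (gl _ Vchi 2^-1 _ _ Vchi Vp0) (gradformC Om _ chi p0).
  exact: gkey.
- rewrite -sumrB mulr_sumr; apply: eq_bigr => i _.
  rewrite (linear_onD (ipl (VwD i)) (Vw i) (Vq0 i)).
  rewrite !(linear_onD (ipr _) (Vw i) (Vq0 i)) //.
  rewrite (ipr (Vw i) 2^-1 (Vw i) (Vq0 i)) (ipC Om (q0 i) (w i)).
  exact: gkey.
Qed.

End conservation.

(** * Projection onto piecewise constants in time *)

Section time_projection.
Context {R : realType} {d : nat} (Om : cube R d) (T : R) (N : nat).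
Hypotheses (T0 : 0 < T) (N0 : (0 < N)%N).
Local Notation fn := ('rV[R]_d -> R).
Local Notation ip := (ip Om).
Local Notation tgrid := (tgrid T N).
Local Notation in_slab := (in_slab T N).
Local Notation local_time := (local_time T N).
Local Notation tau := (T / N%:R).
Variables (V : fn -> Prop).
Hypotheses (sV : submodule V) (Vb : forall v, V v -> bdd Om v).

Let tau0 : 0 < tau := step_gt0 T0 N0.
Let tau_neq0 : tau != 0. Proof. by rewrite gt_eqF. Qed.
Let Vsq v : V v -> sq Om v. Proof. by move/Vb; exact: bdd_sq. Qed.
Let ipl v : V v -> linear_on V (fun x => ip x v).
Proof. by move=> Vv; apply: (ip_lin_l Vb); exact: Vsq. Qed.

Lemma in_slab_inj k n s : in_slab k s -> in_slab n s -> k = n.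
Proof.
move=> /andP[k1 k2] /andP[n1 n2].
have h i j : tgrid i < s -> s < tgrid j.+1 -> (i <= j)%N.
  move=> a1 a2; rewrite leqNgt; apply/negP => /(tgrid_le T0 N0) ji.
  by have := lt_le_trans a2 (le_trans ji (ltW a1)); rewrite ltxx.
by apply/eqP; rewrite eqn_leq !h.
Qed.

Lemma path_minus_cst (chi p0 c z : fn) n s : V chi -> V p0 -> V c -> V z ->
  ip ((local_time n s *: chi + p0) \- c) z
    = local_time n s * ip chi z + (ip p0 z - ip c z).
Proof.
move=> Vchi Vp Vc Vz; have Vl : V (local_time n s *: chi + p0) by exact: sV.2.
change ((local_time n s *: chi + p0) \- c) with ((local_time n s *: chi + p0) - c).
by rewrite (linear_onB (ipl Vz) Vl Vc) (ipl Vz _ Vchi Vp) addrA.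
Qed.

(** Tested with the difference itself, supported in one slab. *)
Lemma projection_midpoint (v vb : R -> fn) n chi p0 c : (n < N)%N ->
  is_pi0 T N Om V v vb -> V chi -> V p0 -> V c ->
  (forall s, in_slab n s -> v s = local_time n s *: chi + p0) ->
  (forall s, in_slab n s -> vb s = c) ->
  aeq Om c (2^-1 *: chi + p0).
Proof.
move=> nN [_ pi0] Vchi Vp Vc vE vbE.
have Vm : V (2^-1 *: chi + p0) by exact: sV.2.
have Vz : V (2^-1 *: chi + p0 - c) by exact: submoduleB.
set z := 2^-1 *: chi + p0 - c in Vz.
pose w s : fn := if in_slab n s then z else 0.
have Pw : Pk T N 0 V w.
  split=> [t _|k kN]; first by rewrite /w; case: ifP => // _; exact: sV.1.
  exists (fun _ => if k == n then z else 0); split => [_|t x kt].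
    by case: ifP => // _; exact: sV.1.
  rewrite big_ord1 expr0 mul1r /w; case: eqP => [e|ne].
    by rewrite -e /in_slab kt.
  by case: ifP => // nt; case: ne; exact: (in_slab_inj kt nt).
have := pi0 _ Pw.
pose g s := ip (v s \- vb s) (w s).
have gn s : in_slab n s -> g s = local_time n s * ip chi z + (ip p0 z - ip c z).
  by move=> h; rewrite /g /w h (vE _ h) (vbE _ h) path_minus_cst.
have g0 k s : k != n -> in_slab k s -> g s = 0.
  move=> kn ks; rewrite /g /w; case: ifP => [ns|_].
    by move: kn; rewrite (in_slab_inj ks ns) eqxx.
  by rewrite -[RHS](intO0 Om); apply: intO_eq => x _; rewrite mulr0.
have [|_ gsum] := @slabs_sum _ T N T0 N0 0 N g (leq0n N).
  move=> k _; have [->|kn] := eqVneq k n.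
    by exists (fun s => local_time n s * ip chi z + (ip p0 z - ip c z)) => //; exact: affine_continuous.
  by exists (fun=> 0); [exact: cst_continuous|move=> s; exact: g0].
move: gsum; rewrite tgrid0 tgrid_last // => -> s0.
have {}s0 : tau * (2^-1 * ip chi z + (ip p0 z - ip c z)) = 0.
  rewrite -(slab_affine T0 N0 gn) -[RHS]s0 (bigD1_seq n) ?iota_uniq //=; last first.
    by rewrite mem_index_iota.
  rewrite big1 ?addr0 // => k kn; rewrite (slab_cst T0 N0 (k := 0)) ?mulr0 // => s.
  exact: g0.
have zz : ip z z = 0.
  apply: (mulfI tau_neq0); rewrite mulr0 -[RHS]s0; congr (_ * _).
  by rewrite {1}/z (linear_onB (ipl Vz) Vm Vc) (ipl Vz _ Vchi Vp) addrA.
have z0 := ip_null (Vsq Vz) zz; apply: aeq_sym.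
have := aeq_op2 +%R z0 (aeq_refl Om c).
have -> : (fun x => z x + c x) = 2^-1 *: chi + p0.
  by apply/funext => x; exact: (subrK (c x)).
have -> : (fun x : 'rV[R]_d => 0 + c x) = c by apply/funext => x; rewrite add0r.
by [].
Qed.

(** An affine function minus its midpoint value has integral 0 over each slab. *)
Lemma midpoint_projection (v vb : R -> fn) (chi p0 : nat -> fn) :
  Pk T N 0 V vb -> (forall n, (n < N)%N -> V (chi n) /\ V (p0 n)) ->
  (forall n s, (n < N)%N -> in_slab n s -> v s = local_time n s *: chi n + p0 n) ->
  (forall n s, (n < N)%N -> in_slab n s -> vb s = 2^-1 *: chi n + p0 n) ->
  is_pi0 T N Om V v vb.
Proof.
move=> Pvb VV vE vbE; split => // w Pw.
pose g s := ip (v s \- vb s) (w s).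
have [|_ gsum] := @slabs_sum _ T N T0 N0 0 N g (leq0n N).
  move=> n nN; have [c Vc cE] := Pk0P Pw nN; have [Vchi Vp] := VV n nN.
  have Vm : V (2^-1 *: chi n + p0 n) by exact: sV.2.
  exists (fun s => local_time n s * ip (chi n) c + (ip (p0 n) c - ip (2^-1 *: chi n + p0 n) c)).
    exact: affine_continuous.
  by move=> s h; rewrite /g (vE _ _ nN h) (vbE _ _ nN h) (cE _ h) path_minus_cst.
move: gsum; rewrite tgrid0 tgrid_last // => gsum; apply: etrans gsum _.
rewrite big_nat big1 // => n nN; have [c Vc cE] := Pk0P Pw nN; have [Vchi Vp] := VV n nN.
have Vm : V (2^-1 *: chi n + p0 n) by exact: sV.2.
rewrite (@slab_affine _ _ _ T0 N0 n g (ip (p0 n) c - ip (2^-1 *: chi n + p0 n) c) (ip (chi n) c)).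
  by rewrite (ipl Vc _ Vchi Vp) addrA subrr mulr0.
by move=> s h; rewrite /g (vE _ _ nN h) (vbE _ _ nN h) (cE _ h) path_minus_cst.
Qed.

End time_projection.

(** * Balance laws for solutions *)

Section solutions.
Context {R : realType} {d : nat} (Om : cube R d) (M : mesh R d) (T : R) (N : nat).
Hypotheses (T0 : 0 < T) (N0 : (0 < N)%N).
Hypothesis cover : \bigcup_i @cell R d M i = cube_set Om.
Local Notation fn := ('rV[R]_d -> R).
Local Notation vf := ('I_d -> 'rV[R]_d -> R).
Local Notation V := (Vh Om M).
Local Notation Q := (Qh Om M).
Local Notation tau := (T / N%:R).
Local Notation tgrid := (tgrid T N).
Local Notation in_slab := (in_slab T N).
Local Notation local_time := (local_time T N).
Variables (gamma : R) (b eta f : R -> R).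
Hypotheses (cb : continuous b) (ceta : continuous eta) (C1f : C1 f) (C1f' : C1 (derive1 f)).
Variables (phi0 : fn) (u0 : vf) (phi phib mu : R -> fn) (u ub : R -> vf) (p : R -> fn).
Hypothesis sol : is_solution Om M T N gamma b f eta phi0 u0 phi phib mu u ub p.

Let VH1 v : V v -> H1 Om v. Proof. by case. Qed.
Let Vb v : V v -> bdd Om v. Proof. exact: Vh_bdd. Qed.
Let sV : submodule V := Vh_submodule Om M.
Let Qsq q : Q q -> sq Om q. Proof. by case=> _ /H1_sq. Qed.
Let tau0 : 0 < tau := step_gt0 T0 N0.
Let tau_neq0 : tau != 0. Proof. by rewrite gt_eqF. Qed.

Let Pk_cst (X : fn -> Prop) c : X c -> Pk T N 0 X (fun=> c).
Proof.
move=> Xc; split => // n _; exists (fun=> c); split => // t x _.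
by rewrite big_ord1 expr0 mul1r.
Qed.

(** Tests constant in time turn the equations of the scheme into those of a slab; the
    formulas on slabs do the rest. *)
Lemma solution_on_slab n : (n < N)%N ->
  exists (p0 chi phib' mu' p' : fn) (q0 w ub' : vf),
  [/\ [/\ V p0, V chi, V phib', V mu' & Q p'],
      [/\ forall i, V (q0 i), forall i, V (w i) & forall i, V (ub' i)],
      slab_scheme Om T N V Q gamma b eta f n p0 chi phib' mu' q0 w ub' p',
      forall i, aeq Om (ub' i) ((2^-1 *: w + q0) i) &
      [/\ phi (tgrid n) = p0 /\ phi (tgrid n.+1) = chi + p0,
          u (tgrid n) = q0 /\ u (tgrid n.+1) = w + q0 &
          forall s, in_slab n s -> [/\ phib s = phib', mu s = mu' & ub s = ub']]].
Proof.
move=> nN; have nN' : (1 <= n.+1 <= N)%N by [].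
have [chi [p0 [Vchi Vp0 phiE phi1 phi2]]] := Pk1P T0 N0 sV (sol_phi sol) nN.
have [phib' Vphib phibE] := Pk0P (sol_phib sol).1 nN.
have [mu' Vmu muE] := Pk0P (sol_mu sol) nN.
have [p' Qp pE] := Pk0P (sol_p sol) nN.
have [w wP] := boolp.choice (fun i => Pk1P T0 N0 sV (sol_u sol i) nN).
have [q0 q0P] := boolp.choice wP.
have Vw i : V (w i) by have [] := q0P i.
have Vq0 i : V (q0 i) by have [] := q0P i.
have uE i s : in_slab n s -> u s i = local_time n s *: w i + q0 i by have [_ _ h _ _] := q0P i; exact: h.
have hub i : exists c, V c /\ forall s, in_slab n s -> ub s i = c.
  by have [c Vc cE] := Pk0P (sol_ub sol i).1 nN; exists c.
have [ub' ubP] := boolp.choice hub.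
have Vub i : V (ub' i) by have [] := ubP i.
have ubE i s : in_slab n s -> ub s i = ub' i by have [_] := ubP i; exact.
exists p0, chi, phib', mu', p', q0, w, ub'; split => //.
- split.
  + move=> psi Vpsi; have := sol_eq_phi sol (Pk_cst Vpsi) nN'.
    rewrite (slab_dt T0 N0 sV Vb Vchi phiE Vpsi (psi := fun=> psi) (fun _ _ => erefl)).
    rewrite (slab_transport T0 N0 sV VH1 Vb Vp0 Vchi Vub phiE ubE Vpsi (psi := fun=> psi) (fun _ _ => erefl)).
    by rewrite (slab_mobility T0 N0 VH1 Vb cb Vphib Vmu phibE muE Vpsi (psi := fun=> psi) (fun _ _ => erefl)).
  + move=> xi Vxi; have := sol_eq_mu sol (Pk_cst Vxi) nN'.
    rewrite (@slab_mu _ _ Om _ _ T0 N0 n mu mu' muE (fun=> xi) xi (fun _ _ => erefl)).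
    rewrite (slab_gradient T0 N0 sV VH1 Vp0 Vchi phiE Vxi (psi := fun=> xi) (fun _ _ => erefl)).
    by rewrite (slab_chemical Vb C1f' Vp0 Vchi phiE Vxi (psi := fun=> xi) (fun _ _ => erefl)).
  + move=> v Vv; have Pv : Pkv T N 0 V (fun=> v) by move=> i; exact: Pk_cst.
    have := sol_eq_u sol Pv nN'.
    rewrite (slab_dtv T0 N0 sV Vb Vw uE Vv (v := fun=> v) (fun _ _ _ => erefl)).
    rewrite (slab_skw T0 N0 sV VH1 Vb Vq0 Vw Vub uE ubE Vv (v := fun=> v) (fun _ _ _ => erefl)).
    rewrite (slab_viscosity T0 N0 VH1 Vb ceta Vphib Vub phibE ubE Vv (v := fun=> v) (fun _ _ _ => erefl)).
    rewrite (@slab_pressure _ _ Om _ _ T0 N0 n p p' pE (fun=> v) v (fun _ _ _ => erefl)).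
    by rewrite (slab_capillary T0 N0 sV VH1 Vb Vp0 Vchi Vmu phiE muE Vv (v := fun=> v) (fun _ _ _ => erefl)).
  + move=> q Qq; have := sol_eq_div sol (Pk_cst Qq) nN'.
    by rewrite (slab_div T0 N0 sV VH1 Qsq Vq0 Vw uE Qq (q := fun=> q) (fun _ _ => erefl)).
- move=> i.
  exact: (projection_midpoint T0 N0 sV Vb nN (sol_ub sol i) (Vw i) (Vq0 i) (Vub i) (uE i) (ubE i)).
- split => //.
    by split; apply/funext => i; have [_ _ _ e1 e2] := q0P i.
  by move=> s h; split; [exact: phibE|exact: muE|apply/funext => i; exact: ubE].
Qed.

Let V1 : V (fun=> 1) := Vh_cst Om M 1.

Lemma solution_mass n : (n < N)%N -> intO Om (phi (tgrid n.+1)) = intO Om (phi (tgrid n)).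
Proof.
move=> /solution_on_slab[p0 [chi [phib' [mu' [p' [q0 [w [ub' H]]]]]]]].
have [[Vp0 Vchi Vphib Vmu Qp] [Vq0 Vw Vub] sch _ [[-> ->] _ _]] := H.
exact: (mass_step sV VH1 Vb V1 cb Vp0 Vchi Vphib Vmu Vub sch).
Qed.

Let diss s := dissipation Om b eta (phib s) (mu s) (ub s).

Lemma solution_energy n : (n < N)%N ->
  exists2 D : R, (forall s, in_slab n s -> diss s = D) &
  energy Om gamma f (phi (tgrid n.+1)) (u (tgrid n.+1)) + tau * D
    = energy Om gamma f (phi (tgrid n)) (u (tgrid n)).
Proof.
move=> /solution_on_slab[p0 [chi [phib' [mu' [p' [q0 [w [ub' H]]]]]]]].
have [[Vp0 Vchi Vphib Vmu Qp] [Vq0 Vw Vub] sch mid [[-> ->] [-> ->] H2]] := H.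
exists (dissipation Om b eta phib' mu' ub').
  by move=> s /H2[e1 e2 e3]; rewrite /diss e1 e2 e3.
exact: (energy_step T0 N0 sV VH1 Vb Qsq cb ceta C1f C1f' Vp0 Vchi Vphib Vmu Qp Vq0 Vw Vub sch mid).
Qed.

Theorem solution_balance m n : (m <= n <= N)%N ->
  intO Om (phi (tgrid n)) = intO Om (phi (tgrid m)) /\
  energy Om gamma f (phi (tgrid n)) (u (tgrid n))
  + \int[lebesgue_measure]_(s in `[tgrid m, tgrid n]) diss s
  = energy Om gamma f (phi (tgrid m)) (u (tgrid m)).
Proof.
move=> /andP[mn nN].
have [|_ ->] := @slabs_sum _ T N T0 N0 m n diss mn.
  move=> k /andP[_ kn]; have [D DE _] := solution_energy (leq_trans kn nN).
  by exists (fun=> D) => //; exact: cst_continuous.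
elim: n mn nN => [|n IH] mn nN.
  by move: mn; rewrite leqn0 => /eqP ->; rewrite big_geq // addr0.
move: mn; rewrite leq_eqVlt => /orP[/eqP ->|mn]; first by rewrite big_geq // addr0.
have [<- <-] := IH mn (ltnW nN).
have [D DE <-] := solution_energy nN.
rewrite (solution_mass nN) big_nat_recr //= (slab_cst T0 N0 DE); split => //.
by rewrite addrAC addrA.
Qed.

End solutions.

(** * Interpolation in time *)

Section interpolation.
Context {R : realType} {d : nat} (T : R) (N : nat).
Hypotheses (T0 : 0 < T) (N0 : (0 < N)%N).
Local Notation fn := ('rV[R]_d -> R).
Local Notation tau := (T / N%:R).
Local Notation in_slab := (in_slab T N).
Local Notation local_time := (local_time T N).
Let tau0 : 0 < tau := step_gt0 T0 N0.
Let tau_neq0 : tau != 0. Proof. by rewrite gt_eqF. Qed.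

Definition step_function (A : Type) (x : nat -> A) (t : R) := x (Num.truncn (t / tau)).

Let slab_scaled n t : in_slab n t -> n%:R < t / tau < n.+1%:R.
Proof. by rewrite /in_slab /tgrid ltr_pdivlMr // ltr_pdivrMr. Qed.

Lemma step_functionE (A : Type) (x : nat -> A) n t : in_slab n t -> step_function x t = x n.
Proof.
move=> /slab_scaled /andP[h1 h2]; rewrite /step_function; congr x.
by apply: truncn_def; rewrite (ltW h1).
Qed.

Lemma step_function_Pk0 (X : fn -> Prop) x : (forall n, X (x n)) -> Pk T N 0 X (step_function x).
Proof.
move=> Xx; split => [t _|n _]; first exact: Xx.
exists (fun=> x n); split => // t y ty.
by rewrite big_ord1 expr0 mul1r (step_functionE x ty).
Qed.

(** It is 0 before the slab k, 1 after it, and affine inside. Summing increments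
    with ramps gives continuity in time without a discussion at the grid points. *)
Definition ramp k (t : R) : R := Num.min 1 (Num.max 0 (t / tau - k%:R)).

Definition interpolant (dx : nat -> fn) (x0 : fn) (t : R) : fn :=
  \sum_(0 <= k < N) ramp k t *: dx k + x0.

Lemma ramp_continuous k : continuous (ramp k).
Proof.
have c0 : continuous (fun t : R => t / tau - k%:R).
  move=> t; have h : r / tau @[r --> t] --> t / tau by exact: (cvgM cvg_id (cvg_cst tau^-1)).
  exact: (cvgB h (cvg_cst (k%:R : R))).
have c1 : continuous (fun t : R => Num.max 0 (t / tau - k%:R)).
  have hm : continuous ((fun=> 0 : R) \max (fun t : R => t / tau - k%:R)).
    by move=> t; apply: continuous_max; [exact: cst_continuous|exact: c0].
  exact: hm.
have hm : continuous ((fun=> 1 : R) \min (fun t : R => Num.max 0 (t / tau - k%:R))).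
  by move=> t; apply: continuous_min; [exact: cst_continuous|exact: c1].
exact: hm.
Qed.

Lemma interpolant0 dx x0 : interpolant dx x0 0 = x0.
Proof.
rewrite /interpolant big1 ?add0r // => k _; rewrite /ramp mul0r sub0r.
have k0 : - (k%:R : R) <= 0 by rewrite oppr_le0.
by rewrite (max_idPl k0) (min_idPr ler01) scale0r.
Qed.

Lemma interpolantE dx (x : nat -> fn) n t : (forall k, x k.+1 = dx k + x k) -> (n < N)%N ->
  in_slab n t -> interpolant dx (x 0%N) t = local_time n t *: dx n + x n.
Proof.
move=> xS nN nt; have /andP[h1 h2] := slab_scaled nt.
have lt_n : local_time n t = t / tau - n%:R.
  by rewrite /local_time /tgrid mulrBl mulfK.
have xn : \sum_(0 <= k < n) dx k + x 0%N = x n.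
  elim: (n) => [|j IH]; first by rewrite big_geq // add0r.
  by rewrite big_nat_recr //= xS -IH addrAC addrC addrA.
have tail : \sum_(n.+1 <= k < N) ramp k t *: dx k = 0.
  rewrite big_nat big1 // => k /andP[nk _].
  have k0 : t / tau - k%:R <= 0.
    by rewrite subr_le0; apply: le_trans (ltW h2) _; rewrite ler_nat.
  by rewrite /ramp (max_idPl k0) (min_idPr ler01) scale0r.
rewrite /interpolant (big_cat_nat (n := n)) //=; last exact: ltnW.
rewrite (big_ltn nN) tail.
have -> : ramp n t = local_time n t.
  rewrite /ramp lt_n (max_idPr _) ?subr_ge0 ?ltW // (min_idPr _) //.
  by move: h2; rewrite -natr1; lra.
have -> : \sum_(0 <= k < n) ramp k t *: dx k = \sum_(0 <= k < n) dx k.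
  apply: eq_big_nat => k /andP[_ kn]; rewrite /ramp.
  have k1 : 1 <= t / tau - k%:R.
    have : k.+1%:R <= n%:R :> R by rewrite ler_nat.
    by rewrite -natr1; lra.
  by rewrite (max_idPr _) ?(min_idPl k1) ?scale1r //; exact: le_trans ler01 k1.
by rewrite addr0 -xn [X in X + x 0%N = _]addrC -addrA.
Qed.

Lemma interpolant_Pkc (X : fn -> Prop) dx (x : nat -> fn) : submodule X ->
  (forall k, x k.+1 = dx k + x k) -> (forall n, X (dx n)) -> (forall n, X (x n)) ->
  Pkc T N 1 X (interpolant dx (x 0%N)).
Proof.
move=> sX xS Xdx Xx; split; first split.
- by move=> t _; apply: submoduleD => //; exact: submodule_sum.
- move=> n nN; exists (fun j => if j == ord0 then - (tgrid T N n / tau) *: dx n + x n else tau^-1 *: dx n).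
  split=> [j|t y ty].
    by case: ifP => _; [exact: sX.2|exact: submoduleZ].
  rewrite (interpolantE xS nN ty) big_ord_recl big_ord1 /= expr0 expr1 mul1r.
  change ((t - tgrid T N n) / tau * dx n y + x n y = - (tgrid T N n / tau) * dx n y + x n y + t * (tau^-1 * dx n y)).
  by move: (x n y) (dx n y) (tau^-1) (tgrid _ _ _) => a1 a2 a3 a4; ring.
- move=> y; apply: continuous_subspaceT.
  rewrite (_ : (fun t => _) = fun t => \sum_(0 <= k < N) ramp k t * dx k y + x 0%N y).
    have cs : continuous (fun t => \sum_(0 <= k < N) ramp k t * dx k y).
      apply: continuous_big => [|k _]; first exact: add_continuous.
      by move=> t; have c1 := @ramp_continuous k t; exact: (cvgM c1 (cvg_cst (dx k y))).
    by move=> t; have c1 := cs t; exact: (cvgD c1 (cvg_cst (x 0%N y))).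
  apply/funext => t; change ((\sum_(0 <= k < N) ramp k t *: dx k) y + x 0%N y = \sum_(0 <= k < N) ramp k t * dx k y + x 0%N y).
  by rewrite fct_sumE.
Qed.

End interpolation.

(** * Existence of solutions *)

Section existence.
Context {R : realType} {d : nat} (Om : cube R d) (M : mesh R d) (T : R) (N : nat).
Hypotheses (T0 : 0 < T) (N0 : (0 < N)%N).
Hypothesis cover : \bigcup_i @cell R d M i = cube_set Om.
Local Notation fn := ('rV[R]_d -> R).
Local Notation vf := ('I_d -> 'rV[R]_d -> R).
Local Notation V := (Vh Om M).
Local Notation Q := (Qh Om M).
Local Notation Z := (Zh Om M).
Local Notation tau := (T / N%:R).
Local Notation tgrid := (tgrid T N).
Local Notation in_slab := (in_slab T N).
Local Notation local_time := (local_time T N).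
Variables (gamma b1 : R) (b eta f : R -> R).
Hypotheses (gamma0 : 0 < gamma) (b10 : 0 < b1).
Hypotheses (C1b : C1 b) (C1eta : C1 eta) (C1f : C1 f) (C1f' : C1 (derive1 f)).
Hypotheses (b_ge : forall s, b1 <= b s) (eta_ge0 : forall s, 0 <= eta s).
Hypothesis f_ge0 : forall s, 0 <= f s.

Let VH1 v : V v -> H1 Om v. Proof. by case. Qed.
Let Vb v : V v -> bdd Om v. Proof. exact: Vh_bdd. Qed.
Let sV : submodule V := Vh_submodule Om M.
Let fV : fin_span V := Vh_fin_span cover.
Let sQ : submodule Q := Qh_submodule Om M.
Let fQ : fin_span Q := Qh_fin_span cover.
Let Qsq q : Q q -> sq Om q. Proof. by case=> _ /H1_sq. Qed.
Let tau0 : 0 < tau := step_gt0 T0 N0.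
Let tau_neq0 : tau != 0. Proof. by rewrite gt_eqF. Qed.
Let Vsq v : V v -> sq Om v. Proof. by move=> /VH1/H1_sq. Qed.
Let sZ : submodule Z. Proof. exact: (divfree_submodule sV VH1 Qsq). Qed.

Definition slab_solution n (P0 : fn) (U0 : vf) (chi mu : fn) (w : vf) (p : fn) :=
  [/\ V chi, V mu, Z w, Q p &
    slab_scheme Om T N V Q gamma b eta f n P0 chi (2^-1 *: chi + P0) mu
      U0 w (2^-1 *: w + U0) p].

(** The step gives the mean velocity; the increment is twice its distance to the
    initial one. *)
Lemma slab_solution_exists n P0 U0 : V P0 -> Z U0 ->
  exists chi mu w p, slab_solution n P0 U0 chi mu w p.
Proof.
move=> VP0 ZU0; have [VU0 _] := ZU0.
have [chi [mu [v [p H]]]] := step_solution sV fV VH1 Vb sQ fQ Qsq gamma0 b10 C1b C1eta C1f C1f'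
  b_ge eta_ge0 f_ge0 (tgrid n) tau0 VP0 VU0.
have {H}[Vchi Vmu Zv Qp [e1 e2 e3]] := H.
have wE : 2^-1 *: (2 *: (v - U0)) + U0 = v.
  by rewrite scalerA mulVf ?scale1r ?subrK // pnatr_eq0.
exists chi, mu, (2 *: (v - U0)), p; split; [exact: Vchi|exact: Vmu| |exact: Qp|].
  by apply: (submoduleZ _ sZ); exact: (submoduleB sZ Zv ZU0).
rewrite /slab_scheme; cbv zeta; rewrite !wE; split; first exact: e1.
- move=> xi Vxi; have := congr1 (fun r => tau * r) (e2 _ Vxi); rewrite mulrDr (mulVKf tau_neq0).
  by rewrite (mulrCA tau gamma).
- move=> w Vw; apply: etrans (e3 _ Vw); rewrite mulr_sumr; apply: eq_bigr => i _.
  have Vd : V (v i - U0 i) by apply: (submoduleB sV); [apply Zv|exact: VU0].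
  exact: (linear_onZ 2 sV (ip_lin_l Vb (Vsq (Vw i))) Vd).
- by move=> q Qq; rewrite (proj2 Zv) // mulr0.
Qed.

(** Dependent choice: the fields at the end of a slab are the data of the next one,
    and discrete incompressibility is inherited because the mean velocity of the
    slab is divergence-free. *)
Lemma slab_solutions P0 U0 : V P0 -> Z U0 ->
  exists (P chi mu p : nat -> fn) (U w : nat -> vf),
  [/\ P 0%N = P0, U 0%N = U0,
      forall n, P n.+1 = chi n + P n /\ U n.+1 = w n + U n,
      forall n, V (P n) /\ Z (U n) &
      forall n, slab_solution n (P n) (U n) (chi n) (mu n) (w n) (p n)].
Proof.
move=> VP0 ZU0.
have step (x : nat * fn * vf) : exists y : fn * fn * vf * fn, V x.1.2 -> Z x.2 ->
    slab_solution x.1.1 x.1.2 x.2 y.1.1.1 y.1.1.2 y.1.2 y.2.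
  have [VZ|nVZ] := pselect (V x.1.2 /\ Z x.2); last first.
    by exists (0, 0, 0, 0) => h1 h2; case: nVZ.
  have [chi [mu [w [p H]]]] := slab_solution_exists x.1.1 VZ.1 VZ.2.
  by exists (chi, mu, w, p) => _ _.
have [g gP] := boolp.choice step.
pose st := fix st n : fn * vf := if n is k.+1 then
  let y := g (k, (st k).1, (st k).2) in (y.1.1.1 + (st k).1, y.1.2 + (st k).2) else (P0, U0).
pose y n := g (n, (st n).1, (st n).2).
have stS n : st n.+1 = ((y n).1.1.1 + (st n).1, (y n).1.2 + (st n).2) by [].
have inv n : V (st n).1 /\ Z (st n).2.
  elim: n => [//|n [Vn Zn]]; rewrite stS; have [Vc _ Zw _ _] := gP (n, (st n).1, (st n).2) Vn Zn.
  by split; [exact: (submoduleD sV Vc Vn)|exact: (submoduleD sZ Zw Zn)].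
exists (fun n => (st n).1), (fun n => (y n).1.1.1), (fun n => (y n).1.1.2), (fun n => (y n).2),
  (fun n => (st n).2), (fun n => (y n).1.2).
split; [by []|by []| |exact: inv|] => n.
  by have h := stS n; split; [exact: (congr1 fst h)|exact: (congr1 snd h)].
by have [Vn Zn] := inv n; exact: (gP (n, (st n).1, (st n).2) Vn Zn).
Qed.

Theorem solution_exists phi0 u0 : H1 Om phi0 -> (forall i, H1 Om (u0 i)) ->
  exists phi phib mu u ub p,
    is_solution Om M T N gamma b f eta phi0 u0 phi phib mu u ub p.
Proof.
move=> Hphi0 Hu0.
have [P0 P0P] := pi1h_exists cover Hphi0; have [U0 U0P] := P1h_exists cover Hu0.
have [P [chi [mu [p [U [w [eP eU S VZ H]]]]]]] := slab_solutions P0P.1 U0P.1.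
have cb := C1_continuous C1b; have ceta := C1_continuous C1eta.
have PS n : P n.+1 = chi n + P n by case: (S n).
have US i n : U n.+1 i = w n i + U n i by case: (S n) => _ ->.
have VP n : V (P n) by case: (VZ n).
have VU n i : V (U n i) by case: (VZ n) => _ [h _]; exact: h.
have Vchi n : V (chi n) by case: (H n).
have Vmu n : V (mu n) by case: (H n).
have Vw n i : V (w n i) by case: (H n) => _ _ [h _] _ _; exact: h.
have Qp n : Q (p n) by case: (H n).
pose m n := 2^-1 *: chi n + P n; pose um n : vf := 2^-1 *: w n + U n.
have Vm n : V (m n) by exact: (sV.2 2^-1 _ _ (Vchi n) (VP n)).
have Vum n i : V (um n i) by exact: (sV.2 2^-1 _ _ (Vw n i) (VU n i)).
pose phi := interpolant T N chi (P 0%N).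
pose u (t : R) : vf := fun i => interpolant T N (fun n => w n i) (U 0%N i) t.
pose phib := step_function T N m; pose ub := step_function T N um.
pose muf := step_function T N mu; pose pf := step_function T N p.
have phiE n s : (n < N)%N -> in_slab n s -> phi s = local_time n s *: chi n + P n.
  by move=> nN; exact: (interpolantE T0 N0 PS nN).
have uE n i s : (n < N)%N -> in_slab n s -> u s i = local_time n s *: w n i + U n i.
  by move=> nN; exact: (interpolantE T0 N0 (x := fun n => U n i) (US i) nN).
have phibE n s : in_slab n s -> phib s = m n by exact: step_functionE.
have ubE n s : in_slab n s -> ub s = um n by exact: step_functionE.
have ubE' n i s : in_slab n s -> ub s i = um n i by move=> h; rewrite (ubE _ _ h).
have muE n s : in_slab n s -> muf s = mu n by exact: step_functionE.
have pE n s : in_slab n s -> pf s = p n by exact: step_functionE.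
exists phi, phib, muf, u, ub, pf; split.
- exact: (interpolant_Pkc T0 N0 sV PS Vchi VP).
- exact: (step_function_Pk0 T0 N0 Vmu).
- by move=> i; exact: (interpolant_Pkc T0 N0 (x := fun n => U n i) sV (US i) (fun n => Vw n i) (fun n => VU n i)).
- exact: (step_function_Pk0 T0 N0 Qp).
- apply: (midpoint_projection T0 N0 sV Vb (step_function_Pk0 T0 N0 Vm) (fun n _ => conj (Vchi n) (VP n)) phiE).
  by move=> n s _; exact: phibE.
- move=> i; apply: (midpoint_projection T0 N0 sV Vb _ (fun n _ => conj (Vw n i) (VU n i)) (fun n s => uE n i s)).
    exact: (step_function_Pk0 T0 N0 (fun n => Vum n i)).
  by move=> n s _; exact: ubE'.
- by rewrite /phi interpolant0 eP.
- have -> : u 0 = U0; last exact: U0P.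
  by apply/funext => i; rewrite /u interpolant0 eU.
- move=> psi [//|n] Ppsi nN; have [c Vc cE] := Pk0P Ppsi nN; have [_ _ _ _ [e1 _ _ _]] := H n.
  have pE' := fun s => phiE n s nN.
  rewrite (slab_dt T0 N0 sV Vb (Vchi n) pE' Vc cE).
  rewrite (slab_transport T0 N0 sV VH1 Vb (VP n) (Vchi n) (Vum n) pE' (ubE' n) Vc cE).
  rewrite (slab_mobility T0 N0 VH1 Vb cb (Vm n) (Vmu n) (phibE n) (muE n) Vc cE).
  exact: e1.
- move=> xi [//|n] Pxi nN; have [c Vc cE] := Pk0P Pxi nN; have [_ _ _ _ [_ e2 _ _]] := H n.
  have pE' := fun s => phiE n s nN.
  rewrite (slab_mu Om T0 N0 (muE n) cE).
  rewrite (slab_gradient T0 N0 sV VH1 (VP n) (Vchi n) pE' Vc cE).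
  rewrite (slab_chemical Vb C1f' (VP n) (Vchi n) pE' Vc cE).
  exact: e2.
- move=> v [//|n] Pv nN; have [_ _ _ _ [_ _ e3 _]] := H n.
  have hv i : exists c, V c /\ forall s, in_slab n s -> v s i = c.
    by have [c Vc cE] := Pk0P (Pv i) nN; exists c.
  have [c cP] := boolp.choice hv.
  have Vc i : V (c i) by case: (cP i).
  have cE i s : in_slab n s -> v s i = c i by case: (cP i) => _; exact.
  have pE' := fun s => phiE n s nN; have uE' := fun i s => uE n i s nN.
  rewrite (slab_dtv T0 N0 sV Vb (Vw n) uE' Vc cE).
  rewrite (slab_skw T0 N0 sV VH1 Vb (VU n) (Vw n) (Vum n) uE' (ubE' n) Vc cE).
  rewrite (slab_viscosity T0 N0 VH1 Vb ceta (Vm n) (Vum n) (phibE n) (ubE' n) Vc cE).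
  rewrite (slab_pressure Om T0 N0 (pE n) cE).
  rewrite (slab_capillary T0 N0 sV VH1 Vb (VP n) (Vchi n) (Vmu n) pE' (muE n) Vc cE).
  exact: e3.
- move=> q [//|n] Pq nN; have [c Qc cE] := Pk0P Pq nN; have [_ _ _ _ [_ _ _ e4]] := H n.
  have uE' := fun i s => uE n i s nN.
  rewrite (slab_div T0 N0 sV VH1 Qsq (VU n) (Vw n) uE' Qc cE).
  exact: e4.
Qed.

End existence.

Theorem theorem4 (R : realType)
  (T : R) (hT : 0 < T)
  (* (A0) *)
  (d : nat) (hd : d = 2%N \/ d = 3%N) (Om : cube R d)
  (* (A1) *)
  (gamma : R) (hgamma : 0 < gamma)
  (* (A2) *)
  (b : R -> R) (b1 b2 b3 b4 : R) (hbC : classCk 2 b) (hb1 : 0 < b1)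
  (hb : forall s, b1 <= b s <= b2)
  (hb3 : forall s, `|derive1 b s| <= b3) (hb4 : forall s, `|derive1n 2 b s| <= b4)
  (* (A3) *)
  (f : R -> R) (f1 : R) (f2 f3 : nat -> R) (hfC : classCk 4 f)
  (hf0 : forall s, 0 <= f s) (hf1 : 0 <= f1)
  (hf2 : forall s, - f1 <= derive1n 2 f s)
  (hf3 : forall k s, (k <= 4)%N -> `|derive1n k f s| <= f2 k + f3 k * `|s| ^+ (4 - k))
  (* (A4) *)
  (eta : R -> R) (eta1 eta2 eta3 eta4 : R) (hetaC : classCk 2 eta)
  (heta1 : 0 < eta1) (heta : forall s, eta1 <= eta s <= eta2)
  (heta3 : forall s, `|derive1 eta s| <= eta3)
  (heta4 : forall s, `|derive1n 2 eta s| <= eta4)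
  (* (A5) *)
  (M : mesh R d) (sigma h : R) (hsigma : 0 < sigma) (hh : 0 < h)
  (hM : conforming_partition Om M) (hMq : quasi_uniform M sigma h)
  (* (A6) *)
  (N : nat) (hN : (0 < N)%N)
  (phi0 : 'rV[R]_d -> R) (u0 : 'I_d -> 'rV[R]_d -> R)
  (hphi0 : H1 Om phi0) (hu0 : forall i, H1 Om (u0 i)) :
  (exists phi phib mu u ub p,
    is_solution Om M T N gamma b f eta phi0 u0 phi phib mu u ub p) /\
  (forall phi phib mu u ub p,
    is_solution Om M T N gamma b f eta phi0 u0 phi phib mu u ub p ->
    forall m n, (m <= n <= N)%N ->
      intO Om (phi (tgrid T N n)) = intO Om (phi (tgrid T N m)) /\
      energy Om gamma f (phi (tgrid T N n)) (u (tgrid T N n))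
      + \int[lebesgue_measure]_(s in `[tgrid T N m, tgrid T N n])
          dissipation Om b eta (phib s) (mu s) (ub s)
      = energy Om gamma f (phi (tgrid T N m)) (u (tgrid T N m))).
Proof.
have [cover _ _] := hM.
have C1b := classCk_C1 hbC; have C1eta := classCk_C1 hetaC; have C1f := classCk_C1 hfC.
have C1f' := classCk_C1 (classCk_derive1 hfC).
split.
  apply: (solution_exists hT hN _ hgamma hb1 C1b C1eta C1f C1f') => //.
  - by case: hM.
  - by move=> s; case/andP: (hb s).
  - by move=> s; case/andP: (heta s) => e1 _; exact: le_trans (ltW heta1) e1.
move=> phi phib mu u ub p sol m n mn; case: hM => _ cov _.
exact: (solution_balance hT hN cov (C1_continuous C1b) (C1_continuous C1eta) C1f C1f' sol mn).
Qed.
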